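(* For a rational function $R \in \mathbb{C}_p(z)$ of degree at least two the following properties are equivalent. (1) $F(R) = \mathcal{A}'(R) \sqcup \mathcal{E}'(R)$. (2) The Fatou set $F(R)$ has no wandering components.
   Context: $p$ is a prime, $\mathbb{C}_p$ is the completion of an algebraic closure of $\mathbb{Q}_p$, $|\cdot|$ its norm, $\mathbb{P}(\mathbb{C}_p) = \mathbb{C}_p \cup \{\infty\}$, and $\Delta$ is the chordal distance, $\Delta([x,y],[x',y']) = |xy'-x'y| / (\max\{|x|,|y|\}\max\{|x'|,|y'|\})$. For $a \in \mathbb{C}_p$ and $r \in |\mathbb{C}_p^*|$, $\{|z-a|<r\}$ is an open ball and $\{|z-a|\le r\}$ a closed ball of $\mathbb{C}_p$. An open ball of $\mathbb{P}(\mathbb{C}_p)$ is an open ball of $\mathbb{C}_p$ or the complement in $\mathbb{P}(\mathbb{C}_p)$ of a closed ball of $\mathbb{C}_p$. An open affinoid is a nonempty finite intersection of open balls. For $U \subset \mathbb{P}(\mathbb{C}_p)$ open and $x \in U$, the analytic component of $U$ containing $x$ is the union of all open affinoids $X \subset U$ containing $x$. The Fatou set $F(R)$ is the set of points having a neighbourhood $X$ such that $\bigcup_{n\ge 0} R^n(X)$ omits at least 3 points of $\mathbb{P}(\mathbb{C}_p)$. For $x \in F(R)$, the component of $F(R)$ containing $x$ is the union of all open affinoids $X \subset F(R)$ containing $x$ such that $\bigcup_{n \ge 0} R^n(X)$ omits at least 3 points. The image under $R$ of a component of $F(R)$ is a component of $F(R)$; a component $C$ is wandering if the components $R^n(C)$,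 $n\ge0$, are pairwise disjoint. A periodic point $z_0$ with $R^n(z_0)=z_0$ ($n$ its primitive period) is attracting if its multiplier $(R^n)'(z_0)$ has norm $<1$. Its basin of attraction is the set of $x$ with $\Delta(R^n(x),R^n(z_0)) \to 0$ as $n\to\infty$, and its immediate basin is the analytic component of its basin that contains $z_0$. $\mathcal{A}(R)$ is the union of the immediate basins of attraction of $R$. $\mathcal{E}(R)$, the quasi-periodicity domain, is the interior of the set of points recurrent under $R$ (i.e. $x$ is the limit of $R^{n_j}(x)$ for some $n_j\to\infty$). $\mathcal{A}'(R) = \bigcup_{n\ge0}R^{-n}(\mathcal{A}(R))$ and $\mathcal{E}'(R)=\bigcup_{n\ge0}R^{-n}(\mathcal{E}(R))$; these two sets are disjoint. *)

(* Defs.v *)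
From HB Require Import structures.
From mathcomp Require Import all_boot all_order all_algebra.
From mathcomp Require Import all_classical all_reals all_analysis.

Set Implicit Arguments.
Unset Strict Implicit.
Unset Printing Implicit Defensive.

Import Order.TTheory GRing.Theory Num.Theory.
Import numFieldNormedType.Exports.

Local Open Scope classical_set_scope.
Local Open Scope ring_scope.

(* MathComp-Analysis norms live on modules over ordered fields, which excludes
   C_p; hence absolute values are real-valued functions v : K -> R. *)
Section AbsoluteValues.
Variable R : realType.

Definition ultrametric_abs (K : fieldType) (v : K -> R) : Prop :=
  [/\ forall x, 0 <= v x,
      forall x, v x = 0 <-> x = 0,
      forall x y, v (x * y) = v x * v y &
      forall x y, v (x + y) <= Num.max (v x) (v y)].

Definition complete_abs (K : fieldType) (v : K -> R) : Prop :=
  forall u : nat -> K,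
    (forall e : R, 0 < e ->
       exists N, forall m n, (N <= m)%N -> (N <= n)%N -> v (u m - u n) < e) ->
    exists l : K, (fun n => v (u n - l)) @ \oo --> (0 : R).

Definition is_completion (F K : fieldType) (vF : F -> R) (vK : K -> R)
    (i : {rmorphism F -> K}) : Prop :=
  [/\ ultrametric_abs vK,
      complete_abs vK,
      forall x, vK (i x) = vF x &
      forall (y : K) (e : R), 0 < e -> exists x : F, vK (y - i x) < e].

Definition padic_abs (p : nat) (x : rat) : R :=
  if x == 0 then 0
  else p%:R ^ ((logn p `|denq x|)%:Z - (logn p `|numq x|)%:Z).

(* (K, v) is the completion of an algebraic closure of the completion of
   (Q, |.|_p); this determines (K, v) up to isometric isomorphism. *)
Definition is_Cp (p : nat) (K : fieldType) (v : K -> R) : Prop :=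
  exists (Qp : fieldType) (vQp : Qp -> R) (i : {rmorphism rat -> Qp})
         (Qpbar : closedFieldType) (vbar : Qpbar -> R)
         (j : {rmorphism Qp -> Qpbar}) (k : {rmorphism Qpbar -> K}),
    [/\ is_completion (padic_abs p) vQp i,
        forall x : Qpbar, algebraicOver j x,
        ultrametric_abs vbar,
        forall x : Qp, vbar (j x) = vQp x &
        is_completion vbar v k].

End AbsoluteValues.

(* The projective line K \cup {\infty} is option K, with None the point at
   infinity. *)
Section RationalFunctions.
Variable K : fieldType.
Implicit Types (f : {fraction {poly K}}) (x : option K).

(* numerator and denominator in lowest terms (up to a common nonzero scalar) *)
Definition rnum f : {poly K} :=
  (frac (repr f)).1 %/ gcdp (frac (repr f)).1 (frac (repr f)).2.

Definition rden f : {poly K} :=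
  (frac (repr f)).2 %/ gcdp (frac (repr f)).1 (frac (repr f)).2.

Lemma rden_neq0 f : rden f != 0.
Proof.
rewrite /rden dvdp_div_eq0 ?dvdp_gcdr //; exact: denom_ratioP.
Qed.

Lemma coprimep_rnum_rden f : coprimep (rnum f) (rden f).
Proof.
by apply: coprimep_div_gcd; rewrite denom_ratioP orbT.
Qed.

Lemma rnum_rdenE f :
  f = FracField.tofrac (rnum f) / FracField.tofrac (rden f).
Proof.
have dn0 := rden_neq0 f.
apply: (canRL (mulfK _)); first by rewrite tofrac_eq0.
have d0 : (frac (repr f)).2 != 0 := denom_ratioP _.
have g0 : gcdp (frac (repr f)).1 (frac (repr f)).2 != 0.
  by rewrite gcdp_eq0 negb_and d0 orbT.
have Hn : rnum f * gcdp (frac (repr f)).1 (frac (repr f)).2 = (frac (repr f)).1.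
  by rewrite /rnum divpK // dvdp_gcdl.
have Hd : rden f * gcdp (frac (repr f)).1 (frac (repr f)).2 = (frac (repr f)).2.
  by rewrite /rden divpK // dvdp_gcdr.
have Hf : f * FracField.tofrac (frac (repr f)).2 = FracField.tofrac (frac (repr f)).1.
  rewrite -{1}[f]reprK; unlock FracField.tofrac.
  rewrite -[LHS]FracField.pi_mul; apply/eqP.
  rewrite FracField.equivf_def /FracField.mulf.
  by rewrite !numden_Ratio ?mulf_neq0 ?oner_eq0 //= !mulr1 mulrC.
apply: (mulIf (x := FracField.tofrac (gcdp (frac (repr f)).1 (frac (repr f)).2))).
  by rewrite tofrac_eq0.
by rewrite -mulrA -!tofracM Hd Hn.
Qed.

Definition rdeg f : nat := maxn (size (rnum f)).-1 (size (rden f)).-1.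

(* At infinity this evaluates the homogenizations, of degree rdeg f, of the
   numerator and the denominator at [1 : 0]. *)
Definition reval f x : option K :=
  if x is Some z then
    if (rden f).[z] == 0 then None else Some ((rnum f).[z] / (rden f).[z])
  else
    if (rden f)`_(rdeg f) == 0 then None
    else Some ((rnum f)`_(rdeg f) / (rden f)`_(rdeg f)).

Definition riter f (n : nat) : option K -> option K := iter n (reval f).

Definition inv_chart x : option K :=
  if x is Some z then (if z == 0 then None else Some z^-1) else Some 0.

End RationalFunctions.

Section Dynamics.
Variables (R : realType) (K : fieldType) (v : K -> R).
Implicit Types (x y z : option K) (X U C : set (option K)).

Definition hcoord x : K * K := if x is Some z then (z, 1) else (1, 0).

Definition chordal x y : R :=
  v ((hcoord x).1 * (hcoord y).2 - (hcoord y).1 * (hcoord x).2) /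
  (Num.max (v (hcoord x).1) (v (hcoord x).2) *
   Num.max (v (hcoord y).1) (v (hcoord y).2)).

Definition chordal_nbhs x X : Prop :=
  exists2 e : R, 0 < e & [set y | chordal x y < e] `<=` X.

Definition chordal_interior X : set (option K) := [set x | chordal_nbhs x X].

Definition chordal_cvg (u : nat -> option K) x : Prop :=
  (fun n => chordal (u n) x) @ \oo --> (0 : R).

Definition abs_radius (r : R) : Prop := exists2 c : K, c != 0 & r = v c.

Definition oball (a : K) (r : R) : set (option K) :=
  Some @` [set z | v (z - a) < r].

Definition cball (a : K) (r : R) : set (option K) :=
  Some @` [set z | v (z - a) <= r].

Definition open_ball B : Prop :=
  exists (a : K) (r : R),
    abs_radius r /\ (B = oball a r \/ B = ~` cball a r).

(* The intersected family is nonempty, so that the whole projective line is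
   not an open affinoid. *)
Definition open_affinoid X : Prop :=
  X !=set0 /\
  exists (n : nat) (B : 'I_n.+1 -> set (option K)),
    (forall i, open_ball (B i)) /\ X = \bigcap_i B i.

Definition analytic_component U x : set (option K) :=
  \bigcup_(X in [set X | [/\ open_affinoid X, X `<=` U & X x]]) X.

Definition omits_three X : Prop :=
  exists a b c : option K,
    [/\ a != b, b != c & a != c] /\ [/\ ~ X a, ~ X b & ~ X c].

Variable f : {fraction {poly K}}.

Definition forward_orbit X : set (option K) := \bigcup_n (riter f n @` X).

Definition Fatou : set (option K) :=
  [set x | exists2 X, chordal_nbhs x X & omits_three (forward_orbit X)].

Definition Fatou_component_at x : set (option K) :=
  \bigcup_(X in [set X | [/\ open_affinoid X, X `<=` Fatou, X x &
                             omits_three (forward_orbit X)]]) X.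

Definition Fatou_component C : Prop :=
  exists2 x, Fatou x & C = Fatou_component_at x.

Definition wandering C : Prop :=
  trivIset setT (fun n => riter f n @` C).

(* g takes the finite value w at the finite point z, and g'(z) = l *)
Definition has_derivative (g : option K -> option K) (z l : K) : Prop :=
  exists2 w : K, g (Some z) = Some w &
  forall e : R, 0 < e -> exists2 d : R, 0 < d &
    forall y : K, y != z -> v (y - z) < d ->
      exists2 u : K, g (Some y) = Some u & v ((u - w) / (y - z) - l) < e.

(* The multiplier at a fixed point of g; at infinity it is computed in the
   coordinate 1/z. *)
Definition has_multiplier (g : option K -> option K) x (l : K) : Prop :=
  if x is Some z then has_derivative g z l
  else has_derivative (@inv_chart K \o g \o @inv_chart K) 0 l.

Definition primitive_period x (n : nat) : Prop :=
  [/\ (0 < n)%N, riter f n x = x &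
      forall m, (0 < m < n)%N -> riter f m x <> x].

Definition attracting x : Prop :=
  exists n, primitive_period x n /\
    exists2 l : K, has_multiplier (riter f n) x l & v l < 1.

(* n runs over all of nat rather than over the multiples of the period, so this
   is the basin of the point x and not of its cycle. *)
Definition basin x : set (option K) :=
  [set y | (fun n => chordal (riter f n y) (riter f n x)) @ \oo --> (0 : R)].

Definition immediate_basin x : set (option K) := analytic_component (basin x) x.

Definition attracting_domain : set (option K) :=
  \bigcup_(x in attracting) immediate_basin x.

Definition recurrent x : Prop :=
  exists2 s : nat -> nat, s @ \oo --> \oo &
    chordal_cvg (fun j => riter f (s j) x) x.

Definition quasi_periodicity_domain : set (option K) :=
  chordal_interior recurrent.

Definition backward_orbit X : set (option K) := \bigcup_n (riter f n @^-1` X).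

End Dynamics.

(* Main.v *)
(* A rational map g satisfies
     Delta(g z, u) * \prod_b Delta(z, b) = C * Delta(g z, w) * \prod_a Delta(z, a),
   where a and b run through the fibres of u and w. Hence estimates on discs and
   affinoids reduce to a maximum principle for products of distances.

   Let R^m a = R^n b with m < n, for points a, b of affinoids around x whose
   orbits omit infinitely many points. If the iterates collapse some disc around
   x, then R^N x is close to R^N a and R^(N+n-m) x to R^(N+n-m) b = R^N a, so that
   R^N x approaches a fixed point of R^(n-m). This point is attracting or indifferent:
   near a repelling one the oscillation does not increase backwards in time,
   down to the first iterates. Otherwise, small discs around x have images of
   radius bounded below. Approximating the coefficients of R by elements of a
   finite extension of Q_p, whose integers are totally bounded, one sees that two
   of these images meet, which yields a disc trapped by an iterate of R. On such
   a disc the iterate is c z up to a strict contraction; |c| < 1 would collapse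
   it, and if |c| = 1 then suitable powers tend to the identity, so all points
   are recurrent.

   Conversely, a component attracted to a cycle or mapped into the
   quasi-periodicity domain has two iterated images that meet. *)
Require Import Defs.
From HB Require Import structures.
From mathcomp Require Import all_boot all_order all_algebra.
From mathcomp Require Import all_classical all_reals all_analysis.
From mathcomp Require Import ring lra zify fieldext.

Set Implicit Arguments.
Unset Strict Implicit.
Unset Printing Implicit Defensive.

Import Order.TTheory GRing.Theory Num.Theory.
Import numFieldNormedType.Exports.

Local Open Scope classical_set_scope.
Local Open Scope ring_scope.

(** * Ultrametric absolute values *)

(** All estimates have to hold for every iterate at once, so their constants must not depend on the
    degree. Two devices secure this. On a disc that omits a value w, the distances to the points of
    the fibre of w are constant, so the whole fibre drops out of the product formula. And from a
    fixed list of omitted values one extracts a value that is far from the values of the map at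
    finitely many test points; the list must be longer than the number of these points, which
    depends on the affinoid. This is why infinitely many omitted points are wanted. Preimages of
    omitted points are omitted, and a finite set of at least three points that contains its
    preimages would consist of totally ramified values, which characteristic 0 forbids. Since C_p is
    not locally compact, compactness cannot make two image discs meet. But an error smaller than all
    the radii does not lead out of an ultrametric disc, so the orbit of a perturbed map with
    coefficients in a finite extension of Q_p stays in the image discs, and there the pigeonhole
    principle applies. *)

Record ultraField (R : realType) := UltraField {
  uf_sort :> fieldType;
  uabs : uf_sort -> R;
  uabsP : ultrametric_abs uabs
}.

Section UltrametricAbs.
Variables (R : realType) (K : ultraField R).
Local Notation v := (@uabs R K).
Implicit Types x y z : K.

Lemma uabs_ge0 x : 0 <= v x. Proof. by case: (uabsP K). Qed.
Lemma uabs_eq0 x : (v x == 0) = (x == 0).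
Proof. by case: (uabsP K) => _ h _ _; apply/eqP/eqP => /h. Qed.
Lemma uabs0 : v 0 = 0. Proof. by apply/eqP; rewrite uabs_eq0. Qed.
Lemma uabsM x y : v (x * y) = v x * v y. Proof. by case: (uabsP K). Qed.
Lemma uabsD x y : v (x + y) <= Num.max (v x) (v y). Proof. by case: (uabsP K). Qed.
Lemma uabs_gt0 x : (0 < v x) = (x != 0).
Proof. by rewrite lt_def uabs_ge0 andbT uabs_eq0. Qed.
Lemma uabs1 : v 1 = 1.
Proof.
have h : v 1 != 0 by rewrite uabs_eq0 oner_neq0.
by apply: (mulfI h); rewrite -uabsM !mulr1.
Qed.
Lemma uabsN1 : v (-1) = 1.
Proof.
have h : v (-1) ^+ 2 = 1 by rewrite expr2 -uabsM mulrNN mulr1 uabs1.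
by apply/eqP; rewrite -(@pexpr_eq1 _ _ 2) ?uabs_ge0 // h.
Qed.
Lemma uabsN x : v (- x) = v x. Proof. by rewrite -mulN1r uabsM uabsN1 mul1r. Qed.
Lemma uabs_distC x y : v (x - y) = v (y - x). Proof. by rewrite -uabsN opprB. Qed.
Lemma uabsB x y : v (x - y) <= Num.max (v x) (v y).
Proof. by rewrite -(uabsN y) uabsD. Qed.
Lemma uabsX x n : v (x ^+ n) = v x ^+ n.
Proof. by elim: n => [|n IH]; rewrite ?expr0 ?uabs1 // !exprS uabsM IH. Qed.
Lemma uabsV x : v x^-1 = (v x)^-1.
Proof.
have [->|x0] := eqVneq x 0; first by rewrite invr0 uabs0 invr0.
have vx : v x != 0 by rewrite uabs_eq0.
by apply: (mulfI vx); rewrite -uabsM !divff // uabs1.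
Qed.
Lemma uabs_div x y : v (x / y) = v x / v y. Proof. by rewrite uabsM uabsV. Qed.
Lemma uabs_prod (I : Type) (s : seq I) (F : I -> K) :
  v (\prod_(i <- s) F i) = \prod_(i <- s) v (F i).
Proof. by elim: s => [|a s IH]; rewrite ?big_nil ?uabs1 // !big_cons uabsM IH. Qed.

Lemma uabsD_le x y c : v x <= c -> v y <= c -> v (x + y) <= c.
Proof. by move=> hx hy; apply: le_trans (uabsD _ _) _; rewrite ge_max hx. Qed.
Lemma uabsD_lt x y c : v x < c -> v y < c -> v (x + y) < c.
Proof. by move=> hx hy; apply: le_lt_trans (uabsD _ _) _; rewrite gt_max hx. Qed.
Lemma uabsB_le x y c : v x <= c -> v y <= c -> v (x - y) <= c.
Proof. by move=> hx hy; apply: uabsD_le; rewrite ?uabsN. Qed.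
Lemma uabsB_lt x y c : v x < c -> v y < c -> v (x - y) < c.
Proof. by move=> hx hy; apply: uabsD_lt; rewrite ?uabsN. Qed.
Lemma uabs_dist_le y x z c : v (x - y) <= c -> v (y - z) <= c -> v (x - z) <= c.
Proof. by move=> h1 h2; rewrite -(subrKA y); apply: uabsD_le. Qed.
Lemma uabs_dist_lt y x z c : v (x - y) < c -> v (y - z) < c -> v (x - z) < c.
Proof. by move=> h1 h2; rewrite -(subrKA y); apply: uabsD_lt. Qed.

Lemma uabsD_eqr x y : v x < v y -> v (x + y) = v y.
Proof.
move=> h; apply/eqP; rewrite eq_le; apply/andP; split.
  by apply: uabsD_le => //; exact: ltW.
rewrite leNgt; apply/negP => h2; suff: v y < v y by rewrite ltxx.
by rewrite -{1}(addKr x y) addrC; apply: uabsB_lt.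
Qed.
Lemma uabsD_eql x y : v y < v x -> v (x + y) = v x.
Proof. by rewrite addrC; exact: uabsD_eqr. Qed.
Lemma uabsB_eql x y : v y < v x -> v (x - y) = v x.
Proof. by move=> h; rewrite uabsD_eql ?uabsN. Qed.
Lemma uabsB_eqr x y : v x < v y -> v (x - y) = v y.
Proof. by move=> h; rewrite uabsD_eqr ?uabsN. Qed.
Lemma uabs_dist_eq x y z : v (x - y) < v (y - z) -> v (x - z) = v (y - z).
Proof. by move=> h; rewrite -(subrKA y x (- z)) (uabsD_eqr h). Qed.

Lemma uabs_sum_le (I : Type) (s : seq I) (F : I -> K) (C : R) : 0 <= C ->
  (forall i, v (F i) <= C) -> v (\sum_(i <- s) F i) <= C.
Proof.
move=> C0 hF; elim: s => [|a s IH]; first by rewrite big_nil uabs0.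
by rewrite big_cons; exact: uabsD_le.
Qed.

Lemma uabs_nat (n : nat) : v n%:R <= 1.
Proof.
elim: n => [|n IH]; first by rewrite uabs0 ler01.
by rewrite -[n.+1]addn1 natrD; apply: uabsD_le => //; rewrite uabs1.
Qed.

(* Discrete form of the maximum principle for the rational function
   \prod (z - a) / \prod (z - b): among the discs D(b, S b) around its poles,
   one can be reached by always descending to a residue class that contains
   at least as many poles as zeros. *)
Lemma max_principle (S : K -> R) (la lb : seq K) :
  (size la <= size lb)%N -> (0 < size lb)%N -> (forall b, b \in lb -> 0 < S b) ->
  exists2 b, b \in lb &
    forall T, S b <= T -> (forall c, c \in lb -> v (b - c) <= T) ->
    \prod_(c <- lb) Num.max (S b) (v (b - c)) <=
    T ^+ (size lb - size la) * \prod_(a <- la) Num.max (S b) (v (b - a)).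
Proof.
have arith (p q r s : nat) : (q <= p -> q + s <= p + r ->
    p - q + r = (p + r - (q + s)) + s)%N by lia.
have [n] := ubnP (size lb); elim: n la lb => // n IH la lb ltn hs lb0 hS.
have [[b0 b0l hb0]|hno] :=
    pselect (exists2 b, b \in lb & forall c, c \in lb -> v (b - c) <= S b).
  exists b0 => // T hT _; have S0 := hS _ b0l.
  rewrite (eq_big_seq (fun=> S b0)); last first.
    by move=> c /hb0 hc; apply/max_idPl.
  rewrite big_const_seq count_predT iter_mulr_1 -{1}(subnK hs) exprD.
  apply: ler_pM; rewrite ?exprn_ge0 ?(ltW S0) //.
    by rewrite lerXn2r // ?nnegrE ?(ltW S0) // (le_trans (ltW S0)).
  elim: (la) => [|a l IHl]; rewrite ?big_nil ?expr0 //= big_cons exprS.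
  by apply: ler_pM; rewrite ?exprn_ge0 ?(ltW S0) // le_max lexx.
have {hno} hno b : b \in lb -> exists2 c, c \in lb & S b < v (b - c).
  move=> bl; apply: contrapT => hc; apply: hno; exists b => // c cl.
  by rewrite leNgt; apply/negP => h; apply: hc; exists c.
have [b0 b0l] : exists b, b \in lb by case: (lb) lb0 => // b l _; exists b; rewrite inE eqxx.
have [b1 b1l hb1] : exists2 b1, b1 \in lb & forall c, c \in lb -> v (b0 - c) <= v (b0 - b1).
  clear -b0l; elim: lb b0 b0l => // a l IHl b0 _.
  case: l IHl => [|a' l] IHl; first by exists a => [|c]; rewrite ?inE // => /eqP->.
  have [b2 b2l h2] : exists2 b1, b1 \in a' :: l &
     forall c, c \in a' :: l -> v (b0 - c) <= v (b0 - b1).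
    clear IHl; elim: l a' => [|a2 l IHl] a'.
      by exists a' => [|c]; rewrite ?inE // => /eqP->.
    have [b hb hb'] := IHl a2.
    have [h|h] := leP (v (b0 - a')) (v (b0 - b)).
      exists b; first by rewrite inE hb orbT.
      by move=> c; rewrite inE => /predU1P[->//|/hb'].
    exists a'; first by rewrite inE eqxx.
    by move=> c; rewrite inE => /predU1P[->//|/hb' hc]; exact: le_trans hc (ltW h).
  have [h|h] := leP (v (b0 - a)) (v (b0 - b2)).
    exists b2; first by rewrite inE b2l orbT.
    by move=> c; rewrite inE => /predU1P[->//|/h2].
  exists a; first by rewrite inE eqxx.
  by move=> c; rewrite inE => /predU1P[->//|/h2 hc]; exact: le_trans hc (ltW h).
(* [rho] is the diameter of the set of poles. The open disc of radius [rho] around [b0] and its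
   complement both contain poles, so each of them has fewer poles than [lb]. *)
pose rho := v (b0 - b1).
have hrho b c : b \in lb -> c \in lb -> v (b - c) <= rho.
  by move=> bl cl; apply: (@uabs_dist_le b0); first rewrite uabs_distC; apply: hb1.
have Srho b : b \in lb -> S b < rho.
  by move=> bl; have [c cl] := hno _ bl; move/lt_le_trans; apply; exact: hrho.
have rho0 : 0 < rho by exact: lt_trans (hS _ b0l) (Srho _ b0l).
(* Descent to a class [P]: the poles outside [P] are at distance exactly [rho] from those inside,
   the zeros outside at distance at least [rho]. The outer factors can therefore be compared one by
   one. *)
have step (P : pred K) : (size (seq.filter P la) <= size (seq.filter P lb))%N ->
    (0 < size (seq.filter P lb) < size lb)%N ->
    (forall b c, b \in lb -> P b -> ~~ P c -> rho <= v (b - c)) ->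
    exists2 b, b \in lb &
    forall T, S b <= T -> (forall c, c \in lb -> v (b - c) <= T) ->
    \prod_(c <- lb) Num.max (S b) (v (b - c)) <=
    T ^+ (size lb - size la) * \prod_(a <- la) Num.max (S b) (v (b - a)).
  move=> h1 /andP[h2 h3] h4.
  have [||b] := IH (seq.filter P la) (seq.filter P lb) (leq_trans h3 _) h1 h2.
  - by rewrite -ltnS.
  - by move=> b; rewrite mem_filter => /andP[_ /hS].
  rewrite mem_filter => /andP[Pb bl] /(_ rho (ltW (Srho _ bl))) hb.
  exists b => // T hT1 hT2.
  have hrT : rho <= T.
    have [c cl nPc] : exists2 c, c \in lb & ~~ P c.
      apply/hasP; rewrite has_predC -(@eq_all _ P) //; apply/negP => hall.
      by rewrite (all_filterP hall) ltnn in h3.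
    exact: le_trans (h4 _ _ bl Pb nPc) (hT2 _ cl).
  have T0 : 0 <= T by exact: le_trans (ltW rho0) hrT.
  have {}hb := hb (fun c hc => hrho _ _ bl (mem_subseq (filter_subseq _ _) hc)).
  have S0 := ltW (hS _ bl).
  have mx0 c : 0 <= Num.max (S b) (v (b - c)) by rewrite le_max S0.
  have bsplit (l : seq K) : \prod_(c <- l) Num.max (S b) (v (b - c)) =
      (\prod_(c <- seq.filter P l) Num.max (S b) (v (b - c))) *
      \prod_(c <- seq.filter (predC P) l) Num.max (S b) (v (b - c)).
    by rewrite !big_filter (bigID P).
  rewrite (bsplit lb) (bsplit la).
  set lb' := seq.filter P lb in h1 h2 h3 hb *; set la' := seq.filter P la in h1 hb *.
  rewrite (eq_big_seq (r := seq.filter (predC P) lb) (fun=> rho)); last first.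
    move=> c; rewrite mem_filter => /andP[nPc cl].
    apply/eqP; rewrite eq_le ge_max (ltW (Srho _ bl)) hrho //= le_max.
    by rewrite (h4 _ _ bl Pb nPc) orbT.
  rewrite big_const_seq count_predT iter_mulr_1.
  set lb'' := seq.filter (predC P) lb; set la'' := seq.filter (predC P) la.
  have slb : size lb = (size lb' + size lb'')%N.
    by rewrite -size_cat (perm_size (permEl (perm_filterC P lb))).
  have sla : size la = (size la' + size la'')%N.
    by rewrite -size_cat (perm_size (permEl (perm_filterC P la))).
  have hpa : rho ^+ size la'' <= \prod_(a <- la'') Num.max (S b) (v (b - a)).
    have : all (predC P) la'' by rewrite filter_all.
    elim: (la'') => [|a l IHl] /=; first by rewrite big_nil expr0.
    move=> /andP[nPa /IHl h]; rewrite big_cons exprS.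
    by apply: ler_pM; rewrite ?exprn_ge0 ?(ltW rho0) // le_max (h4 _ _ bl Pb nPa) orbT.
  have pa0 : 0 <= \prod_(a <- la') Num.max (S b) (v (b - a)) by apply: prodr_ge0.
  apply: le_trans (_ : _ <= rho ^+ (size lb' - size la') *
     \prod_(a <- la') Num.max (S b) (v (b - a)) * rho ^+ size lb'') _.
    by apply: ler_pM; rewrite ?exprn_ge0 ?(ltW rho0) ?prodr_ge0.
  rewrite mulrAC -exprD.
  have -> : (size lb' - size la' + size lb'' = (size lb - size la) + size la'')%N.
    by rewrite slb sla; apply: arith => //; rewrite -slb -sla.
  rewrite exprD mulrAC [X in _ <= X]mulrA; apply: ler_pM => //.
  - by rewrite mulr_ge0 ?exprn_ge0 ?(ltW rho0).
  - by rewrite exprn_ge0 ?(ltW rho0).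
  - by apply: ler_wpM2r => //; rewrite lerXn2r // ?nnegrE ?(ltW rho0).
pose P := [pred a | v (a - b0) < rho].
have Pb0 : P b0 by rewrite /= subrr uabs0.
have nPb1 : ~~ P b1 by rewrite /= /rho uabs_distC ltxx.
have hP b c : P b -> ~~ P c -> rho <= v (b - c).
  rewrite /= -leNgt => h1 h2; rewrite leNgt; apply/negP => h3.
  have : v (c - b0) < rho by apply: (@uabs_dist_lt b) => //; rewrite uabs_distC.
  by rewrite ltNge h2.
have f0 : (0 < size (seq.filter P lb))%N.
  by rewrite size_filter -has_count; apply/hasP; exists b0.
have f1 : (0 < size (seq.filter (predC P) lb))%N.
  by rewrite size_filter -has_count; apply/hasP; exists b1.
have slb : (size (seq.filter P lb) + size (seq.filter (predC P) lb) = size lb)%N.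
  by rewrite !size_filter count_predC.
have sla : (size (seq.filter P la) + size (seq.filter (predC P) la) = size la)%N.
  by rewrite !size_filter count_predC.
(* If the disc of [b0] has more zeros than poles, its complement has fewer zeros than poles, since
   there are at least as many poles in all. *)
have [h|h] := leqP (size (seq.filter P la)) (size (seq.filter P lb)).
  apply: (step P) => //; last by move=> b c _; exact: hP.
  by rewrite f0 -slb -{1}[size (seq.filter P lb)]addn0 ltn_add2l.
apply: (step (predC P)).
- by rewrite -(leq_add2l (size (seq.filter P la))) sla (leq_trans hs) // -slb leq_add2r ltnW.
- by rewrite f1 -slb -{1}[size (seq.filter (predC P) lb)]add0n ltn_add2r.
by move=> b c _ /= nb; rewrite negbK => Pc; rewrite uabs_distC; exact: hP.
Qed.

End UltrametricAbs.

Record cpField (R : realType) := CpField {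
  cp_base :> ultraField R;
  cp_root : forall p : {poly cp_base}, (1 < size p)%N -> exists x, root p x;
  cp_res : nat;
  cp_res_lt1 : uabs (cp_res.+1%:R : cp_base) < 1;
  cp_char0 : forall n, n.+1%:R != 0 :> cp_base;
  (* cp_res.+1 stands for p, and L for a finite extension of Q_p that contains
     approximations of the elements of s. *)
  cp_approx : forall (s : seq cp_base) (e : R), 0 < e ->
    exists L : set cp_base,
      [/\ L 1, forall x y, L x -> L y -> L (x - y),
          forall x y, L x -> L y -> L (x * y) & forall x, L x -> L x^-1] /\
      (forall c, c \in s -> exists2 c', L c' & uabs (c - c') < e) /\
      (forall d, 0 < d -> exists N (code : cp_base -> 'I_N), forall x y,
         L x -> L y -> uabs x <= 1 -> uabs y <= 1 ->
         code x = code y -> uabs (x - y) < d)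
}.

Lemma exprn_small (R : realType) (x e : R) : 0 <= x < 1 -> 0 < e ->
  exists n, x ^+ n < e.
Proof.
move=> /andP[x0 x1] e0.
have h : (fun n => x ^+ n) @ \oo --> (0 : R).
  by apply: cvg_expr; rewrite ger0_norm.
have /cvgrPdist_lt /(_ _ e0) := h.
move=> [n _ /(_ n (leqnn n))] /=.
by rewrite sub0r normrN ger0_norm ?exprn_ge0 // => hn; exists n.
Qed.

(** * Algebraically closed fields: generic points and the value group *)

Section Closed.
Variables (R : realType) (K : cpField R).
Local Notation v := (@uabs R K).
Implicit Types x y z : K.

Lemma poly_split (p : {poly K}) : p != 0 ->
  exists2 s : seq K, size s = (size p).-1 &
    p = lead_coef p *: \prod_(z <- s) ('X - z%:P).
Proof.
have [n] := ubnP (size p); elim: n p => // n IH p hn p0.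
have [h|h] := leqP (size p) 1.
  exists [::] => /=; first by case: (size p) h => // -[].
  rewrite big_nil alg_polyC {1}(size1_polyC h); congr _%:P.
  by rewrite lead_coefE; case: (size p) h => // -[].
have [x /factor_theorem[q hq]] := cp_root h.
have q0 : q != 0 by apply: contraNneq p0 => q0; rewrite hq q0 mul0r.
have sq : size p = (size q).+1 by rewrite hq size_Mmonic ?monicXsubC // size_XsubC addn2.
have [|s hs hqs] := IH q _ q0; first by rewrite -ltnS -sq.
exists (x :: s) => /=; first by rewrite hs sq prednK // size_poly_gt0.
have -> : lead_coef p = lead_coef q by rewrite hq lead_coef_Mmonic ?monicXsubC.
by rewrite big_cons {1}hq {1}hqs -scalerAl mulrC.
Qed.

(** Take a root [u] of the product of the [X - z], minus 1. The distances from [u] to the points of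
    [s] have product 1; a norm of [u] above 1 would make all of them exceed 1. So none exceeds 1,
    and hence none is smaller. *)
Lemma generic_unit (s : seq K) : (forall c, c \in s -> v c <= 1) ->
  exists2 u, v u <= 1 & forall c, c \in s -> v (u - c) = 1.
Proof.
case: s => [|c0 s0] hs; first by exists 0; rewrite ?uabs0.
set s := c0 :: s0 in hs *.
have szP : size (\prod_(z <- s) ('X - z%:P)) = (size s0).+2.
  by rewrite size_prod_XsubC.
have [|u] := @cp_root R K (\prod_(z <- s) ('X - z%:P) - 1).
  rewrite size_polyDl ?szP // size_polyN size_poly1; first by [].
rewrite rootE !hornerE horner_prod subr_eq0 => /eqP hu.
have hp : \prod_(z <- s) v (u - z) = 1.
  transitivity (v (\prod_(z <- s) ('X - z%:P).[u])); last by rewrite hu uabs1.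
  by rewrite uabs_prod; apply: eq_bigr => z _; rewrite !hornerE.
have u1 : v u <= 1.
  rewrite leNgt; apply/negP => u1.
  have : 1 < \prod_(z <- s) v (u - z).
    rewrite (eq_big_seq (fun=> v u)) => [|z /hs hz]; last first.
      by rewrite uabsB_eql // (le_lt_trans hz).
    by rewrite big_const_seq count_predT iter_mulr_1 exprn_egt1.
  by rewrite hp ltxx.
exists u => // c cs; apply/eqP; rewrite eq_le uabsB_le ?u1 ?hs //=.
rewrite leNgt; apply/negP => hc.
have : \prod_(z <- s) v (u - z) < 1.
  rewrite (big_rem c cs); apply: le_lt_trans hc; rewrite -[leRHS]mulr1.
  apply: ler_wpM2l; first exact: uabs_ge0.
  have : {subset rem c s <= s} by apply: mem_rem.
  elim: (rem c s) => [|a l IH] hl; first by rewrite big_nil.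
  rewrite big_cons mulr_ile1 ?uabs_ge0 ?prodr_ge0 //.
  - by move=> *; exact: uabs_ge0.
  - by apply: uabsB_le => //; apply: hs; apply: hl; rewrite inE eqxx.
  - by apply: IH => z hz; apply: hl; rewrite inE hz orbT.
by rewrite hp ltxx.
Qed.

(** At [z] a product of distances to the points of [s] takes the value of its Gauss norm on the disc
    of radius [v c] around [a]. Points within [v c] of [a] are avoided as residue classes after
    rescaling; for the others the whole disc is at one distance. *)
Lemma generic_point (a c : K) (s : seq K) : c != 0 ->
  exists2 z, v (z - a) = v c & forall b, b \in s -> v (z - b) = Num.max (v c) (v (a - b)).
Proof.
move=> c0; have vc0 : 0 < v c by rewrite uabs_gt0.
have [|u u1 hu] := @generic_unit (0 :: [seq (b - a) / c | b <- s & v (a - b) <= v c]).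
  move=> z; rewrite inE => /predU1P[->|/mapP[b]]; first by rewrite uabs0.
  rewrite mem_filter => /andP[hb _] ->; rewrite uabs_div uabs_distC.
  by rewrite ler_pdivrMr // mul1r.
have vu : v u = 1 by rewrite -[u]subr0 hu // inE eqxx.
exists (a + c * u); first by rewrite addrC addKr uabsM vu mulr1.
move=> b bs; have [h|h] := leP (v (a - b)) (v c).
  have : v (u - (b - a) / c) = 1.
    by apply: hu; rewrite inE; apply/orP; right; apply: map_f; rewrite mem_filter h.
  have -> : a + c * u - b = c * (u - (b - a) / c) by field.
  by rewrite uabsM => ->; rewrite mulr1.
have -> : a + c * u - b = c * u + (a - b) by ring.
by apply: uabsD_eqr; rewrite uabsM vu mulr1.
Qed.

(** Roots of p of high order have norm close to 1, and the powers of such a root descend in steps of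
    ratio greater than [a / b]. Case b > 1: either 1 lies in the interval or inversion applies. *)
Lemma radius_exists (a b : R) : 0 < a -> a < b -> exists2 c : K, c != 0 & a < v c < b.
Proof.
wlog b1 : a b / b <= 1 => [hw|] a0 ab.
  have [b1|b1] := leP b 1; first exact: hw.
  have [a1|a1] := ltP a 1.
    by exists 1; rewrite ?oner_neq0 // uabs1 a1.
  have b0 := lt_trans a0 ab.
  have [||| c c0 /andP[h1 h2]] := hw b^-1 a^-1.
  - by rewrite invf_le1.
  - by rewrite invr_gt0.
  - by rewrite ltf_pV2.
  exists c^-1; first by rewrite invr_eq0.
  have vc : 0 < v c by rewrite uabs_gt0.
  by rewrite uabsV -(invrK a) ltf_pV2 ?posrE ?invr_gt0 // h2 -(invrK b) ltf_pV2 ?posrE ?invr_gt0.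
have b0 := lt_trans a0 ab.
set w := (cp_res K).+1%:R : K.
have w0 : w != 0 by exact: cp_char0.
have vw : 0 < v w by rewrite uabs_gt0.
have [|n hn] := @exprn_small _ (a / b) (v w) _ vw.
  by rewrite divr_ge0 ?(ltW a0) ?(ltW b0) //= ltr_pdivrMr // mul1r.
have [r hr] : exists r, r ^+ n.+1 = w.
  have [|r] := @cp_root R K ('X^(n.+1) - w%:P); first by rewrite size_XnsubC.
  by rewrite rootE !hornerE subr_eq0 => /eqP; exists r.
have vr : v r ^+ n.+1 = v w by rewrite -uabsX hr.
have r0 : r != 0 by apply: contraNneq w0 => r0; rewrite -hr r0 expr0n.
have r1 : v r < 1.
  by rewrite -(@expr_lt1 _ n.+1) ?uabs_ge0 // vr; exact: cp_res_lt1.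
have rab : a / b < v r.
  rewrite -(@ltr_pXn2r _ n.+1) ?nnegrE ?uabs_ge0 ?divr_ge0 ?(ltW a0) ?(ltW b0) //.
  rewrite vr; apply: le_lt_trans hn; rewrite exprS ler_piMl //.
    by rewrite exprn_ge0 // divr_ge0 ?(ltW a0) ?(ltW b0).
  by rewrite ler_pdivrMr // mul1r ltW.
have ex : exists j, v r ^+ j < b by apply: exprn_small => //; rewrite uabs_ge0.
(* The first power of [r] whose norm is below [b] is still above [a], because the preceding one is
   at least [b]. *)
case: (ex_minnP ex) => -[|j] hj hmin.
  by move: hj; rewrite expr0 ltNge b1.
exists (r ^+ j.+1); first by rewrite expf_neq0.
rewrite uabsX hj andbT exprS.
have hb : b <= v r ^+ j by rewrite leNgt; apply/negP => /hmin; rewrite ltnn.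
apply: lt_le_trans (_ : v r * b <= _); first by rewrite -ltr_pdivrMr.
by rewrite ler_wpM2l ?uabs_ge0.
Qed.

End Closed.

(** * The chordal metric and binary forms *)

Section Chordal.
Variables (R : realType) (K : ultraField R).
Local Notation v := (@uabs R K).
Implicit Types (x y z : option K) (p q : K * K).

(* Locked, so that rewriting with the laws of the real field does not unfold it. *)
Definition cdist x y : R := locked (chordal v x y).
Local Notation dist := cdist.

Lemma cdistE x y : cdist x y = chordal v x y.
Proof. by rewrite /cdist -lock. Qed.

Definition nrm p : R := Num.max (v p.1) (v p.2).
Definition det2 p q : K := p.1 * q.2 - q.1 * p.2.
Definition hproj p : option K := if p.2 == 0 then None else Some (p.1 / p.2).
Definition hscale (c : K) p : K * K := (c * p.1, c * p.2).

Lemma nrm_ge0 p : 0 <= nrm p. Proof. by rewrite le_max uabs_ge0. Qed.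

Lemma nrm_gt0 p : (0 < nrm p) = (p != 0).
Proof. by case: p => a b; rewrite /nrm lt_max !uabs_gt0 /= -negb_and. Qed.

Lemma nrm_scale c p : nrm (hscale c p) = v c * nrm p.
Proof. by rewrite /nrm !uabsM maxr_pMr ?uabs_ge0. Qed.

Lemma det2_scale c d p q : det2 (hscale c p) (hscale d q) = c * d * det2 p q.
Proof. by rewrite /det2 /=; ring. Qed.

Lemma det2_le p q : v (det2 p q) <= nrm p * nrm q.
Proof.
have h1 u : v u.1 <= nrm u by rewrite le_max lexx.
have h2 u : v u.2 <= nrm u by rewrite le_max lexx orbT.
apply: uabsB_le; rewrite uabsM; first by apply: ler_pM; rewrite ?uabs_ge0.
by rewrite mulrC; apply: ler_pM; rewrite ?uabs_ge0.
Qed.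

Lemma hcoord_neq0 x : hcoord x != 0.
Proof. by case: x => [z|]; rewrite -nrm_gt0 lt_max /= uabs1 ltr01 ?orbT. Qed.

Lemma nrm_hcoord_gt0 x : 0 < nrm (hcoord x).
Proof. by rewrite nrm_gt0 hcoord_neq0. Qed.

Lemma hcoordK x : hproj (hcoord x) = x.
Proof. by case: x => [z|]; rewrite /hproj /= ?oner_eq0 ?divr1 ?eqxx. Qed.

Lemma hprojK p : p != 0 -> exists2 c : K, c != 0 & hcoord (hproj p) = hscale c p.
Proof.
case: p => a b; rewrite /hproj /hscale /=; have [->|b0] := eqVneq b 0 => p0.
  have a0 : a != 0 by apply: contraNneq p0 => ->.
  by exists a^-1; rewrite ?invr_eq0 //= mulVf // mulr0.
by exists b^-1; rewrite ?invr_eq0 //= mulVf // mulrC.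
Qed.

Lemma hproj_scale c p : c != 0 -> hproj (hscale c p) = hproj p.
Proof.
move=> c0; rewrite /hproj /= mulf_eq0 (negPf c0) /=; case: eqP => // /eqP p2.
by congr Some; rewrite -mulf_div divff // mul1r.
Qed.

Lemma chordal_hproj p q : p != 0 -> q != 0 ->
  dist (hproj p) (hproj q) = v (det2 p q) / (nrm p * nrm q).
Proof.
move=> p0 q0; rewrite cdistE /chordal -/(nrm _) -/(nrm _) -/(det2 _ _).
have [c c0 ->] := hprojK p0; have [d d0 ->] := hprojK q0.
rewrite det2_scale !nrm_scale !uabsM.
have := nrm_gt0 p; have := nrm_gt0 q; rewrite p0 q0 => /lt0r_neq0 hq /lt0r_neq0 hp.
have vc : v c != 0 by rewrite uabs_eq0.
have vd : v d != 0 by rewrite uabs_eq0.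
by field; rewrite vc vd hp hq.
Qed.

Lemma chordalE x y :
  dist x y = v (det2 (hcoord x) (hcoord y)) / (nrm (hcoord x) * nrm (hcoord y)).
Proof. exact: cdistE. Qed.

Lemma chordal_ge0 x y : 0 <= dist x y.
Proof. by rewrite chordalE divr_ge0 ?uabs_ge0 ?mulr_ge0 ?nrm_ge0. Qed.

Lemma chordalC x y : dist x y = dist y x.
Proof. by rewrite !chordalE [X in _ / X]mulrC /det2 uabs_distC. Qed.

Lemma chordal_le1 x y : dist x y <= 1.
Proof. by rewrite chordalE ler_pdivrMr ?mulr_gt0 ?nrm_hcoord_gt0 // mul1r det2_le. Qed.

Lemma chordal_eq0 x y : (dist x y == 0) = (x == y).
Proof.
rewrite chordalE mulf_eq0 invr_eq0.
rewrite (gt_eqF (mulr_gt0 (nrm_hcoord_gt0 _) (nrm_hcoord_gt0 _))) orbF uabs_eq0.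
case: x y => [x|] [y|]; rewrite /det2 /= ?mulr1 ?mulr0 ?mul1r ?mul0r ?subr_eq0 //=.
  by rewrite eq_sym oner_eq0.
- exact: oner_eq0.
- by rewrite eqxx.
Qed.

Lemma chordalxx x : dist x x = 0. Proof. by apply/eqP; rewrite chordal_eq0. Qed.

Lemma chordal_gt0 x y : (0 < dist x y) = (x != y).
Proof. by rewrite lt_def chordal_eq0 chordal_ge0 andbT. Qed.

(** Rests on the linear relation det(p,r) q = det(p,q) r + det(q,r) p between three vectors of the
    plane, read in both coordinates. *)
Lemma chordal_ultra y x z : dist x z <= Num.max (dist x y) (dist y z).
Proof.
rewrite !chordalE.
set p := hcoord x; set q := hcoord y; set r := hcoord z.
have hp : 0 < nrm p := nrm_hcoord_gt0 x.
have hq : 0 < nrm q := nrm_hcoord_gt0 y.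
have hr : 0 < nrm r := nrm_hcoord_gt0 z.
have h : v (det2 p r) * nrm q <=
    Num.max (v (det2 p q) * nrm r) (v (det2 q r) * nrm p).
  have e1 : det2 p r * q.1 = det2 p q * r.1 + det2 q r * p.1 by rewrite /det2; ring.
  have e2 : det2 p r * q.2 = det2 p q * r.2 + det2 q r * p.2 by rewrite /det2; ring.
  rewrite [X in _ * X]/nrm maxr_pMr ?uabs_ge0 // -!uabsM e1 e2 ge_max.
  apply/andP; split; apply: le_trans (uabsD _ _) _; rewrite !uabsM ge_max;
    by rewrite !le_max !ler_wpM2l ?uabs_ge0 ?orbT // le_max lexx ?orbT.
have -> : v (det2 p r) / (nrm p * nrm r) =
    v (det2 p r) * nrm q / (nrm p * nrm q * nrm r).
  by field; rewrite !lt0r_neq0.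
have h0 : 0 < nrm p * nrm q * nrm r by rewrite !mulr_gt0.
rewrite ler_pdivrMr // maxr_pMl; last exact: ltW.
apply: le_trans h _; rewrite le_eqVlt; apply/orP; left; apply/eqP; congr Num.max.
  by field; rewrite !lt0r_neq0.
by field; rewrite !lt0r_neq0.
Qed.

Lemma chordal_le y x z c : dist x y <= c -> dist y z <= c -> dist x z <= c.
Proof. by move=> h1 h2; apply: le_trans (chordal_ultra y _ _) _; rewrite ge_max h1. Qed.
Lemma chordal_lt y x z c : dist x y < c -> dist y z < c -> dist x z < c.
Proof. by move=> h1 h2; apply: le_lt_trans (chordal_ultra y _ _) _; rewrite gt_max h1. Qed.
Lemma chordal_eq x y z : dist x y < dist y z -> dist x z = dist y z.
Proof.
move=> h; apply/eqP; rewrite eq_le; apply/andP; split.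
  by apply: (@chordal_le y) => //; exact: ltW.
rewrite leNgt; apply/negP => h2; suff: dist y z < dist y z by rewrite ltxx.
by rewrite {1}chordalC; apply: (@chordal_lt x); rewrite chordalC // chordalC.
Qed.
Lemma chordal_ge y x z : dist x z <= dist x y \/ dist x z <= dist y z.
Proof. by have := chordal_ultra y x z; rewrite le_max => /orP. Qed.

Lemma chordal_some (a b : K) :
  dist (Some a) (Some b) = v (a - b) / (Num.max (v a) 1 * Num.max (v b) 1).
Proof. by rewrite cdistE /chordal /= !mulr1 uabs1. Qed.
Lemma chordal_inf (a : K) : dist (Some a) None = (Num.max (v a) 1)^-1.
Proof.
rewrite cdistE /chordal /= uabs1 uabs0 mulr0 mulr1 sub0r uabsN uabs1.
by rewrite (max_l ler01) mulr1 mul1r.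
Qed.
Lemma chordal_some_le1 (a b : K) : v a <= 1 -> v b <= 1 ->
  dist (Some a) (Some b) = v (a - b).
Proof. by move=> ha hb; rewrite chordal_some !max_r // mulr1 divr1. Qed.
Lemma chordal_0 (a : K) (r : R) : r <= 1 -> (dist (Some a) (Some 0) < r) = (v a < r).
Proof.
move=> r1; rewrite chordal_some subr0 uabs0 (max_r ler01) mulr1.
have [h|h] := leP (v a) 1; first by rewrite divr1.
rewrite divff ?gt_eqF ?(lt_trans ltr01) //.
by apply/idP/idP => hr; have := lt_le_trans hr r1; rewrite ?ltxx // ltNge (ltW h).
Qed.

End Chordal.

(** * Binary forms and their factorization *)

Section Forms.
Variables (R : realType) (K : ultraField R).
Local Notation v := (@uabs R K).
Implicit Types (F G : K * K -> K) (p q : {poly K}) (u : K * K).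

Definition bform n p u : K := \sum_(i < n.+1) p`_i * u.1 ^+ i * u.2 ^+ (n - i).
(** A form is kept as a function, together with the existence of a dehomogenization. The degree [n]
    is part of the data because it determines the order of vanishing at infinity, which the
    polynomial alone does not show. *)
Definition isform n F :=
  exists2 p : {poly K}, (size p <= n.+1)%N & forall u, F u = bform n p u.

Lemma bform_inf n p (x : K) : bform n p (x, 0) = p`_n * x ^+ n.
Proof.
rewrite /bform big_ord_recr /= subnn expr0 mulr1 big1 ?add0r // => i _.
by rewrite expr0n subn_eq0 leqNgt ltn_ord mulr0.
Qed.

Lemma bform_fin n p (x y : K) : (size p <= n.+1)%N -> y != 0 ->
  bform n p (x, y) = y ^+ n * p.[x / y].
Proof.
move=> sp y0; rewrite (horner_coef_wide _ sp) mulr_sumr; apply: eq_bigr => i _ /=.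
have hi : (i <= n)%N by rewrite -ltnS.
rewrite expr_div_n; have -> : y ^+ n = y ^+ (n - i) * y ^+ i by rewrite -exprD subnK.
field.
by rewrite expf_neq0.
Qed.

Lemma isform_ext n F G : (forall u, F u = G u) -> isform n F -> isform n G.
Proof. by move=> h [p sp hp]; exists p => // u; rewrite -h. Qed.

Lemma isform_lin n F G (a b : K) : isform n F -> isform n G ->
  isform n (fun u => a * F u + b * G u).
Proof.
move=> [p sp hp] [q sq hq]; exists (a *: p + b *: q).
  apply: leq_trans (size_polyD _ _) _; rewrite geq_max.
  by rewrite !(leq_trans (size_scale_leq _ _)).
move=> u; rewrite hp hq /bform !mulr_sumr -big_split /=; apply: eq_bigr => i _.
by rewrite coefD !coefZ; ring.
Qed.

Lemma isform_mul m n F G : isform m F -> isform n G ->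
  isform (m + n) (fun u => F u * G u).
Proof.
move=> [p sp hp] [q sq hq]; exists (p * q).
  apply: leq_trans (size_polyMleq _ _) _; rewrite -subn1 leq_subLR add1n.
  by rewrite (leq_trans (leq_add sp sq)) // addSn addnS.
have spq : (size (p * q)%R <= (m + n).+1)%N.
  apply: leq_trans (size_polyMleq _ _) _; rewrite -subn1 leq_subLR add1n.
  by rewrite (leq_trans (leq_add sp sq)) // addSn addnS.
move=> [x y]; rewrite hp hq; have [->|y0] := eqVneq y 0; last first.
  by rewrite !bform_fin // hornerM exprD; ring.
rewrite !bform_inf exprD.
suff -> : (p * q)`_(m + n) = p`_m * q`_n by ring.
rewrite coefM; have hm : (m < (m + n).+1)%N by rewrite ltnS leq_addr.
rewrite (bigD1 (Ordinal hm)) //= addKn big1 ?addr0 // => -[i hi] /=.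
rewrite -val_eqE /= neq_ltn => /orP[h|h].
  rewrite [q`__]nth_default ?mulr0 //; apply: leq_trans sq _.
  by rewrite ltn_subRL ltn_add2r.
by rewrite nth_default ?mul0r // (leq_trans sp).
Qed.

Lemma isform_fst : isform 1 fst.
Proof.
exists 'X; first by rewrite size_polyX.
by move=> [x y]; rewrite /bform !big_ord_recr big_ord0 /= !coefX /=; ring.
Qed.
Lemma isform_snd : isform 1 snd.
Proof.
exists 1; first by rewrite size_poly1.
by move=> [x y]; rewrite /bform !big_ord_recr big_ord0 /= !coef1 /=; ring.
Qed.
Lemma isform_const (c : K) : isform 0 (fun=> c).
Proof.
exists c%:P; first by rewrite size_polyC_leq1.
by move=> [x y]; rewrite /bform !big_ord_recr big_ord0 /= !coefC /=; ring.
Qed.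

Lemma isform_prod n (T : Type) (s : seq T) (F : T -> K * K -> K) :
  (forall a, isform n (F a)) -> isform (size s * n) (fun u => \prod_(a <- s) F a u).
Proof.
move=> h; elim: s => [|a s IH].
  by apply: isform_ext (isform_const 1) => u; rewrite big_nil.
rewrite /= mulSn; apply: isform_ext (isform_mul (h a) IH) => u.
by rewrite big_cons.
Qed.

Lemma isform_scale n F (c : K) u : isform n F -> F (hscale c u) = c ^+ n * F u.
Proof.
move=> [p sp hp]; rewrite !hp /bform mulr_sumr; apply: eq_bigr => i _ /=.
have hi : (i <= n)%N by rewrite -ltnS.
rewrite !exprMn; have -> : c ^+ n = c ^+ (n - i) * c ^+ i by rewrite -exprD subnK.
ring.
Qed.

Lemma isform_poly n F : isform n F -> exists2 p : {poly K}, (size p <= n.+1)%N &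
   forall z : K, F (z, 1) = p.[z].
Proof.
by move=> [p sp hp]; exists p => // z; rewrite hp bform_fin ?oner_neq0 // expr1n mul1r divr1.
Qed.

End Forms.

Section FormsClosed.
Variables (R : realType) (K : cpField R).
Local Notation v := (@uabs R K).
Local Notation dist := (@cdist R K).
Implicit Types (F G : K * K -> K).

Lemma isform_factor n F : isform n F ->
  (forall u, F u = 0) \/
  exists2 s : seq (option K), size s = n &
    exists2 c, c != 0 & forall u, F u = c * \prod_(a <- s) det2 u (hcoord a).
Proof.
move=> [p sp hp]; have [p0|p0] := eqVneq p 0.
  left=> u; rewrite hp p0 /bform big1 // => i _; by rewrite coef0 !mul0r.
right; have [s hs hps] := poly_split p0.
have ssn : (size s <= n)%N by rewrite hs -ltnS prednK // size_poly_gt0.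
exists (map Some s ++ nseq (n - size s) None).
  by rewrite size_cat size_map size_nseq subnKC.
(* [det2 u (hcoord None)] equals [- u.2], so each zero at infinity contributes a sign. *)
exists (lead_coef p * (-1) ^+ (n - size s)).
  by rewrite mulf_neq0 ?lead_coef_eq0 // expf_neq0 // oppr_eq0 oner_eq0.
have hsnd u : \prod_(a <- nseq (n - size s) None) det2 u (@hcoord K a) =
    (- u.2) ^+ (n - size s).
  elim: (n - size s)%N => [|k IH]; first by rewrite big_nil.
  by rewrite /= big_cons IH exprS /det2 /= mulr0 sub0r mul1r.
move=> [x y]; rewrite hp big_cat big_map hsnd /=.
have [->|y0] := eqVneq y 0; last first.
  rewrite bform_fin // {1}hps hornerZ horner_prod.
  have -> : \prod_(a <- s) det2 (x, y) (hcoord (Some a)) =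
      y ^+ size s * \prod_(a <- s) ('X - a%:P).[x / y].
    elim: (s) => [|a l IH]; first by rewrite !big_nil expr0 mul1r.
    rewrite !big_cons IH; set P := \prod_(_ <- _) _.
    rewrite /det2 /= hornerXsubC exprS; set Y := y ^+ _; field.
    by rewrite y0.
  have -> : y ^+ n = y ^+ (n - size s) * y ^+ size s by rewrite -exprD subnK.
  rewrite [(- y) ^+ _]exprNn.
  have e : (-1) ^+ (n - size s) * (-1) ^+ (n - size s) = 1 :> K by rewrite -expr2 sqrr_sign.
  set A := \prod_(_ <- _) _; set t := (-1) ^+ _ in e *; set Y := y ^+ _; set Z := y ^+ _.
  transitivity (lead_coef p * (t * t) * A * Y * Z); first by rewrite e; ring.
  by ring.
rewrite bform_inf oppr0 expr0n subn_eq0.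
have -> : \prod_(a <- s) det2 (x, 0) (hcoord (Some a)) = x ^+ size s.
  elim: (s) => [|a l IH]; rewrite ?big_nil ?expr0 // big_cons IH /det2 /= exprS.
  by ring.
have [h|h] := leqP n (size s).
  have e : size s = n by apply/eqP; rewrite eqn_leq ssn.
  by rewrite e subnn expr0 !mulr1 lead_coefE -e -hs.
by rewrite !mulr0 nth_default ?mul0r // -(prednK (_ : 0 < size p)%N) ?size_poly_gt0 // -hs.
Qed.

(** Once [F] is factored, substitution turns each linear factor into a linear combination of [G] and
    [H], and products of forms are forms. *)
Lemma isform_comp m n F G H : isform n F -> isform m G -> isform m H ->
  isform (n * m) (fun u => F (G u, H u)).
Proof.
move=> /isform_factor[hF0|[s <- [c c0 hF]]] hG hH.
  exists 0; first by rewrite size_poly0.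
  by move=> u; rewrite hF0 /bform big1 // => i _; rewrite coef0 !mul0r.
have h a : isform m (fun u => det2 (G u, H u) (@hcoord K a)).
  apply: isform_ext (isform_lin (hcoord a).2 (- (hcoord a).1) hG hH) => u.
  by rewrite /det2 /=; ring.
have := isform_mul (isform_const c) (isform_prod s h); rewrite add0n.
by apply: isform_ext => u; rewrite hF.
Qed.

(** Dividing each linear factor by the norms of its two arguments makes it a chordal distance; the
    norms of the zeros are absorbed in [c]. This is where products of distances come from. *)
Lemma isform_abs n F : isform n F -> (exists u, F u != 0) ->
  exists2 s : seq (option K), size s = n &
    exists2 c : R, 0 < c &
      (forall a, a \in s -> F (hcoord a) = 0) /\
      forall x, v (F (hcoord x)) = c * nrm (hcoord x) ^+ n * \prod_(a <- s) dist x a.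
Proof.
move=> /isform_factor[h [u]|[s hs [c c0 hF]] _]; first by rewrite h eqxx.
exists s => //; exists (v c * \prod_(a <- s) nrm (hcoord a)).
  rewrite mulr_gt0 ?uabs_gt0 // prodr_gt0 // => a _; exact: nrm_hcoord_gt0.
split.
  move=> a aS; rewrite hF (big_rem a) //=.
  have -> : det2 (hcoord a) (hcoord a) = 0 by rewrite /det2; ring.
  by rewrite mul0r mulr0.
move=> x; rewrite hF uabsM uabs_prod -!mulrA; congr (_ * _).
rewrite -hs; elim: (s) => [|a l IH]; first by rewrite !big_nil expr0 !mul1r.
rewrite !big_cons IH exprS chordalE.
have := nrm_hcoord_gt0 a; have := nrm_hcoord_gt0 x => /lt0r_neq0 hx /lt0r_neq0 ha.
by field; rewrite hx ha.
Qed.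

End FormsClosed.

(** * Rational maps *)

Lemma seq_pos_lb (R : realType) (T : eqType) (s : seq T) (F : T -> R) :
  (forall a, a \in s -> 0 < F a) -> exists2 e, 0 < e & forall a, a \in s -> e <= F a.
Proof.
elim: s => [|a s IH] h; first by exists 1.
have [b bs|e e0 he] := IH; first by apply: h; rewrite inE bs orbT.
have Fa : 0 < F a by apply: h; rewrite inE eqxx.
exists (Num.min e (F a)); first by rewrite lt_min e0.
by move=> b; rewrite inE ge_min => /predU1P[->|/he ->//]; rewrite lexx orbT.
Qed.

Lemma prod_ge_exp (R : realType) (T : eqType) (s : seq T) (F : T -> R) (e : R) : 0 <= e ->
  (forall a, a \in s -> e <= F a) -> e ^+ size s <= \prod_(a <- s) F a.
Proof.
move=> e0; elim: s => [|a s IH] h; first by rewrite big_nil.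
rewrite big_cons exprS ler_pM ?exprn_ge0 ?h ?inE ?eqxx // IH // => b bs.
by rewrite h // inE bs orbT.
Qed.

Lemma prod_le1 (R : realType) (T : eqType) (s : seq T) (F : T -> R) :
  (forall a, a \in s -> 0 <= F a <= 1) -> 0 <= \prod_(a <- s) F a <= 1.
Proof.
elim: s => [|a s IH] h; first by rewrite big_nil ler01 lexx.
have /andP[h1 h2] : 0 <= F a <= 1 by rewrite h // inE eqxx.
have /andP[h3 h4] : 0 <= \prod_(a <- s) F a <= 1.
  by apply: IH => b bs; rewrite h // inE bs orbT.
by rewrite big_cons mulr_ge0 //= mulr_ile1.
Qed.

Section RationalMaps.
Variables (R : realType) (K : cpField R).
Local Notation v := (@uabs R K).
Local Notation dist := (@cdist R K).
Implicit Types (x y z w : option K) (g h : option K -> option K).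

(** Over an algebraically closed field, the absence of a common zero says that the two forms are
    coprime, so [n] is the degree of the map. *)
Definition ratlmap n g := exists P Q : K * K -> K,
  [/\ isform n P, isform n Q, forall u : K * K, u != 0 -> (P u, Q u) != 0 &
      forall x, g x = hproj (P (hcoord x), Q (hcoord x))].

Lemma prod_chordal_le1 (s : seq (option K)) x : 0 <= \prod_(a <- s) dist x a <= 1.
Proof. by apply: prod_le1 => a _; rewrite chordal_ge0 chordal_le1. Qed.

Lemma ratlmap_comp n m g h : ratlmap n g -> ratlmap m h -> ratlmap (n * m) (g \o h).
Proof.
move=> [P [Q [hP hQ PQ hg]]] [P' [Q' [hP' hQ' PQ' hh]]].
exists (fun u => P (P' u, Q' u)), (fun u => Q (P' u, Q' u)); split.
- exact: isform_comp.
- exact: isform_comp.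
- by move=> u /PQ' /PQ.
- move=> x /=; rewrite hg hh.
  have [c c0 ->] := hprojK (PQ' _ (hcoord_neq0 x)).
  rewrite (isform_scale c _ hP) (isform_scale c _ hQ).
  by rewrite -[RHS](@hproj_scale _ _ (c ^+ n)) // expf_neq0.
Qed.

Lemma ratlmap_id : ratlmap 1 id.
Proof.
exists fst, snd; split; [exact: isform_fst|exact: isform_snd|by case|].
by move=> x; rewrite -{1}(hcoordK x); case: (hcoord x).
Qed.

Lemma ratlmap_iter n g k : ratlmap n g -> ratlmap (n ^ k) (iter k g).
Proof.
move=> hg; elim: k => [|k IH]; first by rewrite expn0; exact: ratlmap_id.
by rewrite expnS; exact: (ratlmap_comp hg IH).
Qed.

Lemma isform_root n F : isform n.+1 F -> exists2 a : option K, true & F (hcoord a) = 0.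
Proof.
move=> /isform_factor[h|[[//|a s] _ [c _ hF]]]; first by exists None.
exists a => //; rewrite hF big_cons.
have -> : det2 (hcoord a) (hcoord a) = 0; [by rewrite /det2; ring|by rewrite mul0r mulr0].
Qed.

Lemma isform_bound n F : isform n F ->
  exists2 A : R, 0 <= A & forall x, v (F (hcoord x)) <= A * nrm (hcoord x) ^+ n.
Proof.
move=> hF; have [h|h] := pselect (exists u, F u != 0).
  have [s _ [c c0 [_ hs]]] := isform_abs hF h.
  exists c; first exact: ltW.
  move=> x; rewrite hs ler_piMr ?mulr_ge0 ?exprn_ge0 ?nrm_ge0 ?(ltW c0) //.
  by case/andP: (prod_chordal_le1 s x).
exists 0 => // x; rewrite mul0r; have [->|h0] := eqVneq (F (hcoord x)) 0.
  by rewrite uabs0.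
by case: h; exists (hcoord x).
Qed.

Lemma generic_dist1 (s : seq (option K)) : exists z : K, forall a, a \in s -> dist (Some z) a = 1.
Proof.
(* Points outside the closed unit disc, infinity included, are at distance 1 from all of that disc;
   only the others have to be avoided. *)
have [|z z1 hz] := @generic_unit R K (0 :: pmap (fun a : option K =>
    if a is Some b then if v b <= 1 then Some b else None else None) s).
  move=> c; rewrite inE => /predU1P[->|]; first by rewrite uabs0.
  by rewrite mem_pmap => /mapP[[b|] //= _]; case: ifP => // h [->].
exists z => -[b|] hb; last by rewrite chordal_inf max_r // invr1.
rewrite chordal_some (max_r z1) mul1r.
have [h|h] := leP (v b) 1.
  rewrite divr1 hz // inE mem_pmap; apply/orP; right; apply/mapP.
  by exists (Some b) => //=; rewrite h.
by rewrite uabsB_eqr ?divff ?gt_eqF ?(lt_trans ltr01) // (le_lt_trans z1).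
Qed.

(** The quotient measures the lift on normalized vectors. Its lower bound plays the role of a
    resultant: the zeros of [P] and of [Q] are separated, so every point is far from the zeros of
    one of the two. No combination of [P] and [Q] vanishes identically, because a zero of one of
    them would then be common to both. *)
Lemma ratlmap_norm n g : (0 < n)%N -> ratlmap n g -> exists P Q : K * K -> K, exists A B : R,
  [/\ isform n P, isform n Q, forall u : K * K, u != 0 -> (P u, Q u) != 0 &
      forall x, g x = hproj (P (hcoord x), Q (hcoord x))] /\
  [/\ 0 < B, forall x, B <= nrm (P (hcoord x), Q (hcoord x)) / nrm (hcoord x) ^+ n <= A &
      forall a b : K, (a, b) != 0 -> exists u, a * P u + b * Q u != 0].
Proof.
case: n => // n _ [P [Q [hP hQ PQ hg]]].
have nz_comb (a b : K) : (a, b) != 0 -> exists u, a * P u + b * Q u != 0.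
  move=> ab; apply: contrapT => hno.
  have h u : a * P u + b * Q u = 0.
    by apply/eqP; apply: contraT => hu; case: hno; exists u.
  have [a0|a0] := eqVneq a 0.
    have b0 : b != 0 by apply: contraNneq ab => ->; rewrite a0.
    have Q0 u : Q u = 0.
      by have := h u; rewrite a0 mul0r add0r => /eqP; rewrite mulf_eq0 (negPf b0) => /eqP.
    have [c _ hc] := isform_root hP.
    by have := PQ _ (hcoord_neq0 c); rewrite hc Q0 eqxx.
  have [c _ hc] := isform_root hQ.
  have := PQ _ (hcoord_neq0 c); rewrite hc.
  have := h (hcoord c); rewrite hc mulr0 addr0 => /eqP.
  by rewrite mulf_eq0 (negPf a0) => /eqP ->; rewrite eqxx.
pose G x := (P (hcoord x), Q (hcoord x)).
have G0 x : G x != 0 by apply: PQ; exact: hcoord_neq0.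
have nG x : 0 < nrm (G x) by rewrite nrm_gt0.
have [A1 A10 hA1] := isform_bound hP; have [A2 A20 hA2] := isform_bound hQ.
have [|sP _ [cP cP0 [sP0 hsP]]] := isform_abs hP.
  have [|u hu] := nz_comb 1 0; first by rewrite xpair_eqE oner_eq0.
  by exists u; move: hu; rewrite mul1r mul0r addr0.
have [|sQ _ [cQ cQ0 [sQ0 hsQ]]] := isform_abs hQ.
  have [|u hu] := nz_comb 0 1; first by rewrite xpair_eqE oner_eq0 andbF.
  by exists u; move: hu; rewrite mul1r mul0r add0r.
have [e e0 he] : exists2 e, 0 < e & forall ab, ab \in [seq (a, b) | a <- sP, b <- sQ] ->
    e <= dist ab.1 ab.2.
  apply: seq_pos_lb => -[a b] /allpairsP[[a' b'] /= [ha hb [-> ->]]].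
  rewrite chordal_gt0; apply/eqP => ab.
  by have := PQ _ (hcoord_neq0 a'); rewrite sP0 // ab sQ0 // eqxx.
pose e1 := Num.min e 1.
have e10 : 0 < e1 by rewrite lt_min e0 ltr01.
exists P, Q, (Num.max A1 A2), (Num.min cP cQ * e1 ^+ (size sP + size sQ)).
split; first by split.
rewrite -/(G _); split; last exact: nz_comb.
- by rewrite mulr_gt0 ?exprn_gt0 // lt_min cP0.
- move=> x; have hx : 0 < nrm (hcoord x) ^+ n.+1 by rewrite exprn_gt0 ?nrm_hcoord_gt0.
  rewrite ler_pdivlMr // ler_pdivrMr //; apply/andP; split; last first.
    by rewrite maxr_pMl ?(ltW hx) // /nrm ge_max !le_max hA1 hA2 orbT.
  have aux (s t : seq (option K)) (c : R) : 0 < c -> (forall a, a \in s -> e1 <= dist x a) ->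
      Num.min cP cQ <= c -> Num.min cP cQ * e1 ^+ (size s + size t) * nrm (hcoord x) ^+ n.+1 <=
      c * nrm (hcoord x) ^+ n.+1 * \prod_(a <- s) dist x a.
    move=> c0 hs hc; rewrite [leRHS]mulrAC ler_wpM2r ?(ltW hx) //.
    apply: ler_pM => //; rewrite ?exprn_ge0 ?(ltW e10) //.
      by rewrite le_min !ltW.
    apply: le_trans (prod_ge_exp (ltW e10) hs).
    rewrite exprD ler_piMr ?exprn_ge0 ?(ltW e10) // exprn_ile1 ?(ltW e10) //.
    by rewrite ge_min lexx orbT.
  (* A point closer than [e1] to a zero of [P] is at distance at least [e1] from all zeros of
     [Q]. *)
  have [[a aP ha]|hno] := pselect (exists2 a, a \in sP & dist x a < e1); last first.
    apply: le_trans (_ : v (P (hcoord x)) <= _); last by rewrite le_max lexx.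
    rewrite hsP; apply: aux => //; last by rewrite ge_min lexx.
    by move=> a aP; rewrite leNgt; apply/negP => ha; apply: hno; exists a.
  apply: le_trans (_ : v (Q (hcoord x)) <= _); last by rewrite le_max lexx orbT.
  rewrite hsQ addnC; apply: aux => //; last by rewrite ge_min lexx orbT.
  move=> b bQ; have hab : e1 <= dist a b.
    by rewrite ge_min (he (a, b)) //; apply/allpairsP; exists (a, b).
  by rewrite (@chordal_eq _ _ _ a) // (lt_le_trans ha).
Qed.

(** The form [det2 (P, Q) u] has the fibre of [u] as its zeros, with multiplicity. The size [N] of
    the lift does not depend on [u], so it cancels when two fibres are compared. *)
Lemma ratlmap_factor n g : (0 < n)%N -> ratlmap n g ->
  exists N : option K -> R, exists A B : R,
    [/\ 0 < B, (forall x, B <= N x <= A) &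
     forall u, exists2 s : seq (option K), size s = n &
      exists2 C, 0 < C & (forall a, a \in s -> g a = u) /\
        forall x, dist (g x) u * N x = C * \prod_(a <- s) dist x a].
Proof.
move=> n0 /(ratlmap_norm n0)[P [Q [A [B [[hP hQ PQ hg] [B0 hN nz_comb]]]]]].
pose G x := (P (hcoord x), Q (hcoord x)).
have G0 x : G x != 0 by apply: PQ; exact: hcoord_neq0.
have nG x : 0 < nrm (G x) by rewrite nrm_gt0.
exists (fun x => nrm (G x) / nrm (hcoord x) ^+ n), A, B; split => //.
move=> u.
  have hF : isform n (fun p => det2 (P p, Q p) (hcoord u)).
    apply: isform_ext (isform_lin (hcoord u).2 (- (hcoord u).1) hP hQ) => p.
    by rewrite /det2 /=; ring.
  have [|s ss [C C0 [hs0 hs]]] := isform_abs hF.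
    have [|p hp] := nz_comb (hcoord u).2 (- (hcoord u).1).
      by case: (u) => [z|]; rewrite xpair_eqE /= ?oppr_eq0 oner_eq0 ?andbF.
    exists p; apply: contraNneq hp; rewrite /det2 /= => <-; apply/eqP; ring.
  have gu x : dist (g x) u = v (det2 (G x) (hcoord u)) / (nrm (G x) * nrm (hcoord u)).
    by rewrite hg -{1}(hcoordK u) (chordal_hproj (G0 x) (hcoord_neq0 u)).
  have hu := nrm_hcoord_gt0 u.
  exists s => //; exists (C / nrm (hcoord u)); first by rewrite divr_gt0.
  split=> [a /hs0 ha|x].
    by apply/eqP; rewrite -(@chordal_eq0 _ K) gu ha uabs0 mul0r.
  rewrite gu hs; have hx := nrm_hcoord_gt0 x; have := nG x.
  move=> /lt0r_neq0 h1; move: hu hx => /lt0r_neq0 h2 /lt0r_neq0 h3.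
  by field; rewrite h1 h2 expf_neq0.
Qed.

(** The constant is uniform in [u]: the map takes two values at distance [d], each [u] is at
    distance at least [d] from one of them, and evaluating the factorization there bounds its
    leading constant from below. *)
Lemma ratlmap_lower n g : (0 < n)%N -> ratlmap n g -> exists2 c : R, 0 < c &
  forall u, exists2 s : seq (option K), size s = n &
    (forall a, a \in s -> g a = u) /\ forall x, c * \prod_(a <- s) dist x a <= dist (g x) u.
Proof.
move=> n0 hg; have [N [A [B [B0 hN hf]]]] := ratlmap_factor n0 hg.
have [s0 _ [C0 C00 [_ hs0]]] := hf (g None).
have [z hz] := generic_dist1 s0.
have N0 x : 0 < N x by case/andP: (hN x) => /(lt_le_trans B0).
have A0 : 0 < A by case/andP: (hN None) => h; apply: lt_le_trans; exact: lt_le_trans h.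
have d0 : 0 < dist (g (Some z)) (g None).
  rewrite -(pmulr_lgt0 _ (N0 (Some z))) hs0 mulr_gt0 // (eq_big_seq (fun=> 1)) //.
  by rewrite big1.
set d := dist _ _ in d0.
exists (d * B / A); first by rewrite divr_gt0 // mulr_gt0.
move=> u; have [s ss [C C_gt0 [hsu hs]]] := hf u; exists s => //; split => // x.
have [t ht] : exists t, d <= dist (g t) u.
  have [h|h] := @chordal_ge _ K u (g (Some z)) (g None); first by exists (Some z).
  by exists None; rewrite chordalC.
have hC : d * B <= C.
  apply: le_trans (_ : dist (g t) u * N t <= _).
    by apply: ler_pM => //; rewrite ?(ltW d0) ?(ltW B0) //; case/andP: (hN t).
  rewrite hs; have /andP[_ p1] := prod_chordal_le1 s t.
  by apply: ler_piMr => //; exact: ltW.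
rewrite -(ler_pM2r (N0 x)) hs.
have -> : d * B / A * \prod_(a <- s) dist x a * N x =
   (d * B) * \prod_(a <- s) dist x a * (N x / A) by ring.
have /andP[p0 p1] := prod_chordal_le1 s x.
apply: le_trans (_ : d * B * \prod_(a <- s) dist x a <= _); last by rewrite ler_wpM2r.
rewrite -[leRHS]mulr1; apply: ler_wpM2l.
  by apply: mulr_ge0 => //; apply: ltW; apply: mulr_gt0.
rewrite ler_pdivrMr // mul1r.
by case/andP: (hN x).
Qed.

(** In the factorization for the fibre of [g y] one factor is [dist x y] and the others are at most
    1; a point at distance 1 from the whole fibre bounds the constant. *)
Lemma ratlmap_lipschitz n g : (0 < n)%N -> ratlmap n g -> exists2 M : R, 0 < M &
  forall x y, dist (g x) (g y) <= M * dist x y.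
Proof.
move=> n0 hg; have [N [A [B [B0 hN hf]]]] := ratlmap_factor n0 hg.
have N0 x : 0 < N x by case/andP: (hN x) => /(lt_le_trans B0).
have A0 : 0 < A by case/andP: (hN None) => h; apply: lt_le_trans; exact: lt_le_trans h.
exists (A / B); first exact: divr_gt0.
move=> x y; have [s ss [C C_gt0 [hsu hs]]] := hf (g y).
have hC : C <= A.
  have [z hz] := generic_dist1 s.
  have := hs (Some z); rewrite [in RHS](eq_big_seq (fun=> 1)) // big1 // mulr1 => <-.
  rewrite -[A]mul1r; apply: ler_pM; rewrite ?chordal_ge0 ?(ltW (N0 _)) ?chordal_le1 //.
  by case/andP: (hN (Some z)).
have ys : y \in s.
  have := hs y; rewrite chordalxx mul0r => /esym/eqP; rewrite mulf_eq0 gt_eqF //= prodf_seq_eq0.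
  by move=> /hasP[a aS /=]; rewrite chordal_eq0 => /eqP ->.
rewrite -(ler_pM2r (N0 x)) hs (big_rem y) //=.
have /andP[p0 p1] := prod_chordal_le1 (rem y s) x.
apply: le_trans (_ : C * dist x y <= _).
  by rewrite ler_wpM2l ?(ltW C_gt0) // ler_piMr ?chordal_ge0.
have -> : A / B * dist x y * N x = (A * dist x y) * (N x / B) by ring.
apply: le_trans (_ : A * dist x y <= _); first by rewrite ler_wpM2r ?chordal_ge0.
apply: ler_peMr; first by rewrite mulr_ge0 ?chordal_ge0 // ltW.
rewrite ler_pdivlMr // mul1r.
by case/andP: (hN x).
Qed.

Lemma ratlmap_surj n g (u : option K) : (0 < n)%N -> ratlmap n g -> exists a, g a = u.
Proof.
move=> n0 hg; have [N [A [B [B0 hN /(_ u)]]]] := ratlmap_factor n0 hg.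
by move=> [[|a s] ss [C _ [h _]]]; [rewrite -ss in n0|exists a; apply: h; rewrite inE eqxx].
Qed.

Lemma near_dist (z : option K) (e : R) : 0 < e -> exists2 y, y != z & dist y z < e.
Proof.
move=> e0; pose e1 := Num.min e 1.
have e10 : 0 < e1 by rewrite lt_min e0 ltr01.
case: z => [z|]; last first.
  have [||c c0 /andP[h1 h2]] := @radius_exists R K (e1 / 2) e1.
  - by rewrite divr_gt0.
  - by rewrite ltr_pdivrMr // mulr2n mulrDr mulr1 ltrDl.
  exists (Some c^-1) => //; rewrite chordal_inf uabsV.
  have vc : 0 < v c by rewrite uabs_gt0.
  have c1 : 1 <= (v c)^-1 by rewrite invf_ge1 // (le_trans (ltW h2)) // ge_min lexx orbT.
  by rewrite max_l // invrK (lt_le_trans h2) // ge_min lexx.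
have [||c c0 /andP[h1 h2]] := @radius_exists R K (e1 / 2) e1.
- by rewrite divr_gt0.
- by rewrite ltr_pdivrMr // mulr2n mulrDr mulr1 ltrDl.
exists (Some (z + c)); first by apply/eqP => -[/eqP]; rewrite -subr_eq0 addrAC subrr add0r (negPf c0).
rewrite chordal_some addrAC subrr add0r ltr_pdivrMr; last by rewrite mulr_gt0 // lt_max ltr01 orbT.
apply: lt_le_trans h2 _; apply: le_trans (_ : e <= _); first by rewrite ge_min lexx.
have m1 a : 1 <= Num.max (v a) 1 by rewrite le_max lexx orbT.
by apply: ler_peMr; [exact: ltW|apply: le_trans (_ : 1 * 1 <= _); [rewrite mulr1|exact: ler_pM]].
Qed.

(** The fixed points are the zeros of the form [det2 (P u, Q u) u] of degree n + 1, so the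
    displacement is comparable to the product of the distances to them. *)
Lemma ratlmap_fix n g : (1 < n)%N -> ratlmap n g ->
  exists2 s : seq (option K), size s = n.+1 &
    exists C1 C2 : R, [/\ 0 < C1, (forall a, a \in s -> g a = a) &
      forall x, C1 * \prod_(a <- s) dist x a <= dist (g x) x <= C2 * \prod_(a <- s) dist x a].
Proof.
move=> n1 hg; have n0 := ltnW n1.
have [P [Q [A [B [[hP hQ PQ hgE] [B0 hN nz_comb]]]]]] := ratlmap_norm n0 hg.
have hF : isform n.+1 (fun u => det2 (P u, Q u) u).
  have := isform_lin 1 (-1) (isform_mul hP (@isform_snd _ K)) (isform_mul hQ (@isform_fst _ K)).
  by rewrite addn1; apply: isform_ext => u; rewrite /det2 /=; ring.
pose G x := (P (hcoord x), Q (hcoord x)).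
have G0 x : G x != 0 by apply: PQ; exact: hcoord_neq0.
have gE x : dist (g x) x = v (det2 (G x) (hcoord x)) / (nrm (G x) * nrm (hcoord x)).
  by have := chordal_hproj (G0 x) (hcoord_neq0 x); rewrite hcoordK /G -hgE.
have [|s ss [C C0 [hs0 hs]]] := isform_abs hF.
  (* If all points were fixed, the fibre of infinity would be infinity taken n > 1 times, and the
     distance to infinity would be comparable to its n-th power. *)
  apply: contrapT => hno.
  have gid x : g x = x.
    apply/eqP; rewrite -(@chordal_eq0 _ K) gE.
    have [->|h] := eqVneq (det2 (G x) (hcoord x)) 0; first by rewrite uabs0 mul0r.
    by case: hno; exists (hcoord x).
  have [N [A' [B' [B'0 hN' hf]]]] := ratlmap_factor n0 hg.
  have [s ss [C C0 [hs hsx]]] := hf None.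
  have [y yN hy] := @near_dist None (B' / C) (divr_gt0 B'0 C0).
  have := hsx y; rewrite gid (eq_big_seq (fun=> dist y None)); last first.
    by move=> a /hs; rewrite gid => ->.
  rewrite big_const_seq count_predT iter_mulr_1 ss -(prednK n0) exprS mulrCA.
  have d0 : dist y None != 0 by rewrite chordal_eq0.
  move/(mulfI d0) => e; have /andP[hB _] := hN' y.
  suff : C * dist y None ^+ n.-1 < B' by rewrite -e ltNge hB.
  apply: le_lt_trans (_ : C * dist y None < _); last by rewrite mulrC -ltr_pdivlMr.
  rewrite ler_wpM2l ?(ltW C0) // -[n.-1]prednK; last by rewrite -ltnS prednK.
  by rewrite exprS ler_piMr ?chordal_ge0 // exprn_ile1 ?chordal_ge0 ?chordal_le1.
have A0 : 0 < A by case/andP: (hN None) => h; apply: lt_le_trans; exact: lt_le_trans h.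
exists s => //; exists (C / A), (C / B); split; first exact: divr_gt0.
  move=> a /hs0 ha; apply/eqP; rewrite -(@chordal_eq0 _ K) gE ha uabs0 mul0r //.
move=> x; set p := \prod_(a <- s) _.
have /andP[p0 _] : 0 <= p <= 1 := prod_chordal_le1 s x.
have hx := nrm_hcoord_gt0 x; have hG : 0 < nrm (G x) by rewrite nrm_gt0.
have e : dist (g x) x = C * p / (nrm (G x) / nrm (hcoord x) ^+ n).
  rewrite gE hs exprS -/p; move: hx hG => /lt0r_neq0 hx /lt0r_neq0 hG.
  by field; rewrite ?expf_neq0 ?hx ?hG.
have /andP[h1 h2] := hN x; rewrite -/(G x) in h1 h2.
have N0 := lt_le_trans B0 h1.
have Cp : 0 <= C * p by apply: mulr_ge0 => //; exact: ltW.
rewrite e ![C / _ * p]mulrAC; apply/andP.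
by split; apply: ler_wpM2l => //; rewrite lef_pV2.
Qed.

(** If the whole fibre of [w] stayed at distance [e] from [x], then [ratlmap_lower] would keep [g x]
    at distance [c * e ^+ n] from [w]. *)
Lemma ratlmap_open n g x (e : R) : (0 < n)%N -> ratlmap n g -> 0 < e ->
  exists2 d : R, 0 < d & forall w, dist w (g x) < d -> exists2 y, dist y x < e & g y = w.
Proof.
move=> n0 hg e0; have [c c0 hc] := ratlmap_lower n0 hg.
exists (c * e ^+ n); first by rewrite mulr_gt0 // exprn_gt0.
move=> w hw; have [s ss [hs hl]] := hc w.
have [[a aS ha]|hno] := pselect (exists2 a, a \in s & dist a x < e).
  by exists a => //; exact: hs.
have := hl x; rewrite leNgt chordalC (lt_le_trans hw) //.
rewrite ler_wpM2l ?(ltW c0) // -ss; apply: prod_ge_exp => [|a aS]; first exact: ltW.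
by rewrite leNgt; apply/negP => h; apply: hno; exists a => //; rewrite chordalC.
Qed.

Lemma ratlmap_cont n g x (e : R) : (0 < n)%N -> ratlmap n g -> 0 < e ->
  exists2 d : R, 0 < d & forall y, dist y x < d -> dist (g y) (g x) < e.
Proof.
move=> n0 hg e0; have [M M0 hM] := ratlmap_lipschitz n0 hg.
exists (e / M); first exact: divr_gt0.
move=> y hy; apply: le_lt_trans (hM _ _) _.
by rewrite mulrC -ltr_pdivlMr.
Qed.

End RationalMaps.

(** * Moebius isometries as changes of coordinate *)

Section Isometries.
Variables (R : realType) (K : cpField R).
Local Notation v := (@uabs R K).
Local Notation dist := (@cdist R K).
Implicit Types (x y z w : option K) (M N : option K -> option K).

Lemma oballE (a : K) (r : R) :
  oball v a r = [set x | if x is Some z then v (z - a) < r else False].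
Proof.
apply/seteqP; split => [x [z /= h <-] //|[z|] //= h]; by exists z.
Qed.

Lemma cballE (a : K) (r : R) :
  cball v a r = [set x | if x is Some z then v (z - a) <= r else False].
Proof.
apply/seteqP; split => [x [z /= h <-] //|[z|] //= h]; by exists z.
Qed.

(** These coordinate changes move a given point to 0 or to infinity. Preservation of open balls is
    carried along because affinoids are defined through balls of [K], not through the chordal
    metric. *)
Definition misom M N :=
  [/\ cancel M N, cancel N M & forall x y, dist (M x) (M y) = dist x y] /\
  [/\ ratlmap 1 M, ratlmap 1 N,
      forall B, open_ball v B -> open_ball v (M @^-1` B) &
      forall B, open_ball v B -> open_ball v (N @^-1` B)].

Lemma misom_comp M N M' N' : misom M N -> misom M' N' -> misom (M \o M') (N' \o N).
Proof.
move=> [[h1 h2 h3] [h4 h5 h6 h7]] [[k1 k2 k3] [k4 k5 k6 k7]]; split; split.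
- exact: can_comp.
- exact: can_comp.
- by move=> x y /=; rewrite h3 k3.
- exact: (@ratlmap_comp R K 1 1).
- exact: (@ratlmap_comp R K 1 1).
- by move=> B /h6 /k6.
- by move=> B /k7 /h7.
Qed.

Lemma misom_id : misom id id.
Proof. by do !split => //; apply: ratlmap_id. Qed.

Definition tau (b : K) x : option K := if x is Some z then Some (z + b) else None.

Lemma tauK b : cancel (tau b) (tau (- b)).
Proof. by case=> //= z; rewrite addrK. Qed.

Lemma tauE b x : tau b x = hproj ((hcoord x).1 + b * (hcoord x).2, (hcoord x).2).
Proof.
by case: x => [z|]; rewrite /hproj /= ?oner_eq0 ?eqxx // mulr1 divr1.
Qed.

Lemma ratlmap_tau b : ratlmap 1 (tau b).
Proof.
exists (fun u => u.1 + b * u.2), snd; split.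
- by apply: isform_ext (isform_lin 1 b (@isform_fst _ _) (@isform_snd _ _)) => u /=; rewrite mul1r.
- exact: isform_snd.
- move=> [s t]; apply: contraNneq => /= -[hs ht]; move: hs.
  by rewrite ht mulr0 addr0 => ->.
- by move=> x; rewrite tauE.
Qed.

Lemma dist_tau b x y : v b <= 1 -> dist (tau b x) (tau b y) = dist x y.
Proof.
move=> b1; have hn (u : K * K) : nrm (u.1 + b * u.2, u.2) = nrm u.
  have h (c : K) (w : K * K) : v c <= 1 -> nrm (w.1 + c * w.2, w.2) <= nrm w.
    move=> hc; rewrite /nrm ge_max /= le_max [X in _ && X]le_max lexx orbT andbT -le_max.
    apply: uabsD_le; first by rewrite le_max lexx.
    by rewrite uabsM le_max ler_piMl ?orbT ?uabs_ge0.
  apply/eqP; rewrite eq_le h //=.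
  have := h (- b) (u.1 + b * u.2, u.2); rewrite uabsN => /(_ b1) /=.
  by rewrite mulNr addrK; case: (u).
have h0 z : ((hcoord z).1 + b * (hcoord z).2, (hcoord z).2) != 0.
  by rewrite -nrm_gt0 hn nrm_hcoord_gt0.
rewrite !tauE (chordal_hproj (h0 x) (h0 y)) !hn chordalE; congr (v _ / _).
by rewrite /det2 /=; ring.
Qed.

Lemma preimage_tau b B : open_ball v B -> open_ball v (tau b @^-1` B).
Proof.
move=> [a [r [hr hB]]]; exists (a - b), r; split => //.
have e (z : K) : v (z + b - a) = v (z - (a - b)) by congr v; ring.
case: hB => ->; [left|right]; apply/seteqP;
  by split => -[z|]; rewrite ?oballE ?cballE //= e.
Qed.

Lemma misom_tau b : v b <= 1 -> misom (tau b) (tau (- b)).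
Proof.
move=> hb; split; split.
- exact: tauK.
- by rewrite -{2}(opprK b); exact: tauK.
- by move=> x y; exact: dist_tau.
- exact: ratlmap_tau.
- exact: ratlmap_tau.
- exact: preimage_tau.
- exact: preimage_tau.
Qed.

Local Notation sigma := (@inv_chart K).

Lemma sigmaK : involutive sigma.
Proof.
case=> [z|] /=; last by rewrite eqxx.
by case: eqP => [->//|/eqP z0] /=; rewrite invr_eq0 (negPf z0) invrK.
Qed.

Lemma sigmaE x : sigma x = hproj ((hcoord x).2, (hcoord x).1).
Proof. by case: x => [z|]; rewrite /hproj /= ?oner_eq0 ?mul0r // div1r. Qed.

Lemma ratlmap_sigma : ratlmap 1 sigma.
Proof.
exists snd, fst; split; [exact: isform_snd|exact: isform_fst| |exact: sigmaE].
by move=> [a b]; apply: contraNneq => /= -[-> ->].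
Qed.

Lemma dist_sigma x y : dist (sigma x) (sigma y) = dist x y.
Proof.
have hn (u : K * K) : nrm (u.2, u.1) = nrm u by rewrite /nrm /= maxC.
have h0 z : ((hcoord z).2, (hcoord z).1) != 0 by rewrite -nrm_gt0 hn nrm_hcoord_gt0.
rewrite !sigmaE (chordal_hproj (h0 x) (h0 y)) !hn chordalE; congr (_ / _).
by rewrite /det2 /= uabs_distC; congr v; ring.
Qed.

(** On a ball around [a] that misses 0 the norm is constant, so inversion scales distances there by
    the constant factor [v a ^- 2]. *)
Lemma sigma_ball (a z : K) (r : R) : r <= v a -> 0 < r -> z != 0 ->
  (v (z^-1 - a) < r <-> v (z - a^-1) < r / v a ^+ 2) /\
  (r < v a -> (v (z^-1 - a) <= r <-> v (z - a^-1) <= r / v a ^+ 2)).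
Proof.
move=> ra r0 z0; have va : 0 < v a := lt_le_trans r0 ra.
have a0 : a != 0 by rewrite -uabs_gt0.
have vz : 0 < v z by rewrite uabs_gt0.
have e : v (z^-1 - a) * v z = v a * v (z - a^-1).
  by rewrite uabs_distC -!uabsM; congr v; field; rewrite ?z0 ?a0.
have key : v z = (v a)^-1 -> v (z^-1 - a) = v (z - a^-1) * v a ^+ 2.
  move=> hz; have vz' : v z != 0 by rewrite gt_eqF.
  apply: (mulIf vz'); rewrite e hz expr2.
  by field; rewrite gt_eqF.
have h1 : v (z^-1 - a) < v a -> v z = (v a)^-1.
  move=> h; have : v z^-1 = v a by rewrite -(subrK a z^-1) uabsD_eqr.
  by rewrite uabsV => <-; rewrite invrK.
have h2 : v (z - a^-1) < (v a)^-1 -> v z = (v a)^-1.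
  by move=> h; rewrite -(subrK a^-1 z) uabsD_eqr uabsV.
have va2 : 0 < v a ^+ 2 by rewrite exprn_gt0.
have hr1 : r / v a ^+ 2 <= (v a)^-1.
  by rewrite ler_pdivrMr // expr2 mulrA mulVf ?gt_eqF // mul1r.
split; [|move=> ra']; split => h.
- by rewrite ltr_pdivlMr // -key // h1 // (lt_le_trans h).
- by rewrite key ?h2 ?(lt_le_trans h) // -ltr_pdivlMr.
- by rewrite ler_pdivlMr // -key // h1 // (le_lt_trans h).
- rewrite key -?ler_pdivlMr //; apply: h2; apply: le_lt_trans h _.
  by rewrite ltr_pdivrMr // expr2 mulrA mulVf ?gt_eqF // mul1r.
Qed.

Lemma preimage_sigma B : open_ball v B -> open_ball v (sigma @^-1` B).
Proof.
move=> [a [r [[c c0 hr] hB]]]; have r0 : 0 < r by rewrite hr uabs_gt0.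
have rV : abs_radius v r^-1 by exists c^-1; rewrite ?invr_eq0 // hr uabsV.
have ra2 : a != 0 -> abs_radius v (r / v a ^+ 2).
  by move=> a0; exists (c / a ^+ 2); rewrite ?mulf_neq0 ?invr_eq0 ?expf_neq0 // hr uabs_div uabsX.
have hinv (z : K) : z != 0 -> (v z^-1 < r) = (r^-1 < v z) /\ (v z^-1 <= r) = (r^-1 <= v z).
  move=> z0; rewrite uabsV; have vz : 0 < v z by rewrite uabs_gt0.
  by split; [rewrite -(invrK r) ltf_pV2 ?posrE ?invr_gt0 // invrK|
             rewrite -(invrK r) lef_pV2 ?posrE ?invr_gt0 // invrK].
case: hB => ->.
  have [ar|ra] := ltP (v a) r.
    exists 0, r^-1; split => //; right; apply/seteqP; split => -[z|];
      rewrite oballE cballE /= ?subr0 //.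
    - case: eqP => //= /eqP z0 h; apply/negP; rewrite -ltNge -(hinv _ z0).1.
      by rewrite -(subrK a z^-1); apply: uabsD_lt.
    - by move=> _ [].
    - move=> /negP; rewrite -ltNge => h; have z0 : z != 0.
        by rewrite -uabs_gt0 (lt_trans _ h) // invr_gt0.
      by rewrite (negPf z0); apply: uabsB_lt => //; rewrite (hinv _ z0).1.
    - by move=> _; rewrite sub0r uabsN.
  have a0 : a != 0 by rewrite -uabs_gt0 (lt_le_trans r0).
  exists a^-1, (r / v a ^+ 2); split; [exact: ra2|left].
  apply/seteqP; split => -[z|]; rewrite !oballE /= ?sub0r ?uabsN ?ltNge ?ra //.
    by case: eqP => //= /eqP z0; rewrite -!ltNge => /(sigma_ball ra r0 z0).1.
  case: eqP => [->|/eqP z0]; last by rewrite -!ltNge => /(sigma_ball ra r0 z0).1.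
  rewrite sub0r uabsN uabsV -ltNge ltr_pdivlMr ?exprn_gt0 ?uabs_gt0 // expr2 mulKf ?uabs_eq0 //.
  by rewrite ltNge ra.
have [ar|ra] := leP (v a) r.
  exists 0, r^-1; split => //; left; apply/seteqP; split => -[z|];
    rewrite oballE cballE /= ?subr0 ?sub0r ?uabsN //.
  - case: eqP => [->|/eqP z0 /=]; first by rewrite uabs0 invr_gt0.
    move=> h; rewrite ltNge; apply/negP => h2; apply: h.
    by apply: uabsB_le => //; rewrite (hinv _ z0).2.
  - have [->|z0] := eqVneq z 0; first by move=> _ [].
    rewrite ltNge => /negP h h2; apply: h.
    by rewrite -(hinv _ z0).2 -(subrK a z^-1); apply: uabsD_le.
have a0 : a != 0 by rewrite -uabs_gt0 (lt_trans r0).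
exists a^-1, (r / v a ^+ 2); split; [exact: ra2|right].
apply/seteqP; split => -[z|]; rewrite !cballE /= ?sub0r ?uabsN //.
- case: eqP => [->|/eqP z0] /= h; last by rewrite -((sigma_ball (ltW ra) r0 z0).2 ra).
  apply/negP; rewrite -ltNge sub0r uabsN uabsV ltr_pdivrMr ?exprn_gt0 ?uabs_gt0 //.
  by rewrite expr2 mulKf ?uabs_eq0.
- by move=> _ [].
- have [->|z0] := eqVneq z 0; first by move=> _ [].
  by rewrite -((sigma_ball (ltW ra) r0 z0).2 ra).
- by move=> _; apply/negP; rewrite -ltNge.
Qed.

Lemma misom_sigma : misom sigma sigma.
Proof.
split; split; [exact: sigmaK|exact: sigmaK|exact: dist_sigma|exact: ratlmap_sigma|
  exact: ratlmap_sigma|exact: preimage_sigma|exact: preimage_sigma].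
Qed.

Lemma misom_to_inf y : exists M N, misom M N /\ M y = None.
Proof.
case: y => [a|]; last by exists id, id; split => //; exact: misom_id.
have [h|h] := leP (v a) 1.
  exists (sigma \o tau (- a)), (tau (- - a) \o sigma); split.
    by apply: misom_comp misom_sigma (misom_tau _); rewrite uabsN.
  by rewrite /= subrr eqxx.
(* Translation by [- a] is no isometry here; inverting first brings the point into the unit disc. *)
have a0 : a != 0 by rewrite -uabs_gt0 (lt_trans ltr01).
exists (sigma \o (tau (- a^-1) \o sigma)), ((sigma \o tau (- - a^-1)) \o sigma); split.
  apply: misom_comp misom_sigma (misom_comp (misom_tau _) misom_sigma).
  by rewrite uabsN uabsV invf_le1 ?(ltW h) // (lt_trans ltr01).
by rewrite /= (negPf a0) /= subrr eqxx.
Qed.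

Lemma misom_to_0 y : exists M N, misom M N /\ M y = Some 0.
Proof.
have [M [N [h hM]]] := misom_to_inf y.
exists (sigma \o M), (N \o sigma); split; first exact: misom_comp misom_sigma h.
by rewrite /= hM.
Qed.

End Isometries.

(** * Rational maps on discs *)

Section Balls.
Variables (R : realType) (K : cpField R).
Local Notation v := (@uabs R K).
Local Notation dist := (@cdist R K).
Implicit Types (x y z w : option K) (g : option K -> option K).

Lemma chordal_generic y (c : K) (s : seq (option K)) : c != 0 -> v c < 1 ->
  exists2 z, dist z y = v c & forall b, b \in s -> dist z b = Num.max (v c) (dist y b).
Proof.
move=> c0 c1; have [M [N [[[MN NM dM] _] My]]] := misom_to_0 y.
have [z hz hs] := @generic_point R K 0 c (pmap M s) c0.
rewrite subr0 in hz.
have dz b : dist (N (Some z)) b = dist (Some z) (M b) by rewrite -dM NM.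
have dy b : dist y b = dist (Some 0) (M b) by rewrite -dM My.
have z1 : v z <= 1 by rewrite hz ltW.
exists (N (Some z)).
  by rewrite dz My chordal_some_le1 ?subr0 ?uabs0.
move=> b bs; rewrite dz dy; case e : (M b) => [t|]; last first.
  by rewrite !chordal_inf uabs0 !max_r ?(ltW c1) ?invr1 // ltW.
have ht : v (z - t) = Num.max (v c) (v t).
  rewrite hs ?sub0r ?uabsN // mem_pmap -e; exact: map_f.
have [t1|t1] := leP (v t) 1.
  by rewrite !chordal_some_le1 ?uabs0 // ht sub0r uabsN.
rewrite !chordal_some ht sub0r uabsN uabs0 (max_r z1) (max_r ler01) !mul1r.
rewrite (max_l (ltW t1)) (max_r (le_trans (ltW c1) (ltW t1))).
by rewrite divff ?max_r ?(ltW c1) // gt_eqF // (lt_trans ltr01).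
Qed.

Lemma ratlmap_cross n g (u w : option K) : (0 < n)%N -> ratlmap n g ->
  exists la lb : seq (option K), exists2 C : R, 0 < C &
   [/\ size la = n, size lb = n, (forall a, a \in la -> g a = u),
       (forall b, b \in lb -> g b = w) &
       forall x, dist (g x) u * \prod_(b <- lb) dist x b =
                 C * (dist (g x) w * \prod_(a <- la) dist x a)].
Proof.
move=> n0 hg; have [N [A [B [B0 hN hf]]]] := ratlmap_factor n0 hg.
have [la sa [Ca Ca0 [ha hla]]] := hf u; have [lb sb [Cb Cb0 [hb hlb]]] := hf w.
exists la, lb, (Ca / Cb); first exact: divr_gt0.
split=> // x; have N0 : N x != 0 by case/andP: (hN x) => /(lt_le_trans B0)/lt0r_neq0.
have Cb1 : Cb != 0 by rewrite gt_eqF.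
have e1 : dist (g x) u = Ca * \prod_(a <- la) dist x a / N x by rewrite -hla mulfK.
have e2 : dist (g x) w = Cb * \prod_(a <- lb) dist x a / N x by rewrite -hlb mulfK.
by rewrite e1 e2; field; rewrite N0.
Qed.

Lemma chordal_ball_const x z b (r : R) : dist z x < r -> r <= dist x b -> dist z b = dist x b.
Proof. by move=> h1 h2; apply: chordal_eq; exact: lt_le_trans h2. Qed.

(** A disc that misses a fibre is at one constant distance from each point of that fibre, so both
    products in the cross relation are constant on it. *)
Lemma ball_ratio_const n g x (r : R) (w w' : option K) : (0 < n)%N -> ratlmap n g ->
  (forall z, dist z x < r -> g z != w) -> (forall z, dist z x < r -> g z != w') ->
  forall z, dist z x < r -> dist (g z) w' * dist (g x) w = dist (g x) w' * dist (g z) w.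
Proof.
move=> n0 hg hw hw' z hz; have r0 : 0 < r by apply: le_lt_trans hz; exact: chordal_ge0.
have [la [lb [C C0 [_ _ ha hb hc]]]] := ratlmap_cross w' w n0 hg.
have out (l : seq (option K)) u : (forall a, a \in l -> g a = u) ->
    (forall z, dist z x < r -> g z != u) ->
    \prod_(a <- l) dist z a = \prod_(a <- l) dist x a /\ 0 < \prod_(a <- l) dist x a.
  move=> hl hu.
  have hr a : a \in l -> r <= dist x a.
    move=> al; rewrite leNgt chordalC; apply/negP => /hu.
    by rewrite hl // eqxx.
  split; first by apply: eq_big_seq => a al; apply: (chordal_ball_const hz); exact: hr.
  by rewrite big_seq; apply: prodr_gt0 => a al; exact: lt_le_trans r0 (hr _ al).
have [ea _] := out la w' ha hw'; have [eb pb] := out lb w hb hw.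
have h1 := hc z; have h2 := hc x; rewrite ea eb in h1.
apply: (mulIf (lt0r_neq0 pb)).
rewrite mulrAC h1 [RHS]mulrAC h2; ring.
Qed.

(** If [t] were omitted too, the ratio of the distances to [t] and to [w] would be constant on the
    disc. Comparing [z] with [x] contradicts that [t] is closer to [g x] than both [w] and [g z]
    are. *)
Lemma ball_image n g x (r : R) (w t z : option K) : (0 < n)%N -> ratlmap n g ->
  (forall z, dist z x < r -> g z != w) -> dist z x < r ->
  dist t (g x) < dist (g x) w -> dist t (g x) < dist (g z) (g x) ->
  exists2 y, dist y x < r & g y = t.
Proof.
move=> n0 hg hw hz h1 h2; apply: contrapT => hno.
have ht z' : dist z' x < r -> g z' != t.
  by move=> hz'; apply/eqP => e; apply: hno; exists z'.
have := ball_ratio_const n0 hg hw ht hz.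
have -> : dist (g z) t = dist (g z) (g x).
  by rewrite [LHS]chordalC [RHS]chordalC; apply: chordal_eq; rewrite [ltRHS]chordalC.
set a := dist (g z) (g x) in h2 *; set b := dist (g x) w in h1 *.
rewrite [dist (g x) t]chordalC; set d := dist t (g x) in h1 h2 * => e.
have d0 : 0 <= d := chordal_ge0 _ _.
have : dist (g z) w <= Num.max a b := chordal_ultra _ _ _.
have a0 := le_lt_trans d0 h2; have b0 := le_lt_trans d0 h1.
rewrite le_max => /orP[h|h].
  have : a * b <= d * a by rewrite e ler_wpM2l.
  by rewrite mulrC ler_pM2r // leNgt h1.
have : a * b <= d * b by rewrite e ler_wpM2l.
by rewrite ler_pM2r // leNgt h2.
Qed.

(** A Schwarz lemma. The fibre of [g z'] contains [z'], and at a generic point [y] at distance [v c]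
    from [z'] the remaining factors are as large as they can be. One [y] serves for all of [ws], so
    the omitted value may be selected after [g y] is known. *)
Lemma ball_schwarz n g x (r : R) (c : K) (ws : seq (option K)) z z' :
  (0 < n)%N -> ratlmap n g -> c != 0 -> v c < r -> r <= 1 ->
  dist z x < r -> dist z' x < r -> dist z z' <= v c ->
  exists2 y, dist y x < r & forall w, w \in ws -> (forall z, dist z x < r -> g z != w) ->
    v c * (dist (g z) (g z') * dist (g y) w) <=
    dist z z' * (dist (g y) (g z') * dist (g z) w).
Proof.
move=> n0 hg c0 cr r1 hz hz' hzz.
have vc : 0 < v c by rewrite uabs_gt0.
have /choice[F hF] : forall w, exists F : seq (option K) * seq (option K),
    exists2 C : R, 0 < C &
   [/\ size F.1 = n, size F.2 = n, (forall a, a \in F.1 -> g a = g z'),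
       (forall b, b \in F.2 -> g b = w) &
       forall x, dist (g x) (g z') * \prod_(b <- F.2) dist x b =
                 C * (dist (g x) w * \prod_(a <- F.1) dist x a)].
  by move=> w; have [la [lb h]] := ratlmap_cross (g z') w n0 hg; exists (la, lb).
have [y hy hgen] := @chordal_generic z' c (flatten [seq (F w).1 | w <- ws]) c0 (lt_le_trans cr r1).
have yx : dist y x < r by apply: (@chordal_lt _ _ z') => //; rewrite hy.
exists y => // w wws hw; have [C C0 [sa sb ha hb hc]] := hF w.
have hr b : b \in (F w).2 -> r <= dist x b.
  move=> bl; rewrite leNgt chordalC; apply/negP => /hw.
  by rewrite hb // eqxx.
have cst t : dist t x < r -> \prod_(b <- (F w).2) dist t b = \prod_(b <- (F w).2) dist x b.
  by move=> ht; apply: eq_big_seq => b bl; apply: (chordal_ball_const ht); exact: hr.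
have r0 := lt_trans vc cr.
have pb : 0 < \prod_(b <- (F w).2) dist x b.
  by rewrite big_seq; apply: prodr_gt0 => b bl; exact: lt_le_trans r0 (hr _ bl).
have z'in : z' \in (F w).1.
  have := hc z'; rewrite chordalxx mul0r => /esym/eqP.
  rewrite mulf_eq0 gt_eqF //= mulf_eq0 chordal_eq0 (negPf (hw _ hz')) /= prodf_seq_eq0.
  by move=> /hasP[a aS /=]; rewrite chordal_eq0 => /eqP ->.
have hprod : v c * \prod_(a <- (F w).1) dist z a <= dist z z' * \prod_(a <- (F w).1) dist y a.
  rewrite !(big_rem z' z'in) /= hy mulrCA; apply: ler_wpM2l; first exact: chordal_ge0.
  apply: ler_wpM2l; first exact: ltW.
  have : {subset rem z' (F w).1 <= (F w).1} by apply: mem_rem.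
  elim: (rem z' (F w).1) => [|a l IH] hl; first by rewrite !big_nil.
  rewrite !big_cons; apply: ler_pM; rewrite ?chordal_ge0 //.
  - by apply: prodr_ge0 => *; exact: chordal_ge0.
  - rewrite hgen.
      by apply: le_trans (chordal_ultra z' _ _) _; rewrite ge_max !le_max hzz lexx orbT.
    by apply/flattenP; exists (F w).1; [exact: map_f|apply: hl; rewrite inE eqxx].
  - by apply: IH => t ht; apply: hl; rewrite inE ht orbT.
have hz1 := hc z; have hy1 := hc y; rewrite !cst // in hz1 hy1.
set P := \prod_(b <- (F w).2) dist x b in pb hz1 hy1.
rewrite -(ler_pM2r pb).
have -> : v c * (dist (g z) (g z') * dist (g y) w) * P =
  v c * dist (g y) w * (dist (g z) (g z') * P) by ring.
have -> : dist z z' * (dist (g y) (g z') * dist (g z) w) * P =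
  dist z z' * dist (g z) w * (dist (g y) (g z') * P) by ring.
rewrite hz1 hy1.
set A := \prod_(a <- _) dist z a in hprod *; set A' := \prod_(a <- _) dist y a in hprod *.
have -> : v c * dist (g y) w * (C * (dist (g z) w * A)) =
   (C * dist (g y) w * dist (g z) w) * (v c * A) by ring.
have -> : dist z z' * dist (g z) w * (C * (dist (g y) w * A')) =
   (C * dist (g y) w * dist (g z) w) * (dist z z' * A') by ring.
apply: ler_wpM2l => //; apply: mulr_ge0; last exact: chordal_ge0.
by apply: mulr_ge0; [exact: ltW|exact: chordal_ge0].
Qed.

(** The constant depends neither on [g] nor on its degree: wherever [g y] lies, one of the two
    omitted values is at distance at least [c0] from it. *)
Lemma ball_equicont n g x (r c0 : R) (c : K) (w1 w2 : option K) z z' :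
  (0 < n)%N -> ratlmap n g -> c != 0 -> v c < r -> r <= 1 ->
  (forall z, dist z x < r -> g z != w1) -> (forall z, dist z x < r -> g z != w2) ->
  c0 <= dist w1 w2 -> 0 <= c0 ->
  dist z x < r -> dist z' x < r -> dist z z' <= v c ->
  v c * c0 * dist (g z) (g z') <= dist z z'.
Proof.
move=> n0 hg cn0 cr r1 h1 h2 hw c00 hz hz' hzz.
have [y yx hy] := ball_schwarz [:: w1; w2] n0 hg cn0 cr r1 hz hz' hzz.
have [w [wl hwo hc]] : exists w, [/\ w \in [:: w1; w2], (forall z, dist z x < r -> g z != w) &
    c0 <= dist (g y) w].
  have [h|h] := @chordal_ge _ _ (g y) w1 w2.
    by exists w1; rewrite inE eqxx; split => //; rewrite chordalC (le_trans hw).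
  by exists w2; rewrite !inE eqxx orbT; split => //; rewrite (le_trans hw).
have := hy w wl hwo => h.
apply: le_trans (_ : v c * (dist (g z) (g z') * dist (g y) w) <= _).
  rewrite -mulrA ler_wpM2l ?uabs_ge0 // mulrC ler_wpM2l ?chordal_ge0 //.
apply: le_trans h _; rewrite ler_piMr ?chordal_ge0 //.
by rewrite mulr_ile1 ?chordal_ge0 ?chordal_le1.
Qed.

(** The sharp constant [S / r]: the omitted value is farther than [S] away, so its distance to all
    points of the image is the same and cancels, and the radius [v c] can be taken arbitrarily close
    to [r]. *)
Lemma ball_schwarz_lip n g x (r S : R) w z z' :
  (0 < n)%N -> ratlmap n g -> r <= 1 -> 0 <= S ->
  (forall z, dist z x < r -> g z != w) ->
  (forall z, dist z x < r -> dist (g z) (g x) <= S) -> S < dist (g x) w ->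
  dist z x < r -> dist z' x < r -> r * dist (g z) (g z') <= S * dist z z'.
Proof.
move=> n0 hg r1 S0 hw hS Sw hz hz'.
have [->|zz'] := eqVneq z z'; first by rewrite !chordalxx !mulr0.
have d0 : 0 < dist z z' by rewrite chordal_gt0.
have dr : dist z z' < r by apply: (@chordal_lt _ _ x) => //; rewrite chordalC.
have r0 := lt_trans d0 dr.
rewrite leNgt; apply/negP => h.
set D := dist (g z) (g z') in h.
have D0 : 0 < D.
  rewrite -(pmulr_rgt0 _ r0); apply: le_lt_trans h; rewrite mulr_ge0 //; exact: ltW.
have [||c c0 /andP[h1 h2]] := @radius_exists R K (Num.max (dist z z') (S * dist z z' / D)) r.
- by rewrite lt_max d0.
- by rewrite gt_max dr /= ltr_pdivrMr.
move: h1; rewrite gt_max => /andP[h1 h3].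
have [y yx hy] := ball_schwarz [:: w] n0 hg c0 h2 r1 hz hz' (ltW h1).
have := hy w; rewrite inE eqxx => /(_ isT hw).
have dw t : dist t x < r -> dist (g t) w = dist (g x) w.
  by move=> ht; apply: chordal_eq; apply: le_lt_trans Sw; exact: hS.
have w0 := le_lt_trans S0 Sw.
rewrite (dw y) // (dw z) // !mulrA (ler_pM2r w0) -/D => h4.
have h5 : dist (g y) (g z') <= S.
  by apply: (@chordal_le _ _ (g x)); [exact: hS|rewrite chordalC; exact: hS].
have : v c * D <= S * dist z z'.
  by apply: le_trans h4 _; rewrite mulrC ler_wpM2r ?chordal_ge0.
by rewrite leNgt -ltr_pdivrMr // h3.
Qed.

Lemma poly_all_roots (p : {poly K}) : (forall z : K, p.[z] = 0) -> p = 0.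
Proof.
move=> h; apply/eqP; apply: contraT => p0.
have [sp|sp] := leqP (size p) 1.
  have := h 0; rewrite (size1_polyC sp) hornerC => e.
  by move: p0; rewrite (size1_polyC sp) e polyC0 eqxx.
have [|x] := @cp_root R K (p + 1).
  by rewrite size_polyDl // size_poly1.
by rewrite rootE hornerD h hornerC add0r oner_eq0.
Qed.

(** Over a totally ramified value the form [det2 (P, Q) w] is a multiple of the n-th power of a
    linear form, so three such values give a linear relation between three n-th powers. On a
    suitable line its derivative at 0 is a nonzero multiple of n. *)
Lemma no_three_ramified n g (w1 w2 w3 a1 a2 a3 : option K) : (1 < n)%N -> ratlmap n g ->
  w1 != w2 -> w2 != w3 -> w1 != w3 ->
  (forall x, g x = w1 -> x = a1) -> (forall x, g x = w2 -> x = a2) ->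
  (forall x, g x = w3 -> x = a3) -> False.
Proof.
move=> n1 hg w12 w23 w13 h1 h2 h3; have n0 := ltnW n1.
have [P [Q [A [B [[hP hQ PQ gE] [_ _ nz]]]]]] := ratlmap_norm n0 hg.
have det0 x y : (det2 (hcoord x) (hcoord y) == 0) = (x == y).
  rewrite -(@chordal_eq0 _ K) chordalE mulf_eq0 invr_eq0.
  by rewrite (gt_eqF (mulr_gt0 (nrm_hcoord_gt0 _) (nrm_hcoord_gt0 _))) orbF uabs_eq0.
have key w a : (forall x, g x = w -> x = a) -> g a = w /\
    exists2 c : K, c != 0 & forall u, det2 (P u, Q u) (hcoord w) = c * det2 u (hcoord a) ^+ n.
  move=> hw.
  have hF : isform n (fun p => det2 (P p, Q p) (hcoord w)).
    apply: isform_ext (isform_lin (hcoord w).2 (- (hcoord w).1) hP hQ) => p.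
    by rewrite /det2 /=; ring.
  have [hz|[s ss [c c0 hs]]] := isform_factor hF.
    have [|p hp] := nz (hcoord w).2 (- (hcoord w).1).
      by case: (w) => [z|]; rewrite xpair_eqE /= ?oppr_eq0 oner_eq0 ?andbF.
    by case/eqP: hp; have := hz p; rewrite /det2 /= => <-; ring.
  have hgs b : b \in s -> g b = w.
    move=> bs; apply/eqP; rewrite -(@chordal_eq0 _ K) gE -(hcoordK w).
    rewrite (chordal_hproj (PQ _ (hcoord_neq0 b)) (hcoord_neq0 w)) hs (big_rem b) //=.
    have -> : det2 (hcoord b) (hcoord b) = 0 by rewrite /det2; ring.
    by rewrite mul0r mulr0 uabs0 mul0r.
  split.
    case: s ss hs hgs => [|b s] ss _ hgs; first by rewrite -ss in n0.
    by have hb := hgs b (mem_head _ _); rewrite -(hw _ hb).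
  exists c => // u; rewrite hs; congr (_ * _); rewrite -ss.
  rewrite (eq_big_seq (fun=> det2 u (hcoord a))); last by move=> b /hgs /hw ->.
  by rewrite big_const_seq count_predT iter_mulr_1.
have [g1 [c1 c10 e1]] := key _ _ h1; have [g2 [c2 c20 e2]] := key _ _ h2.
have [g3 [c3 c30 e3]] := key _ _ h3.
(* The coefficients come from the linear relation between the vectors of [w1], [w2] and [w3]. *)
pose A1 := det2 (hcoord w2) (hcoord w3) * c1.
pose A2 := det2 (hcoord w3) (hcoord w1) * c2.
pose A3 := det2 (hcoord w1) (hcoord w2) * c3.
have rel u : A1 * det2 u (hcoord a1) ^+ n + A2 * det2 u (hcoord a2) ^+ n +
   A3 * det2 u (hcoord a3) ^+ n = 0.
  rewrite -!mulrA -e1 -e2 -e3 /det2 /=; ring.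
have a12 : a1 != a2 by apply: contraNneq w12 => e; rewrite -g1 -g2 e.
have a23 : a2 != a3 by apply: contraNneq w23 => e; rewrite -g2 -g3 e.
have a13 : a1 != a3 by apply: contraNneq w13 => e; rewrite -g1 -g3 e.
pose D := det2 (hcoord a1) (hcoord a2).
pose E := det2 (hcoord a2) (hcoord a3).
pose F := det2 (hcoord a1) (hcoord a3).
have E0 : E != 0 by rewrite det0.
have F0 : F != 0 by rewrite det0.
(* On this line the form of [a1] vanishes at 0 and that of [a2] is constant; only the power
   belonging to [a3] contributes to the derivative at 0. *)
pose U (x : K) := (x * (hcoord a2).1 + (hcoord a1).1, x * (hcoord a2).2 + (hcoord a1).2).
have U1 (x : K) : det2 (U x) (hcoord a1) = - D * x by rewrite /D /det2 /=; ring.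
have U2 (x : K) : det2 (U x) (hcoord a2) = D by rewrite /D /det2 /=; ring.
have U3 (x : K) : det2 (U x) (hcoord a3) = E * x + F by rewrite /E /F /det2 /=; ring.
have D0 : D != 0 by rewrite det0.
clearbody D E F.
pose p : {poly K} := (A1 * (- D) ^+ n) *: 'X^n + (A2 * D ^+ n)%:P + A3 *: (E *: 'X + F%:P) ^+ n.
have p0 : p = 0.
  apply: poly_all_roots => x; rewrite /p !hornerE /=.
  by have := rel (U x); rewrite U1 U2 U3 exprMn mulrA.
have n10 : (n.-1 != 0)%N by rewrite -lt0n -ltnS prednK.
have := congr1 (fun q : {poly K} => q^`().[0]) p0.
rewrite /p !derivD !derivZ derivXn derivC deriv_exp derivD derivZ derivX derivC deriv0.
rewrite !(hornerD, hornerZ, hornerMn, hornerM, hornerXn, horner_exp, hornerC, hornerX).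
rewrite !expr0n (negPf n10) /= !mulr0 ?mul0rn ?mulr0 ?add0r.
have hn : n%:R != 0 :> K by rewrite -(prednK n0) cp_char0.
have hA : A3 != 0 by rewrite mulf_neq0 // det0.
rewrite mulr1 addr0 -mulr_natr => /eqP; apply/negP.
apply: mulf_neq0 => //; apply: mulf_neq0 => //.
by apply: mulf_neq0 => //; exact: expf_neq0.
Qed.

End Balls.

(** * Affinoids *)

Section Vitali.
Variables (R : realType) (K : cpField R).
Local Notation v := (@uabs R K).
Local Notation dist := (@cdist R K).
Implicit Types (x y z w : option K) (g : option K -> option K) (X : set (option K)).

(* Polynomials with zeros in the discs l, normalized by their value near xi,
   can be made small on all these discs; the discs closest to xi get the
   highest multiplicities. *)
Lemma small_on_discs (xi : K) (l : seq (K * R)) (gam : R) : 0 < gam ->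
  (forall p, p \in l -> 0 < p.2 < v (p.1 - xi)) ->
  exists ms : seq K, forall p, p \in l ->
    \prod_(y <- ms) Num.max p.2 (v (p.1 - y)) <= gam * v (p.1 - xi) ^+ size ms.
Proof.
move=> gam0; pose le (p q : K * R) := v (p.1 - xi) <= v (q.1 - xi).
wlog : l / sorted le l.
  move=> hw hl; have [||ms hms] := hw (sort le l).
  - by apply: sort_sorted => p q; exact: le_total.
  - by move=> p; rewrite mem_sort; exact: hl.
  - by exists ms => p pl; apply: hms; rewrite mem_sort.
elim: l => [|[c0 s0] l IH] hs hl; first by exists [::].
have tr : transitive le by move=> p q t; exact: le_trans.
have /allP hmin := order_path_min tr hs.
have [||ms hms] := IH; first exact: path_sorted hs.
  by move=> p pl; apply: hl; rewrite inE pl orbT.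
have /andP[/= s00 s0e] := hl (c0, s0) (mem_head _ _).
set e0 := v (c0 - xi) in s0e hmin.
have e00 := lt_trans s00 s0e.
pose A := \prod_(y <- ms) Num.max s0 (v (c0 - y)) / e0 ^+ size ms.
have A0 : 0 <= A.
  rewrite /A divr_ge0 ?exprn_ge0 ?(ltW e00) //; apply: prodr_ge0 => y _.
  by rewrite le_max (ltW s00).
have eA : \prod_(y <- ms) Num.max s0 (v (c0 - y)) = A * e0 ^+ size ms.
  by rewrite /A divfK // expf_neq0 // gt_eqF.
clearbody A.
(* The multiplicity of the new zero [c0] must outweigh the factor [A] which the earlier zeros
   produce on its disc. *)
have [||m hm] := @exprn_small R (s0 / e0) (gam / (A + 1)).
- by rewrite divr_ge0 ?(ltW s00) ?(ltW e00) //= ltr_pdivrMr // mul1r.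
- by rewrite divr_gt0 // ltr_wpDl.
exists (nseq m c0 ++ ms) => p.
rewrite big_cat /= size_cat size_nseq exprD big_nseq iter_mulr_1.
rewrite inE => /predU1P[->|pl] /=.
  rewrite subrr uabs0 (max_l (ltW s00)) -/e0.
  rewrite eA !mulrA ler_wpM2r ?exprn_ge0 ?(ltW e00) //.
  have -> : s0 ^+ m = (s0 / e0) ^+ m * e0 ^+ m.
    by rewrite expr_div_n divfK // expf_neq0 // gt_eqF.
  rewrite [_ * e0 ^+ m * A]mulrAC; apply: ler_wpM2r; first by rewrite exprn_ge0 ?(ltW e00).
  apply: le_trans (_ : gam / (A + 1) * A <= _); first by apply: ler_wpM2r => //; exact: ltW.
  rewrite mulrAC ler_pdivrMr ?ltr_wpDl // ler_wpM2l ?(ltW gam0) // lerDl.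
  exact: ler01.
have /andP[p0 pe] : 0 < p.2 < v (p.1 - xi) by apply: hl; rewrite inE pl orbT.
have ep0 := lt_trans p0 pe.
(* The other discs are at least as far from [xi] as [c0] is, so each added factor is at most
   [v (p.1 - xi)] and the earlier estimates survive. *)
rewrite mulrCA; apply: ler_pM; rewrite ?hms //.
- by rewrite exprn_ge0 // le_max (ltW p0).
- by apply: prodr_ge0 => y _; rewrite le_max (ltW p0).
rewrite lerXn2r ?nnegrE ?(ltW ep0) // ?le_max ?(ltW p0) // ge_max (ltW pe) /=.
apply: (@uabs_dist_le _ _ xi) => //.
by rewrite uabs_distC; exact: (hmin _ pl).
Qed.

Lemma misom_none (M N : option K -> option K) a z :
  misom M N -> M a = None -> z != a -> exists t, M z = Some t.
Proof.
move=> [[MN NM _] _] Ma za; case e : (M z) => [t|]; first by exists t.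
by move: za; rewrite -(MN z) e -Ma MN eqxx.
Qed.

(** Both fibres have n points, so the chordal denominators in [t] cancel; evaluating at [a], which
    is sent to infinity, eliminates the constant of the cross relation. *)
Lemma ratlmap_cross_inf n g (u w a : option K) (M N : option K -> option K) :
  (0 < n)%N -> ratlmap n g -> misom M N -> M a = None -> g a != u -> g a != w ->
  exists la lb : seq K,
   [/\ size la = n, size lb = n, (forall t, t \in la -> g (N (Some t)) = u),
       (forall t, t \in lb -> g (N (Some t)) = w) &
       forall t, dist (g (N (Some t))) u * \prod_(b <- lb) v (t - b) * dist (g a) w =
                 dist (g (N (Some t))) w * \prod_(b <- la) v (t - b) * dist (g a) u].
Proof.
move=> n0 hg hM Ma gau gaw; have [[MN NM dM] _] := hM.
have [la [lb [C C0 [sa sb ha hb hc]]]] := ratlmap_cross u w n0 hg.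
have sep (l : seq (option K)) q : (forall b, b \in l -> g b = q) -> g a != q ->
    exists l' : seq K, map M l = map Some l'.
  elim: l => [|b l IH] hl ga; first by exists [::].
  have [|l' hl'] := IH _ ga; first by move=> c cl; apply: hl; rewrite inE cl orbT.
  have ba : b != a by apply: contraNneq ga => <-; rewrite hl ?mem_head.
  have [t ht] := misom_none hM Ma ba.
  by exists (t :: l'); rewrite /= ht hl'.
have [la' ea] := sep _ _ ha gau; have [lb' eb] := sep _ _ hb gaw.
have mem l l' t : map M l = map Some l' -> t \in l' -> N (Some t) \in l.
  move=> e tl; have : Some t \in map M l by rewrite e map_f.
  by move=> /mapP[b bl ->]; rewrite MN.
exists la', lb'; split.
- by rewrite -sa -(size_map M) ea size_map.
- by rewrite -sb -(size_map M) eb size_map.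
- by move=> t tl; apply: ha; exact: mem ea tl.
- by move=> t tl; apply: hb; exact: mem eb tl.
pose m (t : K) := Num.max (v t) 1; have m0 t : 0 < m t by rewrite lt_max ltr01 orbT.
have pr (l : seq (option K)) l' : map M l = map Some l' ->
   (forall t, \prod_(b <- l) dist (N (Some t)) b =
     (\prod_(b <- l') v (t - b)) * (m t ^+ size l)^-1 * \prod_(b <- l') (m b)^-1) /\
   \prod_(b <- l) dist a b = \prod_(b <- l') (m b)^-1.
  elim: l l' => [|b l IH] [|b' l'] //=.
    by split=> [t|]; rewrite !big_nil ?expr0 ?invr1 ?mulr1.
  move=> [e /IH[h1 h2]]; split => [t|].
    rewrite !big_cons h1 -dM NM e chordal_some -/(m t) -/(m b') exprS.
    by field; rewrite ?expf_neq0 ?lt0r_neq0.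
  by rewrite !big_cons h2 -dM Ma e chordalC chordal_inf.
have [pa1 pa2] := pr _ _ ea; have [pb1 pb2] := pr _ _ eb.
move=> t; have := hc (N (Some t)); have := hc a.
rewrite pa1 pb1 pa2 pb2 sa sb.
have mt : m t ^+ n != 0 by rewrite expf_neq0 // lt0r_neq0.
have : \prod_(b <- lb') (m b)^-1 != 0.
  by rewrite prodf_seq_neq0; apply/allP => b _ /=; rewrite invr_eq0 lt0r_neq0.
set kb := \prod_(b <- lb') (m b)^-1; set ka := \prod_(b <- la') (m b)^-1.
set pa := \prod_(b <- la') _; set pb := \prod_(b <- lb') _.
move: (dist (g a) u) (dist (g a) w) (dist (g (N (Some t))) u) (dist (g (N (Some t))) w).
clearbody ka kb pa pb; move=> au aw tu tw kb0 e1 e2.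
apply: (mulIf kb0); apply: (mulIf (_ : (m t ^+ n)^-1 != 0)); first by rewrite invr_eq0.
transitivity (tu * (pb * (m t ^+ n)^-1 * kb) * aw); first by ring.
rewrite e2.
transitivity (tw * pa * (m t ^+ n)^-1 * (C * (aw * ka))); first by ring.
by rewrite -e1; ring.
Qed.

(* The complement of an affinoid, seen from one of its points sent to infinity,
   is a finite union of closed discs. *)
Lemma affinoid_holes X a (M N : option K -> option K) :
  open_affinoid v X -> X a -> misom M N -> M a = None ->
  exists k (c d : 'I_k -> K), (forall i, d i != 0) /\
    forall t, X (N (Some t)) <-> forall i, v (d i) < v (t - c i).
Proof.
move=> [_ [k [B [hB XE]]]] Xa [[MN NM _] [_ _ _ hN]] Ma.
have Na : N None = a by rewrite -Ma MN.
have h i : exists cd : K * K, cd.2 != 0 /\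
    forall t, B i (N (Some t)) <-> v cd.2 < v (t - cd.1).
  have Bia : B i a by move: Xa; rewrite XE; apply.
  have [c [r [[d d0 hr] [e|e]]]] := hN _ (hB i).
    have : (N @^-1` B i) None by rewrite /= Na.
    by rewrite e oballE.
  exists (c, d); split => // t.
  have -> : B i (N (Some t)) = (N @^-1` B i) (Some t) by [].
  by rewrite e cballE /= hr ltNge; split => [/negP|] // /negP.
have [cd hcd] := choice h.
exists k.+1, (fun i => (cd i).1), (fun i => (cd i).2); split => [i|t].
  by case: (hcd i).
rewrite XE; split => [h' i|h' i _]; first by apply/(hcd i).2; exact: h'.
by apply/(hcd i).2.
Qed.

(** A small image of one disc forces small variation up to any point of the affinoid, uniformly in
    the degree. Otherwise, with [a] at infinity, multiply the ratio of the fibre products of [g x]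
    and [w] by the polynomial of [small_on_discs] divided by a power of [t - xi]. Zeros and poles
    are equally many and the poles lie in the holes or at [xi], so on one of these discs the result
    is at least 1. In a hole the auxiliary factor is too small for this, near [xi] the image is. *)
Lemma vitali X x a (r eta : R) : open_affinoid v X -> X a ->
  0 < r -> (forall z, dist z x < r -> X z) -> 0 < eta ->
  exists m : nat, forall ws : seq (option K), uniq ws -> size ws = m ->
  exists2 eps : R, 0 < eps &
    forall n g, (0 < n)%N -> ratlmap n g ->
      (forall z w, X z -> w \in ws -> g z != w) ->
      (forall z, dist z x < r -> dist (g z) (g x) < eps) ->
      dist (g x) (g a) < eta.
Proof.
move=> hX Xa r0 hr eta0.
have [->|xa] := eqVneq x a.
  by exists 0%N => ws _ _; exists 1 => // n g _ _ _ _; rewrite chordalxx.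
have [M [N [hM Ma]]] := misom_to_inf a.
have [[MN NM dM] _] := hM.
have [xi hxi] := misom_none hM Ma xa.
have [k [c [d [d0 hXE]]]] := affinoid_holes hX Xa hM Ma.
have Nxi : N (Some xi) = x by rewrite -hxi MN.
have Xx : X x by apply: hr; rewrite chordalxx.
have hxc i : v (d i) < v (xi - c i) by move: Xx; rewrite -Nxi => /hXE.
have e0 i : 0 < v (xi - c i) by apply: le_lt_trans (hxc i); exact: uabs_ge0.
have vd i : 0 < v (d i) by rewrite uabs_gt0.
have h i : exists s : K, s != 0 /\ v (d i) < v s < v (c i - xi).
  by have [s s0 hs] := @radius_exists R K _ _ (vd i) (hxc i); exists s; rewrite uabs_distC.
have [s hs] := choice h.
have [sx sx0 /andP[_ hsx]] : exists2 sx : K, sx != 0 & r / 2 < v sx < r.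
  apply: radius_exists; first by rewrite divr_gt0.
  by rewrite ltr_pdivrMr // mulr_natr mulr2n ltrDl.
pose ctr (j : option 'I_k) := if j is Some i then c i else xi.
pose rad (j : option 'I_k) := if j is Some i then s i else sx.
have rad0 j : rad j != 0 by case: j => [i|] //=; case: (hs i).
(* There is one omitted value more than there are test points, one point for each hole and one near
   [xi]. As the omitted values are [del] apart, a test value is within [del] of at most one of
   them. *)
exists (#|{: option 'I_k}|.+1) => ws uws sws.
have [del del0 hdel] : exists2 del, 0 < del &
    forall p, p \in [seq p <- [seq (w, w') | w <- ws, w' <- ws] | p.1 != p.2] ->
      del <= dist p.1 p.2.
  apply: seq_pos_lb => p; rewrite mem_filter => /andP[hp _].
  by rewrite chordal_gt0.
pose gam := del * eta / 2.
have de0 : 0 < del * eta by rewrite mulr_gt0.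
have gam0 : 0 < gam by rewrite divr_gt0.
have [|ms hms] := @small_on_discs xi [seq (c i, v (s i)) | i <- enum 'I_k] gam gam0.
  move=> p /mapP[i _ ->] /=; have [s0 /andP[_ h2]] := hs i.
  by rewrite uabs_gt0 s0 h2.
pose Lam := \prod_(y <- ms) Num.max (v sx) (v (xi - y)).
have Lam0 : 0 < Lam.
  by apply: prodr_gt0 => y _; rewrite lt_max uabs_gt0 sx0.
have vsx : 0 < v sx by rewrite uabs_gt0.
(* This is the lower bound that the estimate will give for the distance from [g x] to the value at
   the test point near [xi]. *)
exists (del * eta * v sx ^+ size ms / Lam).
  by rewrite !mulr_gt0 ?invr_gt0 // exprn_gt0.
move=> n g n0 hg hgw hgB.
have gaw w : w \in ws -> g a != w by exact: hgw.
rewrite ltNge; apply/negP => hge.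
have gau : g a != g x.
  by apply/eqP => e; move: hge; rewrite e chordalxx leNgt eta0.
have h2 w : exists F : seq K * seq K, w \in ws ->
   [/\ size F.1 = n, size F.2 = n, (forall t, t \in F.2 -> g (N (Some t)) = w) &
       forall t, dist (g (N (Some t))) (g x) * \prod_(b <- F.2) v (t - b) * dist (g a) w =
                 dist (g (N (Some t))) w * \prod_(b <- F.1) v (t - b) * dist (g a) (g x)].
  have [/gaw hw|hw] := boolP (w \in ws); last by exists ([::], [::]).
  have [la [lb [h1 h2 _ h4 h5]]] := ratlmap_cross_inf n0 hg hM Ma gau hw.
  by exists (la, lb).
have [F hF] := choice h2.
(* The test points are made generic for the fibres belonging to all of [ws], because [w] is selected
   only after the values at the test points are known. *)
pose big := xi :: ms ++ flatten [seq (F w).1 ++ (F w).2 | w <- ws].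
have h3 j : exists z : K, forall b, b \in big -> v (z - b) = Num.max (v (rad j)) (v (ctr j - b)).
  by have [z _ hz] := generic_point (ctr j) big (rad0 j); exists z.
have [zt hzt] := choice h3.
have [w wws hw] : exists2 w, w \in ws & forall j, del <= dist (g (N (Some (zt j)))) w.
  apply: contrapT => hno.
  have h4 j : exists w0, forall w, w \in ws -> dist (g (N (Some (zt j)))) w < del -> w = w0.
    have [[w0 w0s hw0]|hn] := pselect (exists2 w0, w0 \in ws & dist (g (N (Some (zt j)))) w0 < del).
      exists w0 => w ww hw; apply/eqP; apply: contraT => ne.
      have : del <= dist w w0.
        by apply: (hdel (w, w0)); rewrite mem_filter ne; apply/allpairsP; exists (w, w0).
      by rewrite leNgt (@chordal_lt _ _ (g (N (Some (zt j))))) // chordalC.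
    by exists None => w ww hw; case: hn; exists w.
  have [bad hbad] := choice h4.
  have : (size ws <= size [seq bad j | j <- enum {: option 'I_k}])%N.
    apply: uniq_leq_size => // w ww; apply: contrapT => hnot; apply: hno; exists w => // j.
    rewrite leNgt; apply/negP => hj; apply: hnot.
    by rewrite (hbad j w ww hj); apply: map_f; rewrite mem_enum.
  by rewrite sws size_map -cardE ltnn.
have [sa sb hb hcr] := hF w wws.
set la := (F w).1 in sa hcr; set lb := (F w).2 in sb hb hcr.
have big1 b : b \in la -> b \in big.
  move=> bl; rewrite inE mem_cat; apply/orP; right; apply/orP; right.
  by apply/flattenP; exists ((F w).1 ++ (F w).2); [exact: map_f|rewrite mem_cat bl].
have big2 b : b \in lb -> b \in big.
  move=> bl; rewrite inE mem_cat; apply/orP; right; apply/orP; right.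
  by apply/flattenP; exists ((F w).1 ++ (F w).2); [exact: map_f|rewrite mem_cat bl orbT].
have big3 b : b \in ms -> b \in big by move=> bl; rewrite inE mem_cat bl orbT.
have cov b : exists j, b \in lb ++ nseq (size ms) xi -> v (b - ctr j) <= v (rad j).
  have [hbl|hbl] := boolP (b \in lb ++ nseq (size ms) xi); last by exists None.
  move: hbl; rewrite mem_cat => /orP[bl|]; last first.
    by rewrite mem_nseq => /andP[_ /eqP->]; exists None; rewrite /= subrr uabs0 ltW.
  have nX : ~ X (N (Some b)) by move=> /hgw /(_ wws); rewrite hb // eqxx.
  apply: contrapT => hno; apply: nX; apply/hXE => i.
  rewrite ltNge; apply/negP => hle; apply: hno; exists (Some i) => _ /=.
  by apply: le_trans hle _; have [_ /andP[/ltW]] := hs i.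
have [kap hkap] := choice cov.
have [|||b bl hb2] := @max_principle R K (fun b => v (rad (kap b)))
    (la ++ ms) (lb ++ nseq (size ms) xi).
- by rewrite !size_cat size_nseq sa sb.
- by rewrite size_cat sb ltn_addr.
- by move=> b _; rewrite uabs_gt0.
set j := kap b in hb2; have hbj := hkap b bl; rewrite -/j in hbj.
have tr t : t \in big -> Num.max (v (rad j)) (v (b - t)) = v (zt j - t).
  move=> tb; rewrite hzt //; have [h1|h1] := leP (v (ctr j - t)) (v (rad j)).
    by apply/max_idPl; apply: (@uabs_dist_le _ _ (ctr j)).
  have -> : v (b - t) = v (ctr j - t) by apply: uabs_dist_eq; exact: le_lt_trans h1.
  by apply/max_idPr; exact: ltW.
have := hb2 (v (rad j) + \sum_(c <- lb ++ nseq (size ms) xi) v (b - c)).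
rewrite !size_cat size_nseq sa sb subnn expr0 mul1r lerDl sumr_ge0 //; last first.
  by move=> *; exact: uabs_ge0.
have hsum (l : seq K) q : q \in l -> v (b - q) <= v (rad j) + \sum_(c <- l) v (b - c).
  move=> ql; rewrite (big_rem q ql) /= addrCA lerDl addr_ge0 ?uabs_ge0 // sumr_ge0 //.
  by move=> *; exact: uabs_ge0.
move=> /(_ isT (hsum _)).
rewrite !big_cat /= big_nseq iter_mulr_1.
rewrite (eq_big_seq (r := lb) (fun t => v (zt j - t))); last by move=> t /big2 /tr.
rewrite (eq_big_seq (r := la) (fun t => v (zt j - t))); last by move=> t /big1 /tr.
rewrite (eq_big_seq (r := ms) (fun t => v (zt j - t))); last by move=> t /big3 /tr.
rewrite tr ?mem_head //.
have := hcr (zt j).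
set pb := \prod_(t <- lb) _; set pa := \prod_(t <- la) _; set pm := \prod_(t <- ms) _.
have hzr t : t \in big -> 0 < v (zt j - t).
  by move=> tb; rewrite -tr // lt_max uabs_gt0 rad0.
have pb0 : 0 < pb by rewrite /pb big_seq; apply: prodr_gt0 => t /big2; exact: hzr.
have pm0 : 0 < pm by rewrite /pm big_seq; apply: prodr_gt0 => t /big3; exact: hzr.
have pa0 : 0 < pa by rewrite /pa big_seq; apply: prodr_gt0 => t /big1; exact: hzr.
set zj := g (N (Some (zt j))) => e1 e2.
have e3 : pa * (del * eta) <= dist zj (g x) * pb.
  apply: le_trans (_ : dist zj w * pa * dist (g a) (g x) <= _).
    rewrite [pa * _]mulrCA -mulrA; apply: ler_pM.
    - exact: ltW.
    - by apply: mulr_ge0; exact: ltW.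
    - exact: hw.
    - by rewrite ler_wpM2l ?(ltW pa0) // chordalC.
  rewrite -e1; apply: ler_piMr; last exact: chordal_le1.
  by apply: mulr_ge0; [exact: chordal_ge0|exact: ltW].
have e4 : v (zt j - xi) ^+ size ms * (del * eta) <= dist zj (g x) * pm.
  rewrite -(ler_pM2l pb0) mulrA.
  apply: le_trans (_ : pa * pm * (del * eta) <= _); first by rewrite ler_wpM2r // ltW.
  have -> : pa * pm * (del * eta) = pa * (del * eta) * pm by ring.
  have -> : pb * (dist zj (g x) * pm) = dist zj (g x) * pb * pm by ring.
  by apply: ler_wpM2r => //; exact: ltW.
(* In a hole, [small_on_discs] contradicts the estimate because [gam] is half of [del * eta]; near
   [xi], the choice of [eps] does. *)
case ej : j => [i|].
  have := hms (c i, v (s i)).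
  have -> : (c i, v (s i)) \in [seq (c i, v (s i)) | i <- enum 'I_k].
    by apply: map_f; rewrite mem_enum.
  move=> /(_ isT) /=.
  have -> : \prod_(y <- ms) Num.max (v (s i)) (v (c i - y)) = pm.
    by apply: eq_big_seq => y /big3 yb; rewrite hzt // ej.
  have -> : v (c i - xi) = v (zt j - xi).
    rewrite hzt ?mem_head // ej /=; apply/esym/max_idPr.
    by have [_ /andP[_ /ltW]] := hs i.
  move=> e5; have x0 : 0 < v (zt j - xi) ^+ size ms by rewrite exprn_gt0 // hzr // mem_head.
  have : v (zt j - xi) ^+ size ms * (del * eta) <= gam * v (zt j - xi) ^+ size ms.
    apply: le_trans e4 _; apply: le_trans e5; apply: ler_piMl; first exact: ltW.
    exact: chordal_le1.
  rewrite mulrC ler_pM2r // leNgt /gam ltr_pdivrMr // mulr_natr mulr2n ltrDl.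
  by rewrite de0.
have : v (zt j - xi) = v sx.
  by rewrite hzt ?mem_head // ej /= subrr uabs0 max_l // ltW.
have epm : pm = Lam by apply: eq_big_seq => y /big3 yb; rewrite hzt // ej.
move=> e5; move: e4; rewrite e5 epm leNgt => /negP; apply.
rewrite -ltr_pdivlMr // [_ ^+ _ * _]mulrC; apply: hgB.
rewrite -Nxi -dM !NM chordal_some.
have m1 (t : K) : 1 <= Num.max (v t) 1 by rewrite le_max lexx orbT.
apply: le_lt_trans hsx; rewrite e5 ler_pdivrMr; last first.
  by apply: mulr_gt0; apply: lt_le_trans (m1 _); exact: ltr01.
by apply: ler_peMr; [exact: ltW|rewrite -[leLHS]mulr1; apply: ler_pM].
Qed.

End Vitali.

(** * Small affinoids and affinoid neighbourhoods in preimages of discs *)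

Section PullBack.
Variables (R : realType) (K : cpField R).
Local Notation v := (@uabs R K).
Local Notation dist := (@cdist R K).
Implicit Types (x y z w : option K) (g : option K -> option K) (X : set (option K)).

Lemma open_ball_chordal x (c : K) : c != 0 -> v c <= 1 ->
  open_ball v [set y | dist y x < v c].
Proof.
move=> c0 c1; have [M [N [[[MN NM dM] [_ _ hM _]] Mx]]] := misom_to_0 x.
have -> : [set y | dist y x < v c] = M @^-1` (oball v 0 (v c)).
  apply/seteqP; split => y; rewrite oballE /= -dM Mx; case: (M y) => [t|] //.
  - by rewrite chordal_0 // subr0.
  - by rewrite chordalC chordal_inf uabs0 (max_r ler01) invr1 ltNge c1.
  - by rewrite chordal_0 // subr0.
by apply: hM; exists 0, (v c); split; [exists c|left].
Qed.

Lemma affinoid_open_ball (B : set (option K)) x : open_ball v B -> B x -> open_affinoid v B.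
Proof.
move=> hB Bx; split; first by exists x.
exists 0%N, (fun=> B); split => //; apply/seteqP; split => y; first by move=> yB i.
by move=> /(_ ord0); exact.
Qed.

Lemma small_affinoid x (e : R) : 0 < e -> exists2 c : K, c != 0 & v c < e /\
  [/\ open_affinoid v [set y | dist y x < v c] & v c < 1].
Proof.
move=> e0; have m0 : 0 < Num.min e 1 by rewrite lt_min e0 ltr01.
have [||c c0 /andP[_ h]] := @radius_exists R K (Num.min e 1 / 2) (Num.min e 1).
- by rewrite divr_gt0.
- by rewrite ltr_pdivrMr // mulr_natr mulr2n ltrDl.
move: h; rewrite lt_min => /andP[h1 h2]; exists c => //; split => //; split => //.
apply: (@affinoid_open_ball _ x); last by rewrite /= chordalxx uabs_gt0.
by apply: open_ball_chordal => //; exact: ltW.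
Qed.

Lemma exprn_root_gt1 (m : nat) (l : R) : 1 < l -> exists2 k : R, 1 < k & k ^+ m < l.
Proof.
elim: m l => [|m IH] l l1; first by exists 2; rewrite ?expr0 // ltr1n.
have s1 : 1 < Num.sqrt l by rewrite -sqrtr1 ltr_sqrt // (lt_trans ltr01).
have [k k1 hk] := IH _ s1; exists (Num.min k (Num.sqrt l)); first by rewrite lt_min k1.
have l0 := ltW (lt_trans ltr01 l1).
have k0 := lt_trans ltr01 k1; have sl0 := lt_trans ltr01 s1.
rewrite exprSr -[ltRHS](sqr_sqrtr l0) expr2.
apply: le_lt_trans (_ : k ^+ m * Num.sqrt l < _); last by rewrite ltr_pM2r.
apply: ler_pM; rewrite ?exprn_ge0 ?le_min ?(ltW k0) ?(ltW sl0) //.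
  by rewrite lerXn2r // ?nnegrE ?le_min ?(ltW k0) ?(ltW sl0) // ge_min lexx.
by rewrite ge_min lexx orbT.
Qed.

Lemma prod_max_scale (b : K) (l : seq K) (r r' : R) : 0 < r -> r <= r' ->
  \prod_(a <- l) Num.max r (v (b - a)) <= \prod_(a <- l) Num.max r' (v (b - a)) /\
  \prod_(a <- l) Num.max r' (v (b - a)) <= (r' / r) ^+ size l * \prod_(a <- l) Num.max r (v (b - a)).
Proof.
move=> r0 rr'; have r'0 := lt_le_trans r0 rr'.
have h1 a : 0 <= Num.max r (v (b - a)) by rewrite le_max (ltW r0).
have q1 : 1 <= r' / r by rewrite ler_pdivlMr // mul1r.
split.
  elim: l => [|a l IH]; first by rewrite !big_nil.
  rewrite !big_cons ler_pM ?prodr_ge0 //.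
  by rewrite ge_max !le_max rr' lexx orbT.
elim: l => [|a l IH]; first by rewrite !big_nil mul1r.
rewrite !big_cons /= exprS mulrACA ler_pM //.
- by rewrite le_max (ltW r'0).
- by apply: prodr_ge0 => c _; rewrite le_max (ltW r'0).
rewrite ge_max; apply/andP; split.
  rewrite -{1}(divfK (lt0r_neq0 r0) r'); apply: ler_pM; rewrite ?le_max ?lexx ?(ltW r0) //.
  exact: le_trans q1.
apply: le_trans (_ : Num.max r (v (b - a)) <= _); first by rewrite le_max lexx orbT.
by rewrite ler_peMl.
Qed.

(** As the radius grows from 0, the ratio of the two products starts from arbitrarily large values
    and ends at 1. The radius [v c] is taken just above the last one at which the ratio reaches
    [lam], so that at [v c] it still exceeds 1. *)
Lemma level_radius (b : K) (la lb : seq K) (lam : R) : size la = size lb -> b \in lb ->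
  b \notin la -> 1 < lam -> exists2 c : K, c != 0 &
    \prod_(a <- lb) Num.max (v c) (v (b - a)) < \prod_(a <- la) Num.max (v c) (v (b - a)) /\
    forall r, v c < r ->
      \prod_(a <- la) Num.max r (v (b - a)) < lam * \prod_(a <- lb) Num.max r (v (b - a)).
Proof.
move=> sab bl bla l1; have l0 := lt_trans ltr01 l1.
pose f (l : seq K) r := \prod_(a <- l) Num.max r (v (b - a)).
have f0 l r : 0 < r -> 0 < f l r.
  by move=> r0; apply: prodr_gt0 => a _; rewrite lt_max r0.
pose T := [set r : R | 0 < r /\ lam * f lb r <= f la r].
have [r1 [r10 hr1]] : T !=set0.
  pose A := \prod_(a <- la) v (b - a).
  have A0 : 0 < A.
    rewrite /A big_seq; apply: prodr_gt0 => a al; rewrite uabs_gt0 subr_eq0.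
    by apply: contraNneq bla => ->.
  pose B := \prod_(a <- rem b lb) Num.max 1 (v (b - a)).
  have B0 : 0 < B by apply: prodr_gt0 => a _; rewrite lt_max ltr01.
  pose r := Num.min 1 (A / (lam * B)).
  have r0 : 0 < r by rewrite lt_min ltr01 divr_gt0 // mulr_gt0.
  exists r; split => //.
  apply: le_trans (_ : A <= _); last first.
    rewrite /A /f; elim: (la) => [|a l IH]; first by rewrite !big_nil.
    rewrite !big_cons ler_pM ?uabs_ge0 ?prodr_ge0 // => [*|]; first exact: uabs_ge0.
    by rewrite le_max lexx orbT.
  rewrite /f (big_rem b bl) /= subrr uabs0 (max_l (ltW r0)).
  apply: le_trans (_ : lam * (r * B) <= _).
    rewrite ler_wpM2l ?(ltW l0) // ler_wpM2l ?(ltW r0) //.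
    by case: (@prod_max_scale b (rem b lb) r 1 r0) => //; rewrite ge_min lexx.
  by rewrite mulrCA -ler_pdivlMr ?mulr_gt0 // ge_min lexx orbT.
pose U := 1 + \sum_(a <- la ++ lb) v (b - a).
have U0 : 0 < U by rewrite ltr_pwDl // sumr_ge0 // => *; exact: uabs_ge0.
have hU r : T r -> r <= U.
  move=> [r0 hr]; rewrite leNgt; apply/negP => Ur.
  have fr l : {subset l <= la ++ lb} -> f l r = r ^+ size l.
    move=> hl; rewrite /f (eq_big_seq (fun=> r)); last first.
      move=> a /hl al; apply/max_idPl; apply: le_trans (ltW Ur).
      rewrite /U (big_rem a al) /= addrCA lerDl addr_ge0 ?ler01 // sumr_ge0 //.
      by move=> *; exact: uabs_ge0.
    by rewrite big_const_seq count_predT iter_mulr_1.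
  move: hr; rewrite !fr ?sab; last first.
  - by move=> a; rewrite mem_cat => ->; rewrite orbT.
  - by move=> a; rewrite mem_cat => ->.
  by rewrite ger_pMl ?exprn_gt0 // leNgt l1.
have hT : has_sup T by split; [exists r1|exists U].
have hle r : T r -> r <= sup T by apply: ub_le_sup; case: hT.
have s0 : 0 < sup T := lt_le_trans r10 (hle r1 (conj r10 hr1)).
(* From a radius of [T] near the supremum to [v c] the radius grows by at most [k ^+ 2], and a
   product of [size la] factors by at most [k ^+ (2 * size la)]. *)
have [k k1 hk] := exprn_root_gt1 (2 * size la) l1.
have k0 := lt_trans ltr01 k1.
have [r [r0 hr] sr] : exists2 r, T r & sup T / k < r.
  have e0 : 0 < sup T - sup T / k.
    by rewrite subr_gt0 ltr_pdivrMr // ltr_pMr.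
  by have [r Tr hr] := sup_adherent e0 hT; exists r => //; rewrite opprB addrCA subrr addr0 in hr.
have [|c c0 /andP[c1 c2]] := @radius_exists R K (sup T) (sup T * k) s0.
  by rewrite ltr_pMr.
exists c => //; have vc : 0 < v c by rewrite uabs_gt0.
have rc : r <= v c by apply: ltW; apply: le_lt_trans c1; exact: (hle r (conj r0 hr)).
split; last first.
  move=> r' cr'; rewrite ltNge; apply/negP => h.
  have : r' <= sup T by apply: hle; split => //; exact: lt_trans cr'.
  by rewrite leNgt (lt_trans c1).
have [h1 _] := prod_max_scale b la r0 rc; have [_ h2] := prod_max_scale b lb r0 rc.
rewrite -/(f _ _) -/(f _ _) in h1 h2 *.
apply: le_lt_trans h2 _; apply: lt_le_trans h1; apply: lt_le_trans hr.
rewrite ltr_pM2r ?f0 // -sab; apply: le_lt_trans hk; rewrite exprM.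
rewrite lerXn2r ?nnegrE ?exprn_ge0 ?(ltW k0) ?divr_ge0 ?(ltW vc) ?(ltW r0) //.
rewrite ler_pdivrMr //; apply: le_trans (ltW c2) _.
rewrite expr2 -mulrA mulrC ler_wpM2l ?(ltW k0) // mulrC.
by rewrite -ler_pdivrMr // ltW.
Qed.

(* V is the complement of discs around the preimages of a point far from z; if z
   were not attained on V, the maximum principle would contradict the choice of
   the radii of these discs. *)
Lemma pullback_affinoid n g x z (del : R) : (0 < n)%N -> ratlmap n g ->
  dist (g x) z < del -> del <= 1 ->
  exists V, [/\ open_affinoid v V, V x, (forall y, V y -> dist (g y) z < del) &
    exists2 u, V u & g u = z].
Proof.
move=> n0 hg hx d1; have [gxz|gxz] := eqVneq (g x) z.
  have d0 : 0 < del by apply: le_lt_trans hx; exact: chordal_ge0.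
  have [e e0 he] := ratlmap_cont x n0 hg d0.
  have [c c0 [ce [hA _]]] := small_affinoid x e0.
  have xx : dist x x < v c by rewrite chordalxx uabs_gt0.
  exists [set y | dist y x < v c]; split => //; last by exists x.
  by move=> y hy; rewrite -gxz; apply: he; exact: lt_trans ce.
have [w hw] := generic_dist1 [:: z].
have {}hw : dist z (Some w) = 1 by rewrite chordalC hw // mem_head.
have gxw1 : dist (g x) (Some w) = 1.
  by rewrite (@chordal_eq _ _ _ z) // hw (lt_le_trans hx).
have gxw : g x != Some w by rewrite -(@chordal_gt0 _ K) gxw1 ltr01.
have [M [N [hM Mx]]] := misom_to_inf x; have [[MN NM dM] [_ _ hMB _]] := hM.
have [la [lb [sa sb ha hb hc]]] := ratlmap_cross_inf n0 hg hM Mx gxz gxw.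
have q0 : 0 < dist (g x) z by rewrite chordal_gt0.
(* The ratio [del / dist (g x) z] exceeds 1; it is the room by which the distance to [z] may grow on
   [V]. *)
have hl b : exists c : K, b \in lb -> c != 0 /\
    \prod_(a <- lb) Num.max (v c) (v (b - a)) < \prod_(a <- la) Num.max (v c) (v (b - a)) /\
    forall r, v c < r -> \prod_(a <- la) Num.max r (v (b - a)) <
      del / dist (g x) z * \prod_(a <- lb) Num.max r (v (b - a)).
  have [bl|bl] := boolP (b \in lb); last by exists 0.
  have [|||c c0 hc'] := @level_radius b la lb (del / dist (g x) z) _ bl.
  - by rewrite sa sb.
  - apply/negP => /ha e; move: hw; rewrite -(hb _ bl) e chordalxx => /eqP.
    by rewrite eq_sym oner_eq0.
  - by rewrite ltr_pdivlMr // mul1r.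
  by exists c.
have [S hS] := choice hl.
have sbn : size lb = n.-1.+1 by rewrite prednK.
pose V := [set y | forall b, b \in lb -> (~` cball v b (v (S b))) (M y)].
have VN t : V (N (Some t)) <-> forall b, b \in lb -> v (S b) < v (t - b).
  rewrite /V /= NM; split => h b /h; rewrite cballE /= ltNge; first by move=> /negP.
  by move=> /negP.
have Vx : V x by move=> b _; rewrite Mx cballE.
exists V; split => //.
- split; first by exists x.
  exists n.-1, (fun i => M @^-1` (~` cball v (nth 0 lb i) (v (S (nth 0 lb i))))).
  split=> [i|].
    have il : nth 0 lb i \in lb by rewrite mem_nth // sbn.
    apply: hMB; exists (nth 0 lb i), (v (S (nth 0 lb i))); split; last by right.
    by exists (S (nth 0 lb i)) => //; case: (hS _ il).
  apply/seteqP; split => y hy; first by move=> i _; apply: hy; rewrite mem_nth // sbn.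
  move=> b bl; have ib : (index b lb < n.-1.+1)%N by rewrite -sbn index_mem.
  by have := hy (Ordinal ib) I; rewrite /= nth_index.
- move=> y Vy; have [->//|yx] := eqVneq y x.
  have [t ht] := misom_none hM Mx yx.
  have yE : y = N (Some t) by rewrite -ht MN.
  move: Vy; rewrite yE => /VN Vt.
  have [b0 b0l] : exists b, b \in lb.
    by case: (lb) sb => [e|b l _]; [rewrite -e in n0|exists b; rewrite mem_head].
  (* With [b] the pole nearest to [t] and [r] its distance to [t], every pole [a] is at distance
     [Num.max r (v (b - a))] from [t], and every zero at most at that distance. *)
  have [b bl hmin] : exists2 b, b \in lb & forall c, c \in lb -> v (t - b) <= v (t - c).
    clear -b0l; elim: lb b0 b0l => // a l IH b0 _; case: l IH => [|a' l] IH.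
      by exists a; rewrite ?mem_head // => c; rewrite inE => /eqP ->.
    have [b bl hb] := IH a' (mem_head _ _).
    have [h|h] := leP (v (t - a)) (v (t - b)).
      exists a; first exact: mem_head.
      by move=> c; rewrite inE => /predU1P[->//|/hb]; exact: le_trans.
    exists b; first by rewrite inE bl orbT.
    by move=> c; rewrite inE => /predU1P[->|/hb //]; exact: ltW.
  have [Sb0 [_ hSb]] := hS b bl; have {hSb} := hSb _ (Vt b bl).
  set r := v (t - b) in hmin *; have r0 : 0 < r by apply: le_lt_trans (Vt b bl); exact: uabs_ge0.
  have eb : \prod_(a <- lb) Num.max r (v (b - a)) = \prod_(a <- lb) v (t - a).
    apply: eq_big_seq => a al; have [h|h] := leP (v (b - a)) r.
      by apply/eqP; rewrite eq_le hmin //=; apply: (@uabs_dist_le _ _ b).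
    by apply/esym; apply: uabs_dist_eq.
  have pb0 : 0 < \prod_(a <- lb) v (t - a).
    rewrite big_seq; apply: prodr_gt0 => a al; apply: le_lt_trans (Vt a al); exact: uabs_ge0.
  have ea : \prod_(a <- la) v (t - a) <= \prod_(a <- la) Num.max r (v (b - a)).
    elim: (la) => [|a l IH]; first by rewrite !big_nil.
    rewrite !big_cons ler_pM ?uabs_ge0 ?prodr_ge0 // => [*|]; first exact: uabs_ge0.
    by apply: (@uabs_dist_le _ _ b); rewrite le_max lexx ?orbT.
  rewrite eb mulrAC ltr_pdivlMr // => h.
  rewrite -(ltr_pM2r pb0); have := hc t; rewrite gxw1 mulr1 => ->.
  apply: le_lt_trans h; apply: le_trans (_ : \prod_(a <- la) v (t - a) * dist (g x) z <= _).
    apply: ler_wpM2r; first exact: ltW.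
    apply: ler_piMl; last exact: chordal_le1.
    by apply: prodr_ge0 => a _; exact: uabs_ge0.
  by apply: ler_wpM2r => //; exact: ltW.
apply: contrapT => hno.
have cov a : exists b, a \in la -> b \in lb /\ v (a - b) <= v (S b).
  have [al|al] := boolP (a \in la); last by exists 0.
  have nV : ~ V (N (Some a)) by move=> Va; apply: hno; exists (N (Some a)) => //; exact: ha.
  apply: contrapT => hn; apply: nV; apply/VN => b bl.
  by rewrite ltNge; apply/negP => h; apply: hn; exists b.
have [kap hkap] := choice cov.
have la0 : (0 < size la)%N by rewrite sa.
(* The maximum principle is applied with zeros and poles exchanged: all zeros are now assumed to lie
   in the removed discs. *)
have [|||a al hmax] := @max_principle R K (fun a => v (S (kap a))) lb la.
- by rewrite sa sb.
- exact: la0.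
- by move=> a /hkap[bl _]; rewrite uabs_gt0; case: (hS _ bl).
have [bl hab] := hkap a al; set b := kap a in bl hab hmax.
have [Sb0 [h1 _]] := hS b bl.
have hsum (l : seq K) q : q \in l -> v (a - q) <= v (S b) + \sum_(c <- l) v (a - c).
  move=> ql; rewrite (big_rem q ql) /= addrCA lerDl addr_ge0 ?uabs_ge0 // sumr_ge0 //.
  by move=> *; exact: uabs_ge0.
have := hmax (v (S b) + \sum_(c <- la) v (a - c)).
rewrite lerDl sumr_ge0; last by move=> *; exact: uabs_ge0.
move=> /(_ isT (hsum la)); rewrite sa sb subnn expr0 mul1r.
have tr (l : seq K) : \prod_(c <- l) Num.max (v (S b)) (v (a - c)) =
    \prod_(c <- l) Num.max (v (S b)) (v (b - c)).
  apply: eq_bigr => c _; have [h|h] := leP (v (b - c)) (v (S b)).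
    by apply/max_idPl; apply: (@uabs_dist_le _ _ b).
  have -> : v (a - c) = v (b - c) by apply: uabs_dist_eq; exact: le_lt_trans h.
  by apply/max_idPr; exact: ltW.
by rewrite !tr leNgt h1.
Qed.

End PullBack.

(** * Local analysis *)

Section LocalAnalysis.
Variables (R : realType) (K : cpField R).
Local Notation v := (@uabs R K).
Local Notation dist := (@cdist R K).
Implicit Types (p A B : {poly K}) (g : option K -> option K).

Lemma gauss_split (s : seq K) (r : R) i : 0 <= r ->
  v ((\prod_(a <- s) ('X - a%:P))`_i) * r ^+ i <= \prod_(a <- s) Num.max r (v a).
Proof.
move=> r0; elim: s i => [|a s IH] i.
  rewrite !big_nil coef1; case: i => [|i] /=; first by rewrite uabs1 mulr1.
  by rewrite uabs0 mul0r ler01.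
have m0 : 0 <= \prod_(b <- s) Num.max r (v b).
  by apply: prodr_ge0 => b _; rewrite le_max r0.
have r0i k : 0 <= r ^+ k by apply: exprn_ge0.
rewrite !big_cons mulrBl coefB coefXM coefCM.
set q := \prod_(b <- s) _ in IH *; set m := \prod_(b <- s) _ in IH m0 *.
have h1 : v (a * q`_i) * r ^+ i <= Num.max r (v a) * m.
  rewrite uabsM -mulrA; apply: ler_pM; [exact: uabs_ge0| |by rewrite le_max lexx orbT|exact: IH].
  by apply: mulr_ge0 => //; exact: uabs_ge0.
case: i h1 => [|i] h1; first by rewrite sub0r uabsN.
have h2 : v q`_i * r ^+ i.+1 <= Num.max r (v a) * m.
  rewrite exprS mulrCA; apply: ler_pM => //; last by rewrite le_max lexx.
  by apply: mulr_ge0 => //; exact: uabs_ge0.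
have := uabsB q`_i (a * q`_i.+1); rewrite le_max => /orP[] h /=.
  by apply: le_trans h2; exact: ler_wpM2r.
by apply: le_trans h1; exact: ler_wpM2r.
Qed.

(** Cauchy's estimate. At a generic point on the circle of radius [v c] the polynomial attains its
    Gauss norm there, which bounds every coefficient; then [v c] is brought close to [rho]. *)
Lemma gauss_coef p (rho C : R) i : 0 < rho -> 0 <= C ->
  (forall z : K, v z < rho -> v p.[z] <= C) -> v p`_i * rho ^+ i <= C.
Proof.
move=> rho0 C0 hp; have [->|p0] := eqVneq p 0; first by rewrite coef0 uabs0 mul0r.
have key (c : K) : c != 0 -> v c < rho -> v p`_i * v c ^+ i <= C.
  move=> c0 hc; have [s _ hs] := poly_split p0.
  have [z hz1 hz2] := generic_point 0 s c0; rewrite subr0 in hz1.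
  have := hp z; rewrite hz1 => /(_ hc); apply: le_trans.
  rewrite {1}hs coefZ uabsM -mulrA {2}hs hornerZ uabsM ler_wpM2l ?uabs_ge0 //.
  apply: le_trans (gauss_split _ _ (uabs_ge0 _)) _.
  rewrite horner_prod uabs_prod le_eqVlt; apply/orP; left; apply/eqP/eq_big_seq => a ha.
  by rewrite !hornerE hz2 // sub0r uabsN.
rewrite leNgt; apply/negP => h.
have pi0 : 0 < v p`_i.
  rewrite lt_def uabs_ge0 andbT; apply: contraTneq h => ->; by rewrite mul0r -leNgt.
pose C' := Num.max C (v p`_i * rho ^+ i / 2).
have q0 : 0 < v p`_i * rho ^+ i by rewrite mulr_gt0 // exprn_gt0.
have C'0 : 0 < C' by rewrite lt_max divr_gt0 ?orbT.
have hC' : C' < v p`_i * rho ^+ i.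
  by rewrite gt_max h /= ltr_pdivrMr // ltr_pMr // ltr1n.
have [k k1 hk] : exists2 k : R, 1 < k & k ^+ i < v p`_i * rho ^+ i / C'.
  by apply: exprn_root_gt1; rewrite ltr_pdivlMr // mul1r.
have k0 := lt_trans ltr01 k1.
have [||c c0 /andP[c1 c2]] := @radius_exists R K (rho / k) rho.
- exact: divr_gt0.
- by rewrite ltr_pdivrMr // ltr_pMr.
have := key c c0 c2; rewrite leNgt => /negP; apply.
apply: le_lt_trans (_ : C' < _); first by rewrite le_max lexx.
have ki : 0 < k ^+ i by apply: exprn_gt0.
rewrite -(ltr_pM2r ki); apply: lt_le_trans (_ : v p`_i * rho ^+ i <= _).
  by rewrite mulrC -ltr_pdivlMr.
rewrite -mulrA; apply: ler_wpM2l; first exact: uabs_ge0.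
rewrite -exprMn; apply: lerXn2r; rewrite ?nnegrE ?mulr_ge0 ?uabs_ge0 ?(ltW rho0) ?(ltW k0) //.
by rewrite -ler_pdivrMr //; exact: ltW.
Qed.

Lemma uabs_horner_const B (rho : R) z : (forall z : K, v z < rho -> B.[z] != 0) ->
  v z < rho -> v B.[z] = v B.[0].
Proof.
move=> hB hz; have B0 : B != 0.
  by apply: contraTneq (hB z hz) => ->; rewrite horner0 eqxx.
have [s _ hs] := poly_split B0.
rewrite hs !hornerZ !uabsM !horner_prod !uabs_prod; congr (_ * _).
apply: eq_big_seq => a ha; rewrite !hornerXsubC sub0r uabsN uabsB_eqr //.
apply: lt_le_trans hz _; rewrite leNgt; apply/negP => /hB.
by rewrite hs hornerZ horner_prod (big_rem a ha) /= hornerXsubC subrr mul0r mulr0 eqxx.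
Qed.

Lemma poly_linear_approx p (rho C r : R) (z z' : K) : 0 < rho -> 0 <= C ->
  (forall i, v p`_i * rho ^+ i <= C) -> r <= rho -> v z <= r -> v z' <= r ->
  v (p.[z] - p`_0) * rho <= C * r /\
  v (p.[z] - p.[z'] - p`_1 * (z - z')) * rho ^+ 2 <= C * r * v (z - z').
Proof.
move=> rho0 C0 hp rr hz hz'; have r0 : 0 <= r by apply: le_trans hz; exact: uabs_ge0.
have sp : (size p <= (size p).+2)%N by rewrite leqW.
split.
  rewrite (horner_coef_wide _ sp) big_ord_recl expr0 mulr1 addrC addKr.
  rewrite -ler_pdivlMr //; apply: uabs_sum_le; first by rewrite divr_ge0 ?mulr_ge0 // ltW.
  move=> i; rewrite ler_pdivlMr // uabsM uabsX /= /bump /= add1n.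
  apply: le_trans (_ : v p`_i.+1 * (rho ^+ i * r) * rho <= _).
    apply: ler_wpM2r; first exact: ltW.
    apply: ler_wpM2l; first exact: uabs_ge0.
    rewrite exprSr; apply: ler_pM; rewrite ?exprn_ge0 ?uabs_ge0 //.
    by apply: lerXn2r; rewrite ?nnegrE ?uabs_ge0 ?(ltW rho0) //; exact: le_trans rr.
  rewrite -!mulrA [r * _]mulrC; rewrite 2!mulrA -[_ * _ * rho]mulrA -exprSr.
  exact: ler_wpM2r.
have -> : p.[z] - p.[z'] - p`_1 * (z - z') =
    \sum_(i < size p) p`_i.+2 * (z ^+ i.+2 - z' ^+ i.+2).
  rewrite !(horner_coef_wide _ sp) -sumrB 2!big_ord_recl /= !expr0 subrr add0r.
  rewrite /bump /= addn0 !expr1 mulrBr addrC addKr.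
  by apply: eq_bigr => i _; rewrite /bump /= !add1n mulrBr.
have rho2 : 0 < rho ^+ 2 by apply: exprn_gt0.
rewrite -ler_pdivlMr //; apply: uabs_sum_le.
  by rewrite divr_ge0 ?mulr_ge0 ?uabs_ge0 // ltW.
move=> i; rewrite ler_pdivlMr // subrXX !uabsM.
have hs : v (\sum_(j < i.+2) z ^+ (i.+2.-1 - j) * z' ^+ j) <= r * rho ^+ i.
  apply: uabs_sum_le; first by rewrite mulr_ge0 ?exprn_ge0 // ltW.
  move=> j; rewrite uabsM !uabsX; apply: le_trans (_ : r ^+ (i.+2.-1 - j) * r ^+ j <= _).
    by apply: ler_pM; rewrite ?exprn_ge0 ?uabs_ge0 //; apply: lerXn2r; rewrite ?nnegrE ?uabs_ge0.
  have hj : (j <= i.+1)%N by rewrite -ltnS ltn_ord.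
  rewrite -exprD [(_ - _ + _)%N](subnK hj) exprS; apply: ler_wpM2l => //.
  by apply: lerXn2r; rewrite ?nnegrE ?(ltW rho0).
apply: le_trans (_ : v p`_i.+2 * (v (z - z') * (r * rho ^+ i)) * rho ^+ 2 <= _).
  apply: ler_wpM2r; first exact: ltW.
  apply: ler_wpM2l; first exact: uabs_ge0.
  apply: ler_wpM2l => //; exact: uabs_ge0.
have -> : v p`_i.+2 * (v (z - z') * (r * rho ^+ i)) * rho ^+ 2 =
   v p`_i.+2 * rho ^+ i.+2 * r * v (z - z') by rewrite !exprS; ring.
apply: ler_wpM2r; first exact: uabs_ge0.
exact: ler_wpM2r.
Qed.

(** The denominator has constant norm on the disc, so Cauchy's estimate applies to [A] and [B]
    separately and no power series for the quotient is used. *)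
Lemma quot_linear_approx A B (rho S : R) : 0 < rho -> 0 <= S ->
  (forall z : K, v z < rho -> B.[z] != 0) ->
  (forall z : K, v z < rho -> v (A.[z] / B.[z]) <= S) ->
  exists2 c : K, v c * rho <= S & forall (r : R) (z z' : K), r < rho -> v z <= r -> v z' <= r ->
    v (A.[z] / B.[z] - A.[z'] / B.[z'] - c * (z - z')) * rho ^+ 2 <= S * r * v (z - z').
Proof.
move=> rho0 S0 hB hS; have v0 : v (0 : K) < rho by rewrite uabs0.
have b00 := hB 0 v0; set b := v B.[0]; have b0 : 0 < b by rewrite uabs_gt0.
have hBb := uabs_horner_const hB.
have coB : forall i, v B`_i * rho ^+ i <= b.
  by move=> i; apply: gauss_coef => //; [exact: ltW|move=> z hz; rewrite hBb].
have Sb : 0 <= S * b by rewrite mulr_ge0 // ltW.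
have coA : forall i, v A`_i * rho ^+ i <= S * b.
  move=> i; apply: gauss_coef => // z hz; have := hS z hz.
  by rewrite uabs_div hBb // ler_pdivrMr.
have := coA 0; have := coA 1%N; have := coB 1%N; rewrite expr0 expr1 mulr1 => cB1 cA1 cA0.
rewrite -horner_coef0 in cA0.
have rho2 : 0 < rho ^+ 2 by apply: exprn_gt0.
(* The derivative of [A / B] at 0. *)
pose c := (A`_1 * B.[0] - A.[0] * B`_1) / B.[0] ^+ 2.
have hc : v c * rho <= S.
  rewrite /c uabs_div uabsX -/b mulrAC ler_pdivrMr ?exprn_gt0 // -ler_pdivlMr //.
  have -> : S * b ^+ 2 = (S * b) * b by ring.
  apply: uabsB_le; rewrite uabsM ler_pdivlMr // -/b.
    by rewrite mulrAC; apply: ler_wpM2r; [exact: ltW|].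
  rewrite -[leLHS]mulrA; apply: ler_pM => //; first exact: uabs_ge0.
  by apply: mulr_ge0; [exact: uabs_ge0|exact: ltW].
exists c => // r z z' rr hz hz'.
have r0 : 0 <= r by apply: le_trans hz; exact: uabs_ge0.
have hzr := le_lt_trans hz rr; have hz'r := le_lt_trans hz' rr.
have Bz := hB z hzr; have Bz' := hB z' hz'r.
have [_ eA] := poly_linear_approx rho0 Sb coA (ltW rr) hz hz'.
have [_ eB] := poly_linear_approx rho0 (ltW b0) coB (ltW rr) hz hz'.
have [eA0 _] := poly_linear_approx rho0 Sb coA (ltW rr) hz' hz.
have [eB0 _] := poly_linear_approx rho0 (ltW b0) coB (ltW rr) hz' hz.
have [eB1 _] := poly_linear_approx rho0 (ltW b0) coB (ltW rr) hz hz.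
rewrite -!horner_coef0 in eA0 eB0 eB1.
set eA1 := A.[z] - A.[z'] - A`_1 * (z - z') in eA.
set eB2 := B.[z] - B.[z'] - B`_1 * (z - z') in eB.
set a0 := A.[z'] - A.[0] in eA0; set b1 := B.[z'] - B.[0] in eB0.
set b2 := B.[z] - B.[0] in eB1.
have vA' : v A.[z'] <= S * b by have := hS z' hz'r; rewrite uabs_div hBb // ler_pdivrMr.
(* The first two terms are the linearization errors of [A] and [B]. The last one is the deviation of
   the linear coefficient from its value at the centre, which is 0 by the choice of [c]. *)
have -> : A.[z] / B.[z] - A.[z'] / B.[z'] - c * (z - z') =
   (eA1 * B.[z'] - A.[z'] * eB2 + ((A`_1 * b1 - a0 * B`_1) -
     c * (B.[0] * b1 + b2 * B.[z'])) * (z - z')) / (B.[z] * B.[z']).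
  rewrite /c /eA1 /eB2 /a0 /b1 /b2; field.
  by rewrite Bz Bz' b00.
have D0 := uabs_ge0 (z - z'); set D := v (z - z') in eA eB D0 *.
rewrite uabs_div uabsM !hBb // -/b mulrAC ler_pdivrMr ?mulr_gt0 // -ler_pdivlMr //.
have T0 : 0 <= S * r * D * (b * b) / rho ^+ 2.
  by rewrite divr_ge0 ?mulr_ge0 // ltW.
apply: uabsD_le; first apply: uabsB_le.
- rewrite uabsM hBb // -/b ler_pdivlMr // [leLHS]mulrAC.
  have -> : S * r * D * (b * b) = (S * b * r * D) * b by ring.
  by apply: ler_wpM2r; [exact: ltW|].
- rewrite uabsM ler_pdivlMr // -[leLHS]mulrA.
  have -> : S * r * D * (b * b) = (S * b) * (b * r * D) by ring.
  by apply: ler_pM => //; rewrite ?uabs_ge0 // mulr_ge0 ?uabs_ge0 // ltW.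
rewrite uabsM -/D ler_pdivlMr // [leLHS]mulrAC.
have -> : S * r * D * (b * b) = (S * b * b * r) * D by ring.
apply: ler_wpM2r => //; rewrite -ler_pdivlMr //.
have nn (x y : K) : 0 <= v x * v y by rewrite mulr_ge0 // uabs_ge0.
have nr (x : K) : 0 <= v x * rho by rewrite mulr_ge0 ?uabs_ge0 // ltW.
apply: uabsB_le; first apply: uabsB_le; rewrite uabsM ler_pdivlMr //.
- have -> : v A`_1 * v b1 * rho ^+ 2 = (v A`_1 * rho) * (v b1 * rho) by ring.
  by apply: le_trans (ler_pM _ _ cA1 eB0) _ => //; rewrite !mulrA.
- have -> : v a0 * v B`_1 * rho ^+ 2 = (v a0 * rho) * (v B`_1 * rho) by ring.
  apply: le_trans (ler_pM _ _ eA0 cB1) _ => //.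
  by rewrite le_eqVlt; apply/orP; left; apply/eqP; ring.
have h3 : v (B.[0] * b1 + b2 * B.[z']) * rho <= b * b * r.
  rewrite -ler_pdivlMr //; apply: uabsD_le; rewrite uabsM ler_pdivlMr // ?hBb // -/b.
    by rewrite -!mulrA; apply: ler_wpM2l; [exact: ltW|].
  by rewrite mulrAC mulrC -mulrA; apply: ler_wpM2l; [exact: ltW|].
have -> : v c * v (B.[0] * b1 + b2 * B.[z']) * rho ^+ 2 =
   (v c * rho) * (v (B.[0] * b1 + b2 * B.[z']) * rho) by ring.
by apply: le_trans (ler_pM _ _ hc h3) _ => //; rewrite !mulrA.
Qed.

Lemma ratlmap_quot n g : ratlmap n g -> exists A B, forall z : K,
  g (Some z) = if B.[z] == 0 then None else Some (A.[z] / B.[z]).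
Proof.
move=> [P [Q [/isform_poly[A _ hA] /isform_poly[B _ hB] _ hg]]]; exists A, B => z.
by rewrite hg /hproj /= hA hB.
Qed.

Lemma chordal_near_some (t : option K) (w : K) :
  dist t (Some w) < (Num.max (v w) 1)^-1 ->
  exists2 u, t = Some u & Num.max (v u) 1 = Num.max (v w) 1.
Proof.
move=> h; case: t h => [u|]; last by rewrite chordalC chordal_inf ltxx.
move=> h; exists u => //; apply/invr_inj; rewrite -!chordal_inf.
by apply: chordal_eq; rewrite chordal_inf.
Qed.

Lemma ratlmap_derivative n g (z w : K) : (0 < n)%N -> ratlmap n g ->
  g (Some z) = Some w -> exists l, has_derivative v g z l.
Proof.
move=> n0 hg gz; have [A [B hAB]] := ratlmap_quot hg.
have m0 (t : K) : 0 < Num.max (v t) 1 by rewrite lt_max ltr01 orbT.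
have iw : 0 < (Num.max (v w) 1)^-1 by rewrite invr_gt0.
have [rho rho0 hr] := ratlmap_cont (Some z) n0 hg iw.
have hfin t : v t < rho -> (B \Po ('X + z%:P)).[t] != 0 /\
   v ((A \Po ('X + z%:P)).[t] / (B \Po ('X + z%:P)).[t]) <= Num.max (v w) 1.
  move=> ht; rewrite !horner_comp !hornerE.
  have : dist (Some (t + z)) (Some z) < rho.
    apply: le_lt_trans ht; rewrite chordal_some addrK ler_pdivrMr ?mulr_gt0 //.
    apply: ler_peMr; first exact: uabs_ge0.
    by apply: mulr_ege1; rewrite le_max lexx orbT.
  move=> /hr; rewrite gz => /chordal_near_some[u]; rewrite hAB.
  by case: eqP => // _ [->] <-; split => //; rewrite le_max lexx.
have [c _ hc] := quot_linear_approx rho0 (ltW (m0 w)) (fun t ht => proj1 (hfin t ht))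
  (fun t ht => proj2 (hfin t ht)).
exists c, w => // e e0; pose S := Num.max (v w) 1.
pose d := Num.min rho (e * rho ^+ 2 / S); have S0 : 0 < S := m0 w.
have d0 : 0 < d by rewrite lt_min rho0 divr_gt0 // mulr_gt0 // exprn_gt0.
exists d => // y yz; rewrite lt_min => /andP[y1 y2].
have [By _] := hfin _ y1.
have B0 : (B \Po ('X + z%:P)).[0] != 0 by case: (hfin 0) => //; rewrite uabs0.
move: gz By B0; rewrite hAB; case: eqP => // _ [wE].
rewrite !horner_comp !hornerD !hornerX !hornerC subrK add0r => By Bz.
exists (A.[y] / B.[y]); first by rewrite hAB (negPf By).
have yz0 : 0 < v (y - z) by rewrite uabs_gt0 subr_eq0.
have := hc (v (y - z)) (y - z) 0 y1 (lexx _); rewrite uabs0 uabs_ge0 => /(_ isT).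
rewrite !horner_comp !hornerD !hornerX !hornerC subrK add0r wE subr0 => h.
have -> : (A.[y] / B.[y] - w) / (y - z) - c = (A.[y] / B.[y] - w - c * (y - z)) / (y - z).
  by field; rewrite subr_eq0 yz By.
rewrite uabs_div ltr_pdivrMr // -(ltr_pM2r (exprn_gt0 2 rho0)).
apply: le_lt_trans h _; rewrite [ltRHS]mulrAC ltr_pM2r // mulrC.
by rewrite -ltr_pdivlMr.
Qed.

End LocalAnalysis.

(** * Near-linear maps and recurrence *)

Section Recurrence.
Variables (R : realType) (K : cpField R).
Local Notation v := (@uabs R K).
Local Notation dist := (@cdist R K).
Implicit Types (g : option K -> option K) (h : K -> K).

(** Only differences are controlled: the disc is mapped into itself, but 0 may move. *)
Definition near_linear (r theta : R) (c : K) h :=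
  (forall z, v z <= r -> v (h z) <= r) /\
  forall z z', v z <= r -> v z' <= r -> v (h z - h z' - c * (z - z')) <= theta * v (z - z').

Lemma near_linear_comp r theta c c' h h' : 0 <= theta <= 1 -> v c <= 1 -> v c' <= 1 ->
  near_linear r theta c h -> near_linear r theta c' h' -> near_linear r theta (c * c') (h \o h').
Proof.
move=> /andP[t0 t1] hc hc' [i1 a1] [i2 a2]; split=> [z hz|z z' hz hz'] /=; first exact/i1/i2.
have e1 := a1 _ _ (i2 _ hz) (i2 _ hz'); have e2 := a2 _ _ hz hz'.
have l2 : v (h' z - h' z') <= v (z - z').
  rewrite -[h' z - h' z'](subrK (c' * (z - z'))); apply: uabsD_le.
    by apply: le_trans e2 _; rewrite ler_piMl ?uabs_ge0.
  by rewrite uabsM ler_piMl ?uabs_ge0.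
have -> : h (h' z) - h (h' z') - c * c' * (z - z') =
  (h (h' z) - h (h' z') - c * (h' z - h' z')) + c * (h' z - h' z' - c' * (z - z')) by ring.
apply: uabsD_le; first by apply: le_trans e1 _; exact: ler_wpM2l.
rewrite uabsM; apply: le_trans e2; rewrite ler_piMl ?uabs_ge0 //.
Qed.

Lemma near_linear_iter r theta c h n : 0 <= theta <= 1 -> v c <= 1 ->
  near_linear r theta c h -> near_linear r theta (c ^+ n) (iter n h).
Proof.
move=> t hc hh; elim: n => [|n IH].
  split=> // z z' _ _; rewrite expr0 mul1r subrr uabs0 mulr_ge0 ?uabs_ge0 //.
  by case/andP: t.
rewrite exprS; have := near_linear_comp t hc _ hh IH; apply.
by rewrite uabsX exprn_ile1 ?uabs_ge0.
Qed.

(** Each iteration moves the point by [h z - z] up to the factor [theta], and ultrametric errors do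
    not add up. *)
Lemma near_linear_mul_step r theta h z n : 0 <= theta <= 1 -> near_linear r theta 1 h -> v z <= r ->
  v (iter n h z - z - n%:R * (h z - z)) <= theta * v (h z - z).
Proof.
move=> /andP[t0 t1] [i1 a1] hz.
have hr k : v (iter k h z) <= r by elim: k => [|k IH] //=; exact: i1.
elim: n => [|n IH] /=; first by rewrite mul0r subr0 subrr uabs0 mulr_ge0 ?uabs_ge0.
set w := iter n h z in IH *; have := a1 w z (hr n) hz; rewrite mul1r => e1.
have wz : v (w - z) <= v (h z - z).
  rewrite -[w - z](subrK (n%:R * (h z - z))); apply: uabsD_le.
    by apply: le_trans IH _; rewrite ler_piMl ?uabs_ge0.
  by rewrite uabsM ler_piMl ?uabs_ge0 ?uabs_nat.
have -> : h w - z - n.+1%:R * (h z - z) =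
  (h w - h z - (w - z)) + (w - z - n%:R * (h z - z)) by rewrite -[n.+1]addn1 natrD; ring.
by apply: uabsD_le => //; apply: le_trans e1 _; exact: ler_wpM2l.
Qed.

(** By the preceding lemma a p-th iterate displaces a point by p times the old displacement, up to
    the factor [theta]; hence every passage to the p-th iterate shrinks the displacement. *)
Lemma near_identity_pow r theta h z n : 0 <= theta <= 1 -> near_linear r theta 1 h -> v z <= r ->
  v (iter ((cp_res K).+1 ^ n) h z - z) <=
    (Num.max theta (v (cp_res K).+1%:R)) ^+ n * v (h z - z).
Proof.
move=> t hh hz; set p := (cp_res K).+1.
elim: n => [|n IH]; first by rewrite expn0 mul1r.
have hT : near_linear r theta 1 (iter (p ^ n) h).
  have := near_linear_iter (p ^ n) t _ hh; rewrite expr1n; apply.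
  by rewrite uabs1.
rewrite expnS iterM exprS -mulrA; set T := iter (p ^ n) h in IH hT *.
have m0 : 0 <= Num.max theta (v p%:R) by rewrite le_max uabs_ge0 orbT.
apply: le_trans (ler_wpM2l m0 IH).
rewrite -[iter p T z - z](subrK (p%:R * (T z - z))); apply: uabsD_le.
  apply: le_trans (near_linear_mul_step p t hT hz) _.
  by apply: ler_wpM2r; [exact: uabs_ge0|rewrite le_max lexx].
by rewrite uabsM; apply: ler_wpM2r; [exact: uabs_ge0|rewrite le_max lexx orbT].
Qed.

(** The residue class of [c] is a root of unity: [c] is close to an element of a subfield whose
    integers fall into finitely many residue classes, and two powers of that element share a
    class. *)
Lemma unit_power (c : K) : v c = 1 -> exists2 q, (0 < q)%N & v (c ^+ q - 1) < 1.
Proof.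
move=> vc; have [L [[L1 _ LM _] [hap hcode]]] := @cp_approx R K [:: c] 1 ltr01.
have [c' Lc' cc'] := hap c (mem_head _ _).
have vc' : v c' = 1.
  by rewrite -[c'](subKr c) uabsB_eql // vc.
have [N [code hco]] := hcode 1 ltr01.
have LX i : L (c' ^+ i) by elim: i => [|i IH]; rewrite ?expr0 // exprS; exact: LM.
have [i [j [ij cij]]] : exists i j : 'I_N.+1, (i < j)%N /\ code (c' ^+ i) = code (c' ^+ j).
  have : ~~ injectiveb (fun i : 'I_N.+1 => code (c' ^+ i)).
    apply/negP => /injectiveP /leq_card; by rewrite !card_ord ltnn.
  case/injectivePn => i [j ij e].
  have [h|h|h] := ltngtP i j; [by exists i, j|by exists j, i|].
  by case/negP: ij; apply/eqP/val_inj.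
have vX k : v (c' ^+ k) = 1 by rewrite uabsX vc' expr1n.
have := hco (c' ^+ i) (c' ^+ j) (LX _) (LX _); rewrite !vX lexx => /(_ isT isT cij) h.
exists (j - i)%N; first by rewrite subn_gt0.
have h1 : v (c' ^+ (j - i) - 1) < 1.
  apply: le_lt_trans h; have e : c' ^+ j = c' ^+ i * c' ^+ (j - i) by rewrite -exprD subnKC // ltnW.
  by rewrite e -{1}[c' ^+ i]mulr1 -mulrBr uabsM vX mul1r uabs_distC.
apply: (@uabs_dist_lt _ _ (c' ^+ (j - i))) => //.
rewrite subrXX uabsM; apply: le_lt_trans cc'; rewrite ler_piMr ?uabs_ge0 //.
apply: uabs_sum_le => // k; rewrite uabsM !uabsX vc vc' !expr1n mulr1 //.
Qed.

Lemma near_linear_recurrent r theta c h z (e : R) N : 0 <= theta < 1 -> v c = 1 ->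
  near_linear r theta c h -> v z <= r -> 0 < e ->
  exists2 m, (N <= m)%N & v (iter m h z - z) < e.
Proof.
move=> /andP[t0 t1] vc hh hz e0.
have [q q0 hq] := unit_power vc.
have th01 : 0 <= theta <= 1 by rewrite t0 ltW.
have vc1 : v c <= 1 by rewrite vc.
have [i1 a1] := near_linear_iter q th01 vc1 hh.
pose th := Num.max theta (v (c ^+ q - 1)).
have hT : near_linear r th 1 (iter q h).
  split=> // w w' hw hw'; rewrite mul1r.
  have -> : iter q h w - iter q h w' - (w - w') =
    (iter q h w - iter q h w' - c ^+ q * (w - w')) + (c ^+ q - 1) * (w - w') by ring.
  apply: uabsD_le.
    by apply: le_trans (a1 _ _ hw hw') _; apply: ler_wpM2r; [exact: uabs_ge0|rewrite le_max lexx].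
  by rewrite uabsM; apply: ler_wpM2r; [exact: uabs_ge0|rewrite le_max lexx orbT].
have th1 : 0 <= th <= 1.
  by apply/andP; split; [rewrite le_max t0|rewrite ge_max (ltW t1) (ltW hq)].
pose l := Num.max th (v (cp_res K).+1%:R).
have l01 : 0 <= l < 1 by rewrite le_max uabs_ge0 orbT !gt_max t1 hq (cp_res_lt1 K).
set D := v (iter q h z - z); have D0 : 0 <= D by exact: uabs_ge0.
have [n hn] : exists n, l ^+ n < e / (D + 1).
  by apply: exprn_small => //; rewrite divr_gt0 // ltr_wpDl.
have p1 : (1 < (cp_res K).+1)%N.
  rewrite ltnS lt0n; apply/negP => /eqP h0; have := cp_res_lt1 K.
  by rewrite h0 uabs1 ltxx.
(* The [q]-th iterate is close to the identity, and its p-power iterates tend to it. The exponent is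
   at least [N] because p > 1. *)
exists ((cp_res K).+1 ^ maxn n N * q)%N.
  apply: leq_trans (leq_pmulr _ q0); apply: leq_trans (ltnW (ltn_expl _ p1)).
  exact: leq_maxr.
rewrite iterM; apply: le_lt_trans (near_identity_pow _ th1 hT hz) _.
rewrite -/D -/l; case/andP: l01 => l0 l1.
have : l ^+ n * (D + 1) < e by rewrite -ltr_pdivlMr // ltr_wpDl.
apply: le_lt_trans; apply: ler_pM => //; first exact: exprn_ge0.
  by apply: ler_wiXn2l => //; [exact: ltW|exact: leq_maxl].
by rewrite lerDl.
Qed.

Lemma chordal_lt_some (t : option K) (r : R) : r <= 1 -> dist t (Some 0) < r ->
  exists2 w, t = Some w & v w < r.
Proof.
move=> r1; case: t => [w|]; first by rewrite chordal_0 //; exists w.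
by rewrite chordalC chordal_inf uabs0 (max_r ler01) invr1 ltNge r1.
Qed.

(* The map g read in an isometric coordinate centred at x. *)
Lemma local_form n g x (rho S : R) : (0 < n)%N -> ratlmap n g -> 0 < rho -> rho <= 1 ->
  0 <= S -> S <= 1 -> (forall z, dist z x < rho -> dist (g z) x < S) ->
  exists M h (c : K), [/\ forall y z, dist y x < 1 -> dist z x < 1 ->
       dist y z = v (M y - M z), M x = 0, forall y, dist y x < rho -> M (g y) = h (M y),
     v c * rho <= S &
     forall (r : R) (z z' : K), r < rho -> v z <= r -> v z' <= r ->
       v (h z - h z' - c * (z - z')) * rho ^+ 2 <= S * r * v (z - z')].
Proof.
move=> n0 hg rho0 rho1 S0 S1 hgS.
have [M [N [[[MN NM dM] [hM hN _ _]] Mx]]] := misom_to_0 x.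
have hG := ratlmap_comp hM (ratlmap_comp hg hN).
have [A [B hAB]] := ratlmap_quot hG.
have hin z : v z < rho -> dist (N (Some z)) x < rho.
  by move=> hz; rewrite -dM NM Mx chordal_0.
have hAS z : v z < rho -> B.[z] != 0 /\ v (A.[z] / B.[z]) <= S.
  move=> /hin /hgS; rewrite -dM Mx => /(chordal_lt_some S1)[w].
  have := hAB z; rewrite /= => ->; case: eqP => // _ [->] /ltW; by split.
have [c hc1 hc2] := quot_linear_approx rho0 S0 (fun z hz => proj1 (hAS z hz))
  (fun z hz => proj2 (hAS z hz)).
exists (fun y => if M y is Some t then t else 0), (fun z => A.[z] / B.[z]), c.
split => //.
- move=> y z hy hz; rewrite -(dM y z); move: hy hz.
  rewrite -(dM y x) -(dM z x) Mx => /(chordal_lt_some (lexx _))[s -> s1].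
  by move=> /(chordal_lt_some (lexx _))[t -> t1]; rewrite chordal_some_le1 // ltW.
- by rewrite Mx.
- move=> y; rewrite -{1}dM Mx => /(chordal_lt_some rho1)[s hs s1].
  have := hAB s; rewrite /= -hs MN => ->; have [Bs _] := hAS s s1.
  by rewrite (negPf Bs) hs.
Qed.

(** The linear coefficient [c] decides; its norm is at most 1 as the disc maps into itself. On the
    closed disc of radius r the error contracts by [r / rho], which is why only smaller discs are
    treated. *)
Lemma trap_dichotomy n g x (rho : R) : (0 < n)%N -> ratlmap n g -> 0 < rho -> rho <= 1 ->
  (forall z, dist z x < rho -> dist (g z) x < rho) ->
  (forall z (e : R) N, dist z x < rho -> 0 < e ->
     exists2 m, (N <= m)%N & dist (iter m g z) z < e) \/
  (forall r : R, r < rho -> exists2 l, 0 <= l < 1 & forall y z, dist y x <= r -> dist z x <= r ->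
     dist (g y) (g z) <= l * dist y z).
Proof.
move=> n0 hg rho0 rho1 hgr.
have [M [h [c [dM Mx hMh hc hlin]]]] := local_form n0 hg rho0 rho1 (ltW rho0) rho1 hgr.
have lt1 y : dist y x < rho -> dist y x < 1 by move=> hy; exact: lt_le_trans rho1.
have xx : dist x x < 1 by rewrite chordalxx.
have dMx y : dist y x < 1 -> dist y x = v (M y) by move=> hy; rewrite dM // Mx subr0.
have c1 : v c <= 1 by rewrite -(ler_pM2r rho0) mul1r.
have hl (r : R) z z' : r < rho -> v z <= r -> v z' <= r ->
    v (h z - h z' - c * (z - z')) <= r / rho * v (z - z').
  move=> rr hz hz'; rewrite -(ler_pM2r (exprn_gt0 2 rho0)).
  apply: le_trans (hlin _ _ _ rr hz hz') _; rewrite le_eqVlt; apply/orP; left; apply/eqP.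
  by field; rewrite gt_eqF.
have [vc|vc] := eqVneq (v c) 1; [left|right].
  move=> z e N hz e0; have hz1 := lt1 _ hz.
  have h0 : v (h 0) < rho.
    rewrite -Mx -hMh ?chordalxx // -dMx; last by apply: lt1; apply: hgr; rewrite chordalxx.
    by apply: hgr; rewrite chordalxx.
  (* The radius includes [v (h 0)] so that the closed disc is invariant although its centre may
     move. *)
  pose r := Num.max (v (M z)) (v (h 0)).
  have r0 : 0 <= r by rewrite le_max uabs_ge0.
  have rr : r < rho by rewrite gt_max h0 -dMx // hz.
  have hnl : near_linear r (r / rho) c h.
    split=> [s hs|s s' hs hs']; last exact: hl.
    rewrite -[h s](subrK (h 0)); apply: uabsD_le; last by rewrite le_max lexx orbT.
    rewrite -[h s - h 0](subrK (c * (s - 0))); apply: uabsD_le.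
      have v0 : v (0 : K) <= r by rewrite uabs0.
      apply: le_trans (hl _ _ _ rr hs v0) _; rewrite subr0.
      by apply: le_trans hs; rewrite ler_piMl ?uabs_ge0 // ler_pdivrMr // mul1r ltW.
    by rewrite uabsM vc mul1r subr0.
  have hz2 : v (M z) <= r by rewrite le_max lexx.
  have th : 0 <= r / rho < 1 by rewrite divr_ge0 ?(ltW rho0) // ltr_pdivrMr // mul1r.
  have [m Nm hm] := near_linear_recurrent N th vc hnl hz2 e0; exists m => //.
  have [ho hMo] : dist (iter m g z) x < rho /\ M (iter m g z) = iter m h (M z).
    elim: m {Nm hm} => [|m [IH1 IH2]] //=; split; first exact: hgr.
    by rewrite hMh // IH2.
  by rewrite dM ?lt1 // hMo.
move=> r rr; have [r0|r0] := ltP r 0.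
  exists 0; first by rewrite lexx ltr01.
  by move=> y z hy; have := le_lt_trans hy r0; rewrite ltNge chordal_ge0.
exists (Num.max (v c) (r / rho)).
  by rewrite le_max uabs_ge0 gt_max lt_neqAle vc c1 ltr_pdivrMr // mul1r.
move=> y z hy hz; have hy1 := le_lt_trans hy rr; have hz1 := le_lt_trans hz rr.
have gy := hgr _ hy1; have gz := hgr _ hz1.
rewrite (dM (g y)) ?lt1 // (dM y) ?lt1 // !hMh //.
have y1 := lt1 _ hy1; have z1 := lt1 _ hz1.
rewrite (dMx y) // in hy; rewrite (dMx z) // in hz.
rewrite -[h _ - h _](subrK (c * (M y - M z))); apply: uabsD_le.
  apply: le_trans (hl _ _ _ rr hy hz) _.
  by apply: ler_wpM2r; [exact: uabs_ge0|rewrite le_max lexx orbT].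
by rewrite uabsM; apply: ler_wpM2r; [exact: uabs_ge0|rewrite le_max lexx].
Qed.

(** The first alternative is the attracting or indifferent case, the second the repelling one. *)
Lemma fixed_dichotomy n g x : (0 < n)%N -> ratlmap n g -> g x = x ->
  exists2 rho : R, 0 < rho <= 1 &
    (forall z, dist z x < rho -> dist (g z) x <= dist z x) \/
    (forall y z, dist y x < rho -> dist z x < rho -> dist y z <= dist (g y) (g z)).
Proof.
move=> n0 hg gx; have [d d0 hd] := ratlmap_cont x n0 hg ltr01.
pose rho : R := Num.min d 1; have rho0 : 0 < rho by rewrite lt_min d0 ltr01.
have rho1 : rho <= 1 by rewrite ge_min lexx orbT.
have hgr z : dist z x < rho -> dist (g z) x < 1.
  by rewrite lt_min => /andP[/hd]; rewrite gx.
have [M [h [c [dM Mx hMh hc hlin]]]] := local_form n0 hg rho0 rho1 ler01 (lexx _) hgr.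
(* Within radius [rho ^+ 2] the error is strictly smaller than the distance of the two points. *)
pose s := rho ^+ 2; have s0 : 0 < s by apply: exprn_gt0.
have srho : s <= rho by rewrite /s expr2 ler_piMl // ltW.
have s1 := le_trans srho rho1.
have xx : dist x x < 1 by rewrite chordalxx.
have dMx y : dist y x < 1 -> dist y x = v (M y) by move=> hy; rewrite dM // Mx subr0.
exists s; first by rewrite s0.
have hl y z : dist y x < s -> dist z x < s -> y != z ->
    v (h (M y) - h (M z) - c * (M y - M z)) < v (M y - M z).
  move=> hy hz yz; have hy1 := lt_le_trans hy s1; have hz1 := lt_le_trans hz s1.
  have D0 : 0 < v (M y - M z) by rewrite -dM // chordal_gt0.
  have [r r1 [r2 r3]] : exists2 r, r < s & dist y x <= r /\ dist z x <= r.
    exists (Num.max (dist y x) (dist z x)); first by rewrite gt_max hy.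
    by rewrite !le_max !lexx orbT.
  rewrite (dMx y) // in r2; rewrite (dMx z) // in r3.
  have := hlin r _ _ (lt_le_trans r1 srho) r2 r3; rewrite mul1r => h1.
  by rewrite -(ltr_pM2r s0); apply: le_lt_trans h1 _; rewrite [ltRHS]mulrC ltr_pM2r.
have [c1|c1] := leP (v c) 1; [left|right].
  move=> z hz; have [->|zx] := eqVneq z x; first by rewrite gx.
  have z1 := lt_le_trans hz s1; have zr := lt_le_trans hz srho.
  have gz := hgr _ zr; rewrite (dMx (g z)) // (dMx z) // hMh //.
  have := hl z x hz _ zx; rewrite chordalxx Mx => /(_ s0).
  have -> : h 0 = 0 by rewrite -Mx -hMh ?chordalxx // gx.
  rewrite !subr0 => h1; rewrite -[h _](subrK (c * M z)); apply: uabsD_le; first exact: ltW.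
  by rewrite uabsM ler_piMl ?uabs_ge0.
move=> y z hy hz; have [->|yz] := eqVneq y z; first by rewrite !chordalxx.
have yr := lt_le_trans hy srho; have zr := lt_le_trans hz srho.
have y1 := lt_le_trans hy s1; have z1 := lt_le_trans hz s1.
have gy := hgr _ yr; have gz := hgr _ zr.
rewrite dM // (dM (g y)) // !hMh //; have h1 := hl y z hy hz yz.
have D0 : 0 < v (M y - M z) by rewrite -dM // chordal_gt0.
have h2 : v (M y - M z) < v (c * (M y - M z)) by rewrite uabsM ltr_pMl.
rewrite -[h _ - h _](subrK (c * (M y - M z))) [leRHS]uabsD_eqr; first exact: ltW.
exact: lt_trans h2.
Qed.

Lemma max1_eq (u z : K) : v (u - z) <= 1 -> Num.max (v u) 1 = Num.max (v z) 1.
Proof.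
move=> h; have aux (a b : K) : v (a - b) <= 1 -> Num.max (v a) 1 <= Num.max (v b) 1.
  move=> hab; rewrite ge_max le_max [1 <= _]le_max lexx orbT andbT.
  have := uabsD (a - b) b; rewrite subrK le_max => /orP[h1|->//].
  by rewrite (le_trans h1 hab) orbT.
by apply/eqP; rewrite eq_le !aux // uabs_distC.
Qed.

Lemma derivative_near g (z l : K) : g (Some z) = Some z -> has_derivative v g z l ->
  exists2 d : R, 0 < d & forall y, dist y (Some z) < d ->
    (v l < 1 -> dist (g y) (Some z) <= Num.max (v l) (1 / 2) * dist y (Some z)) /\
    (1 <= v l -> dist y (Some z) <= dist (g y) (Some z)).
Proof.
move=> gz [w]; rewrite gz => -[<-] hder.
have [d0 d00 hd0] : exists2 d : R, 0 < d & forall y, y != z -> v (y - z) < d ->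
    exists2 u, g (Some y) = Some u & v ((u - z) / (y - z) - l) < 1 / 2.
  by apply: hder; rewrite divr_gt0.
pose m := Num.max (v z) 1; have m0 : 0 < m by rewrite lt_max ltr01 orbT.
(* The last entry keeps the image within 1 of [z], so that the chordal denominators of point and
   image agree. The tolerance 1/2 keeps the quotient below 1 in norm if [l] is, and equal to [l] in
   norm otherwise. *)
pose e := Num.min d0 (Num.min 1 (v l + 1)^-1).
have l10 : 0 < v l + 1 by rewrite ltr_wpDl ?uabs_ge0.
have e0 : 0 < e by rewrite !lt_min d00 ltr01 invr_gt0.
exists (Num.min m^-1 (e / (m * m))); first by rewrite lt_min invr_gt0 m0 divr_gt0 ?mulr_gt0.
move=> y; rewrite lt_min => /andP[/chordal_near_some[t -> mt]].
have [->|tz] := eqVneq t z; first by rewrite gz chordalxx mulr0.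
rewrite chordal_some mt -/m ltr_pM2r ?invr_gt0 ?mulr_gt0 // !lt_min => /and3P[h1 h2 h3].
have [u -> hu] := hd0 t tz h1; have D0 : 0 < v (t - z) by rewrite uabs_gt0 subr_eq0.
have uE : v (u - z) = v ((u - z) / (t - z)) * v (t - z).
  by rewrite -uabsM divfK // subr_eq0.
have half1 : (1 / 2 : R) < 1 by rewrite ltr_pdivrMr // mul1r ltr1n.
have qle : v ((u - z) / (t - z)) <= Num.max (v l) (1 / 2).
  rewrite -[_ / _ in leLHS](subrK l); apply: uabsD_le; last by rewrite le_max lexx.
  by rewrite le_max (ltW hu) orbT.
have u1 : v (u - z) <= 1.
  rewrite uE; apply: le_trans (_ : (v l + 1) * v (t - z) <= _); last first.
    by rewrite mulrC -ler_pdivlMr // div1r ltW.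
  apply: ler_wpM2r; first exact: ltW.
  apply: le_trans qle _; rewrite ge_max lerDl ler01 /=.
  by rewrite (le_trans (ltW half1)) // lerDr uabs_ge0.
rewrite chordal_some (max1_eq u1) -/m; have mm : 0 < (m * m)^-1 by rewrite invr_gt0 mulr_gt0.
split=> l1; first by rewrite mulrA ler_pM2r // uE ler_pM2r.
rewrite ler_pM2r // uE ler_peMl ?uabs_ge0 //.
rewrite -[_ / _](subrK l) uabsD_eqr //; exact: lt_le_trans (lt_trans hu half1) l1.
Qed.

Lemma multiplier_near g x (l : K) : g x = x -> has_multiplier v g x l ->
  exists2 d : R, 0 < d & forall y, dist y x < d ->
    (v l < 1 -> dist (g y) x <= Num.max (v l) (1 / 2) * dist y x) /\
    (1 <= v l -> dist y x <= dist (g y) x).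
Proof.
case: x => [z|] gx hm; first exact: derivative_near.
have [|d d0 hd] := derivative_near _ hm.
  by rewrite /= eqxx gx.
exists d => // y hy; have := hd (@inv_chart K y).
have e t : dist (@inv_chart K t) (Some 0) = dist t None.
  by rewrite -[Some 0]/(@inv_chart K None) dist_sigma.
by rewrite /= sigmaK !e; apply.
Qed.

Lemma multiplier_exists n g x : (0 < n)%N -> ratlmap n g -> g x = x ->
  exists l, has_multiplier v g x l.
Proof.
move=> n0 hg; case: x => [z|] gx; first exact: ratlmap_derivative n0 hg gx.
have h := ratlmap_comp (ratlmap_sigma K) (ratlmap_comp hg (ratlmap_sigma K)).
by apply: ratlmap_derivative h _; rewrite ?mul1n ?muln1 //= eqxx gx.
Qed.

End Recurrence.

(** * Iteration of a rational map *)

Section Backward.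
Variables (R : realType) (K : cpField R).
Local Notation v := (@uabs R K).
Local Notation dist := (@cdist R K).
Variables (d : nat) (g : option K -> option K).
Hypotheses (d1 : (1 < d)%N) (hg : ratlmap d g).
Implicit Types (x y z w : option K).

Let d0 : (0 < d)%N := ltnW d1.

Lemma expd_gt0 n : (0 < d ^ n)%N. Proof. by rewrite expn_gt0 d0. Qed.

Lemma near_avoid x (s : seq (option K)) (e : R) : 0 < e ->
  exists2 y, dist y x < e & y \notin s.
Proof.
move=> e0; have [c c0 [ce [_ c1]]] := small_affinoid x e0.
have [z zx hz] := chordal_generic x s c0 c1; exists z; first by rewrite zx.
apply/negP => /hz; rewrite chordalxx => h.
have : 0 < v c by rewrite uabs_gt0.
by rewrite ltNge; case/negP; rewrite h le_max lexx.
Qed.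

Lemma generic_three (s : seq (option K)) : exists a b c : option K,
  [/\ a != b, b != c & a != c] /\ forall z, z \in [:: a; b; c] -> forall y, y \in s -> dist z y = 1.
Proof.
have ne (y z : option K) : dist y z = 1 -> z != y.
  by move=> h; rewrite eq_sym -(@chordal_gt0 _ K) h ltr01.
have [a ha] := generic_dist1 s; have [b hb] := generic_dist1 (Some a :: s).
have [c hc] := generic_dist1 (Some b :: Some a :: s).
exists (Some a), (Some b), (Some c); split.
  by split; apply: ne; [apply: hb|apply: hc|apply: hc]; rewrite !inE eqxx ?orbT.
move=> z; rewrite !inE => /or3P[] /eqP -> y ys; [exact: ha|apply: hb|apply: hc];
  by rewrite !inE ys ?orbT.
Qed.

(** If [W] were finite, a section of [g] would permute it, so each of its points would have a single
    preimage. With at least three points this is excluded by [no_three_ramified]. *)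
Lemma backward_infinite (W : set (option K)) : (forall a, W (g a) -> W a) ->
  (exists a b c, [/\ a != b, b != c & a != c] /\ [/\ W a, W b & W c]) ->
  forall m, exists2 ws : seq (option K), uniq ws /\ size ws = m & forall w, w \in ws -> W w.
Proof.
move=> hW [a [b [c [[ab bc ac] [Wa Wb Wc]]]]].
have grow ws : uniq ws -> (2 < size ws)%N -> (forall w, w \in ws -> W w) ->
    exists2 w, W w & w \notin ws.
  move=> uw sw hw; apply: contrapT => hno.
  have Wws w : W w -> w \in ws.
    by move=> Ww; apply: contrapT => h; apply: hno; exists w => //; exact/negP.
  have [s hs] := choice (fun u => ratlmap_surj u d0 hg).
  have us : uniq (map s ws) by rewrite map_inj_uniq //; exact: can_inj hs.
  have sub : {subset map s ws <= ws}.
    by move=> _ /mapP[w ww ->]; apply/Wws/hW; rewrite hs; exact: hw.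
  have [|_ e] := uniq_min_size us sub; first by rewrite size_map.
  have fib w y : w \in ws -> g y = w -> y = s w.
    move=> ww gy; have : y \in map s ws by rewrite e; apply/Wws/hW; rewrite gy; exact: hw.
    by case/mapP => w' _ yE; rewrite -gy yE hs.
  case: ws uw sw {hw hno Wws us sub e} fib => [|w1 [|w2 [|w3 ws]]] //= /and4P[h1 h2 _ _] _ fib.
  move: h1 h2; rewrite !inE !negb_or => /and3P[h12 h13 _] /andP[h23 _].
  by apply: (no_three_ramified d1 hg h12 h23 h13 (fun y => fib w1 y _) (fun y => fib w2 y _)
    (fun y => fib w3 y _)); rewrite !inE eqxx ?orbT.
have big m : exists2 ws, uniq ws /\ (m < size ws)%N /\ (2 < size ws)%N & forall w, w \in ws -> W w.
  elim: m => [|m [ws [u [h1 h2]] hw]].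
    exists [:: a; b; c]; first by rewrite /= !inE negb_or ab bc ac.
    by move=> w; rewrite !inE => /or3P[] /eqP ->.
  have [w Ww nw] := grow ws u h2 hw; exists (w :: ws); first by rewrite /= nw u !ltnS h1 ltnW.
  by move=> z; rewrite inE => /predU1P[->|/hw].
move=> m; have [ws [u [h1 _]] hw] := big m; exists (take m ws).
  by split; [exact: take_uniq|rewrite size_takel // ltnW].
by move=> w /mem_take /hw.
Qed.

Definition recur x := forall (e : R) N, 0 < e -> exists2 m, (N <= m)%N & dist (iter m g x) x < e.

Lemma recur_image x : recur x -> recur (g x).
Proof.
move=> hx e N e0; have [del del0 hdel] := ratlmap_cont x d0 hg e0.
by have [m Nm hm] := hx del N del0; exists m => //; rewrite -iterSr /=; exact: hdel.
Qed.

Lemma fixed_point : exists x, g x = x.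
Proof.
have [s ss [_ [_ [_ hs _]]]] := ratlmap_fix d1 hg.
by case: s ss hs => // a s _ hs; exists a; apply: hs; rewrite mem_head.
Qed.

(** If all points were recurrent, a fixed point would be its own only preimage, since other
    preimages never come back. Then the distance to it is at most a multiple of its d-th power after
    one step, and nearby points are attracted without returning. *)
Lemma exists_nonrecur : exists x, ~ recur x.
Proof.
apply: contrapT => hno; have rec x : recur x by apply: contrapT => h; apply: hno; exists x.
have [x gx] := fixed_point.
have fib a : g a = x -> a = x.
  move=> ga; apply: contrapT => /eqP ax; have dax : 0 < dist x a by rewrite chordal_gt0 eq_sym.
  have [m m0] := rec a _ 1%N dax; case: m m0 => // m _.
  by rewrite iterSr ga; elim: m => [|m IH] /=; rewrite ?ltxx // -iterS iterSr gx.
have [Nm [A [B [B0 hN hfac]]]] := ratlmap_factor d0 hg.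
have [s ss [C C0 [hs hC]]] := hfac x.
have sx : forall a, a \in s -> a = x by move=> a /hs /fib.
have hup y : dist (g y) x <= C / B * dist y x ^+ d.
  have <- : \prod_(a <- s) dist y a = dist y x ^+ d.
    by rewrite (eq_big_seq (fun=> dist y x)) ?big_const_seq ?count_predT ?ss ?iter_mulr_1 // => a /sx ->.
  rewrite mulrAC ler_pdivlMr // -hC; apply: ler_wpM2l; first exact: chordal_ge0.
  by case/andP: (hN y).
pose del := Num.min 1 (B / (2 * C)).
have C2 : 0 < 2 * C by rewrite mulr_gt0.
have del0 : 0 < del by rewrite lt_min ltr01 divr_gt0.
have hhalf y : dist y x < del -> dist (g y) x <= dist y x / 2.
  rewrite lt_min => /andP[_ hy]; apply: le_trans (hup y) _.
  have D0 := chordal_ge0 y x; apply: le_trans (_ : C / B * dist y x ^+ 2 <= _).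
    apply: ler_wpM2l; first by rewrite divr_ge0 // ltW.
    by apply: ler_wiXn2l => //; exact: chordal_le1.
  rewrite expr2 mulrA mulrC; apply: ler_wpM2l => //.
  have : dist y x * (2 * C) <= B by rewrite -ler_pdivlMr // ltW.
  by move=> h; rewrite mulrAC ler_pdivrMr //; lra.
have [y yx ydel] := near_dist x del0.
have D0 : 0 < dist y x by rewrite chordal_gt0.
have hit m : dist (iter m.+1 g y) x <= dist y x / 2.
  elim: m => [|m IH]; first exact: hhalf.
  have h : dist (iter m.+1 g y) x <= dist y x.
    by apply: le_trans IH _; rewrite ler_pdivrMr // ler_peMr ?ler1n // ltW.
  rewrite iterS; apply: le_trans (hhalf _ (le_lt_trans h ydel)) _.
  by rewrite ler_pM2r ?invr_gt0.
have [[//|m] _] := rec y _ 1%N D0.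
rewrite (@chordal_eq _ _ _ x); first by rewrite chordalC ltxx.
rewrite (chordalC x); apply: le_lt_trans (hit m) _.
by rewrite ltr_pdivrMr // ltr_pMr // ltr1n.
Qed.

(** Preimages of a nonrecurrent point are nonrecurrent, and such points are not periodic, so two
    successive preimages give three distinct points. The orbit of a set of recurrent points omits
    them. *)
Lemma three_nonrecur : exists a b c, [/\ a != b, b != c & a != c] /\
  [/\ ~ recur a, ~ recur b & ~ recur c].
Proof.
have [w0 h0] := exists_nonrecur.
have [w1 h1] := ratlmap_surj w0 d0 hg; have [w2 h2] := ratlmap_surj w1 d0 hg.
have n1 : ~ recur w1 by move=> /recur_image; rewrite h1.
have n2 : ~ recur w2 by move=> /recur_image; rewrite h2.
have per w : ~ recur w -> forall k, (0 < k)%N -> iter k g w <> w.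
  move=> nw k k0 hk; apply: nw => e N e0; exists (N * k)%N; first exact: leq_pmulr.
  have -> : iter (N * k) g w = w by elim: N => // N IH; rewrite mulSn iterD IH.
  by rewrite chordalxx.
exists w0, w1, w2; split => //; split; apply/eqP => e.
- by apply: (per w0 h0 1%N) => //=; rewrite {1}e h1.
- by apply: (per w1 n1 1%N) => //=; rewrite {1}e h2.
- by apply: (per w0 h0 2%N) => //=; rewrite {1}e h2 h1.
Qed.

Lemma ratlmap_iterd n : ratlmap (d ^ n) (iter n g).
Proof. exact: ratlmap_iter. Qed.

Lemma hproj_perturb (G H : K * K) (e : R) : v (H.1 - G.1) <= e -> v (H.2 - G.2) <= e ->
  e < nrm G -> H != 0 /\ dist (hproj H) (hproj G) * nrm G <= e.
Proof.
move=> h1 h2 eG; have nH : nrm H = nrm G.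
  apply/eqP; rewrite eq_le; apply/andP; split.
    by rewrite /nrm ge_max -/(nrm G); apply/andP; split;
      [rewrite -[H.1](subrK G.1)|rewrite -[H.2](subrK G.2)]; apply: uabsD_le;
      rewrite ?(le_trans h1 (ltW eG)) ?(le_trans h2 (ltW eG)) // /nrm le_max lexx ?orbT.
  have [h|h] := leP (v G.1) (v G.2).
    have nG : nrm G = v G.2 by rewrite /nrm max_r.
    have e2 : v H.2 = v G.2 by rewrite -[H.2](subrK G.2) uabsD_eqr // -nG (le_lt_trans h2).
    by rewrite nG -e2 /nrm le_max lexx orbT.
  have nG : nrm G = v G.1 by rewrite /nrm max_l // ltW.
  have e1 : v H.1 = v G.1 by rewrite -[H.1](subrK G.1) uabsD_eqr // -nG (le_lt_trans h1).
  by rewrite nG -e1 /nrm le_max lexx.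
have e0 : 0 <= e by apply: le_trans h1; exact: uabs_ge0.
have G0 := le_lt_trans e0 eG; have H0 : H != 0 by rewrite -nrm_gt0 nH.
split=> //; rewrite chordal_hproj // -?nrm_gt0 // nH invfM mulrA divfK ?gt_eqF // ler_pdivrMr //.
have -> : det2 H G = (H.1 - G.1) * G.2 - G.1 * (H.2 - G.2) by rewrite /det2; ring.
apply: uabsB_le; rewrite uabsM; first by apply: ler_pM; rewrite ?uabs_ge0 // /nrm le_max lexx orbT.
by rewrite mulrC; apply: ler_pM; rewrite ?uabs_ge0 // /nrm le_max lexx.
Qed.

(* Perturbing the coefficients of g towards a subfield whose integers are
   totally bounded yields a finite code separating points of the pseudo-orbit. *)
Lemma pseudo_orbit (x : option K) (e : R) : 0 < e -> exists (gh : option K -> option K) xh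
    (N : nat) (code : option K -> 'I_N), [/\ forall y, dist (gh y) (g y) < e,
    dist xh x < e & forall i j, code (iter i gh xh) = code (iter j gh xh) ->
      dist (iter i gh xh) (iter j gh xh) < e].
Proof.
move=> e0; have [P [Q [A [B [[[p sp hp] [q sq hq] PQ gE] [B0 hN _]]]]]] := ratlmap_norm d0 hg.
pose cx : seq K := if x is Some t then [:: t] else [::].
(* The bound [B / 2] keeps the norm of the lift unchanged under the perturbation, and [e * B / 2]
   makes the chordal error smaller than [e]. *)
pose e' := Num.min e (Num.min (B / 2) (e * B / 2)).
have e'0 : 0 < e' by rewrite !lt_min e0 !divr_gt0 ?mulr_gt0.
have [L [[L1 LB LM LV] [hap hcode]]] := cp_approx (cx ++ p ++ q) e'0.
have L0 : L 0 by rewrite -(subrr 1); exact: LB.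
have LN (y : K) : L y -> L (- y) by move=> Ly; rewrite -sub0r; exact: LB.
have LD (y z : K) : L y -> L z -> L (y + z).
  by move=> Ly Lz; rewrite -[z]opprK; apply: LB => //; exact: LN.
have LX (y : K) n : L y -> L (y ^+ n).
  by move=> Ly; elim: n => [|n IH]; rewrite ?expr0 // exprS; exact: LM.
have hch (c : K) : exists c', L c' /\ (c \in cx ++ p ++ q -> v (c - c') < e').
  have [/hap[c' Lc' h]|h] := boolP (c \in cx ++ p ++ q); first by exists c'.
  by exists 0.
have [a ha] := choice hch.
have pert (r : {poly K}) : (size r <= d.+1)%N -> {subset (r : seq K) <= cx ++ p ++ q} ->
    exists F : K * K -> K, (forall u, L u.1 -> L u.2 -> L (F u)) /\
      forall u, v (F u - bform d r u) <= e' * nrm u ^+ d.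
  move=> sr hr; pose c (i : nat) := if (i < size r)%N then a r`_i else 0.
  exists (fun u => \sum_(i < d.+1) c i * u.1 ^+ i * u.2 ^+ (d - i)); split.
    move=> u L1u L2u; elim/big_ind: _ => //.
    move=> i _; apply: (LM _ _ (LM _ _ _ (LX _ _ L1u)) (LX _ _ L2u)).
    by rewrite /c; case: ifP => _ //; case: (ha r`_i).
  move=> u; rewrite /bform -sumrB; apply: uabs_sum_le.
    apply: mulr_ge0; first exact: ltW.
    by apply: exprn_ge0; rewrite /nrm le_max uabs_ge0.
  move=> i; rewrite -!mulrBl !uabsM -mulrA; apply: ler_pM; rewrite ?uabs_ge0 //.
  - by apply: mulr_ge0; exact: uabs_ge0.
  - rewrite /c; case: ltnP => h; last by rewrite nth_default // subrr uabs0 ltW.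
    by rewrite uabs_distC ltW //; case: (ha r`_i) => _; apply; apply: hr; rewrite mem_nth.
  have hi : (i <= d)%N by rewrite -ltnS ltn_ord.
  have nu : 0 <= nrm u by rewrite /nrm le_max uabs_ge0.
  have n1 : v u.1 <= nrm u by rewrite /nrm le_max lexx.
  have n2 : v u.2 <= nrm u by rewrite /nrm le_max lexx orbT.
  have -> : nrm u ^+ d = nrm u ^+ i * nrm u ^+ (d - i) by rewrite -exprD subnKC.
  rewrite !uabsX.
  by apply: ler_pM; rewrite ?exprn_ge0 ?uabs_ge0 //; apply: lerXn2r; rewrite ?nnegrE ?uabs_ge0.
have [||Ph [LP eP]] := pert p => //; first by move=> y yp; rewrite !mem_cat yp orbT.
have [||Qh [LQ eQ]] := pert q => //; first by move=> y yq; rewrite !mem_cat yq !orbT.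
pose gh y := hproj (Ph (hcoord y), Qh (hcoord y)).
pose xh := if x is Some t then Some (a t) else None.
pose PL (y : option K) := if y is Some t then L t else True.
have Lxh : PL xh by rewrite /xh; case: (x) => //= t; case: (ha t).
have Lgh y : PL y -> PL (gh y).
  move=> Ly; have [h1 h2] : L (hcoord y).1 /\ L (hcoord y).2 by case: y Ly.
  rewrite /gh /hproj /=; case: eqP => // _ /=; exact: (LM _ _ (LP _ h1 h2) (LV _ (LQ _ h1 h2))).
have e1 : 0 < Num.min e 1 by rewrite lt_min e0 ltr01.
have [N [code hco]] := hcode _ e1.
(* [sm] records the chart, the coordinate or its inverse, in which [co] is integral; for two points
   in the same chart the chordal distance is the distance of these integers. *)
pose sm (y : option K) := if y is Some t then v t <= 1 else false.
pose co (y : option K) : K := if y is Some t then (if v t <= 1 then t else t^-1) else 0.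
have Lco y : PL y -> L (co y).
  by case: y => //= t Lt; case: ifP => // _; exact: LV.
have co1 y : v (co y) <= 1.
  case: y => [t|] /=; last by rewrite uabs0 ler01.
  by case: (leP (v t) 1) => // t1; rewrite uabsV invf_le1 ?ltW // (lt_trans ltr01).
have hco2 y z : sm y = sm z -> dist y z = v (co y - co z).
  have inv (y' : option K) : ~~ sm y' -> inv_chart y' = Some (co y').
    case: y' => //= t; rewrite -ltNge => t1; rewrite leNgt t1 /=.
    by case: eqP t1 => // ->; rewrite uabs0 ltNge ler01.
  have [sy|sy] := boolP (sm y) => sz.
    case: y z sy sz => [s|] // [t|] //=; rewrite /co => s1; rewrite s1 => t1.
    by rewrite -t1 chordal_some_le1.
  by rewrite -dist_sigma (inv y sy) (inv z) -?sz // chordal_some_le1.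
exists gh, xh, #|{: 'I_N * bool}|, (fun y => enum_rank (code (co y), sm y)); split.
- move=> y; set u := hcoord y.
  have nd : 0 < nrm u ^+ d by apply: exprn_gt0; exact: nrm_hcoord_gt0.
  set G := (P u, Q u); have G0 : G != 0 by apply: PQ; exact: hcoord_neq0.
  have nG : 0 < nrm G by rewrite nrm_gt0.
  have BG : B * nrm u ^+ d <= nrm G by have /andP[h _] := hN y; rewrite -ler_pdivlMr.
  have eG : e' * nrm u ^+ d < nrm G.
    apply: lt_le_trans BG; rewrite ltr_pM2r //; apply: le_lt_trans (_ : B / 2 < B).
      by rewrite !ge_min lexx orbT.
    by rewrite ltr_pdivrMr // ltr_pMr // ltr1n.
  have eP' : v (Ph u - P u) <= e' * nrm u ^+ d by rewrite hp; exact: eP.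
  have eQ' : v (Qh u - Q u) <= e' * nrm u ^+ d by rewrite hq; exact: eQ.
  have := @hproj_perturb G (Ph u, Qh u) _ eP' eQ' eG.
  rewrite gE -/u -/G => -[_ h]; rewrite -(ltr_pM2r nG); apply: le_lt_trans h _.
  apply: lt_le_trans (_ : e * (B * nrm u ^+ d) <= _); last by rewrite ler_pM2l.
  rewrite mulrA ltr_pM2r //; apply: le_lt_trans (_ : e * B / 2 < _).
    by rewrite !ge_min lexx !orbT.
  by rewrite ltr_pdivrMr ?mulr_gt0 // ltr_pMr ?mulr_gt0 // ltr1n.
- have xcx t : x = Some t -> v (t - a t) < e'.
    by move=> xt; case: (ha t) => _; apply; rewrite /cx xt inE eqxx.
  move: xcx; rewrite /xh; case: (x) => [t|] h; last by rewrite chordalxx.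
  have {}h := h t erefl.
  apply: le_lt_trans (_ : v (t - a t) < _); last by apply: lt_le_trans h _; rewrite ge_min lexx.
  rewrite chordal_some uabs_distC ler_pdivrMr ?mulr_gt0 ?lt_max ?ltr01 ?orbT //.
  rewrite ler_peMr ?uabs_ge0 // mulr_ege1 ?le_max ?lexx ?orbT //.
move=> i j /enum_rank_inj[cij sij].
have Lit n : PL (iter n gh xh) by elim: n => //= n /Lgh.
rewrite hco2 //; apply: lt_le_trans (hco _ _ _ _ _ _ cij) _; rewrite ?co1 //; [exact/Lco|exact/Lco|].
by rewrite ge_min lexx.
Qed.

Lemma recur_iter k z : (0 < k)%N ->
  (forall (e : R) N, 0 < e -> exists2 m, (N <= m)%N & dist (iter m (iter k g) z) z < e) ->
  recur z.
Proof.
move=> k0 h e N e0; have [m Nm hm] := h e N e0; exists (m * k)%N; last by rewrite iterM.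
by apply: leq_trans Nm _; exact: leq_pmulr.
Qed.

(** Two ultrametric balls that meet are nested, so among the first members of a chain there is one
    that contains all of them. *)
Lemma chain_balls (Y : nat -> option K) (s : nat -> R) :
  (forall j, exists2 t, dist t (Y j) < s j & dist t (Y j.+1) < s j.+1) ->
  forall j, exists i, forall l, (l <= j)%N ->
    s l <= s i /\ forall t, dist t (Y l) < s l -> dist t (Y i) < s i.
Proof.
move=> hc; have sub i l u : s l <= s i -> dist u (Y i) < s i -> dist u (Y l) < s l ->
    forall t, dist t (Y l) < s l -> dist t (Y i) < s i.
  move=> li ui ul t tl; apply: (@chordal_lt _ _ u) => //.
  apply: (@chordal_lt _ _ (Y l)); first exact: lt_le_trans li.
  by rewrite chordalC; exact: lt_le_trans li.
elim=> [|j [i IH]].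
  by exists 0%N => l; rewrite leqn0 => /eqP ->.
have [t tj tj1] := hc j; have [_ hij] := IH j (leqnn j).
have [h|h] := leP (s j.+1) (s i).
  exists i => l; rewrite leq_eqVlt ltnS => /predU1P[->|/IH //]; split => //.
  by apply: sub h _ tj1; exact: hij.
exists j.+1 => l; rewrite leq_eqVlt ltnS => /predU1P[->|/IH[h1 h2]] //; split.
  by apply: le_trans h1 _; exact: ltW.
by move=> u /h2; apply: (sub _ _ t); [exact: ltW| |exact: hij].
Qed.

(* If the iterates do not shrink the balls around x, the images of a small ball
   are balls of radius bounded below; by finiteness of the code two of them meet,
   and the union of the resulting chain is a trap for an iterate of g. *)
Lemma noncollapse_recur x (r0 : R) (w1 w2 : option K) : 0 < r0 -> w1 != w2 ->
  (forall n z, dist z x < r0 -> iter n g z != w1) ->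
  (forall n z, dist z x < r0 -> iter n g z != w2) ->
  (forall r : R, 0 < r -> exists2 e : R, 0 < e & forall N, exists2 z, dist z x < r &
     e < dist (iter N g z) (iter N g x)) ->
  exists N, exists2 rho : R, 0 < rho & forall z, dist z (iter N g x) < rho -> recur z.
Proof.
move=> r00 w12 hw1 hw2 hnc; pose y N := iter N g x; set c0 := dist w1 w2.
have c00 : 0 < c0 by rewrite chordal_gt0.
have hgi N := ratlmap_iterd N; have dg N := expd_gt0 N.
pose R0 := Num.min r0 1; have R00 : 0 < R0 by rewrite lt_min r00 ltr01.
have R01 : R0 <= 1 by rewrite ge_min lexx orbT.
have Rr0 z : dist z x < R0 -> dist z x < r0 by rewrite lt_min => /andP[].
have [||c cn0 /andP[_ cR]] := @radius_exists R K (R0 / 2) R0.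
- by rewrite divr_gt0.
- by rewrite ltr_pdivrMr // ltr_pMr // ltr1n.
have vc0 : 0 < v c by rewrite uabs_gt0.
have lip N z : dist z x <= v c -> v c * c0 * dist (iter N g z) (y N) <= dist z x.
  move=> hz; apply: (ball_equicont (dg N) (hgi N) cn0 cR R01 _ _ (lexx c0) (ltW c00)) => //.
  - by move=> t /Rr0 /hw1.
  - by move=> t /Rr0 /hw2.
  - exact: le_lt_trans cR.
  - by rewrite chordalxx.
(* By [lip] the images of the ball of radius [r] have radius at most [c0 / 2], while [w1] or [w2] is
   at distance at least [c0] from their centre. *)
pose r := Num.min (v c) (v c * c0 * (c0 / 2)).
have vcc : 0 < v c * c0 by rewrite mulr_gt0.
have r_gt0 : 0 < r by rewrite lt_min vc0 mulr_gt0 // divr_gt0.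
have rR : r <= R0 by rewrite ge_min (ltW cR).
have r1 := le_trans rR R01.
have c0h : c0 / 2 < c0 by rewrite ltr_pdivrMr // ltr_pMr // ltr1n.
have osc N z : dist z x < r -> dist (iter N g z) (y N) <= c0 / 2.
  rewrite lt_min => /andP[h1 h2]; rewrite -(ler_pM2l vcc).
  by apply: le_trans (ltW h2); apply: lip; exact: ltW.
have hw N : exists2 w, c0 <= dist (y N) w & forall z, dist z x < r -> iter N g z != w.
  have rz z : dist z x < r -> dist z x < r0 by move=> hz; apply/Rr0/(lt_le_trans hz).
  have [h|h] := @chordal_ge _ _ (y N) w1 w2.
    by exists w1; [rewrite chordalC|move=> z /rz /hw1].
  by exists w2 => // z /rz /hw2.
pose T N := [set dist (iter N g z) (y N) | z in [set z | dist z x < r]].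
pose S N := sup (T N).
have xr : dist x x < r by rewrite chordalxx.
have hT N : has_sup (T N).
  split; first by exists (dist (iter N g x) (y N)), x.
  by exists (c0 / 2) => _ [z hz <-]; exact: osc.
have hS1 N z : dist z x < r -> dist (iter N g z) (y N) <= S N.
  by move=> hz; apply: ub_le_sup; [case: (hT N)|exists z].
have hS2 N : S N <= c0 / 2.
  by apply: ge_sup; [case: (hT N)|move=> _ [z hz <-]; exact: osc].
have [e0 e00 he0] := hnc r r_gt0.
have eS N : e0 < S N by have [z hz h] := he0 N; exact: lt_le_trans (hS1 N z hz).
(* The sharp Schwarz constant shows that the supremum [S N] is not attained; with [img2], the image
   is exactly the open ball of radius [S N]. *)
have img1 N z : dist z x < r -> dist (iter N g z) (y N) < S N.
  move=> hz; have [w wN hwN] := hw N.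
  have S0 : 0 < S N := lt_trans e00 (eS N).
  have := ball_schwarz_lip (dg N) (hgi N) r1 (ltW S0) hwN (hS1 N)
    (le_lt_trans (hS2 N) (lt_le_trans c0h wN)) hz xr.
  by rewrite mulrC => h; rewrite -(ltr_pM2r r_gt0); apply: le_lt_trans h _; rewrite ltr_pM2l.
have img2 N t : dist t (y N) < S N -> exists2 z, dist z x < r & iter N g z = t.
  move=> ht; have [w wN hwN] := hw N.
  have d_gt0 : 0 < S N - dist t (y N) by rewrite subr_gt0.
  have [_ [z hz <-]] := sup_adherent d_gt0 (hT N); rewrite -/(S N) subKr => hlt.
  apply: (ball_image (dg N) (hgi N) hwN hz _ hlt).
  by apply: lt_le_trans wN; apply: lt_trans c0h; exact: lt_le_trans (hS2 N).
have step k N t : dist t (y N) < S N -> dist (iter k g t) (y (N + k)%N) < S (N + k)%N.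
  by move=> /img2[z hz <-]; rewrite -iterD addnC; exact: img1.
have [gh [xh [C [code [hgh hxh hco]]]]] := pseudo_orbit x e00.
(* The error [e0] is smaller than all radii [S n], so the perturbed orbit never leaves the image
   balls. *)
have hyh n : dist (iter n gh xh) (y n) < S n.
  elim: n => [|n IH]; first exact: lt_trans (eS 0%N).
  apply: (@chordal_lt _ _ (g (iter n gh xh))); first exact: lt_trans (hgh _) (eS _).
  by have := step 1%N n _ IH; rewrite addn1.
have [N [M [NM hNM]]] : exists N M, (N < M)%N /\ code (iter N gh xh) = code (iter M gh xh).
  have : ~~ injectiveb (fun i : 'I_C.+1 => code (iter i gh xh)).
    by apply/negP => /injectiveP /leq_card; rewrite !card_ord ltnn.
  case/injectivePn => i [j ij e].
  have [h|h|h] := ltngtP i j; [by exists i, j|by exists j, i|].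
  by case/negP: ij; apply/eqP/val_inj.
have k0 : (0 < M - N)%N by rewrite subn_gt0.
set k := (M - N)%N in k0; have MNk : M = (N + k)%N by rewrite /k subnKC // ltnW.
have hMN : dist (iter M gh xh) (y N) < S N.
  apply: (@chordal_lt _ _ (iter N gh xh)); last exact: hyh.
  by rewrite chordalC; exact: lt_trans (hco _ _ hNM) (eS N).
pose Y j := y (N + j * k)%N; pose s j := S (N + j * k)%N.
have chain : forall j, exists i, forall l, (l <= j)%N ->
    s l <= s i /\ forall t, dist t (Y l) < s l -> dist t (Y i) < s i.
  apply: chain_balls => j; exists (iter (j * k) g (iter M gh xh)); first exact: step.
  rewrite /Y /s mulSn addnA -MNk; apply: step; exact: hyh.
pose U := range s; have hU : has_sup U.
  by split; [exists (s 0%N), 0%N|exists (c0 / 2) => _ [j _ <-]; exact: hS2].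
pose rho := sup U.
have sr j : s j <= rho by apply: ub_le_sup; [case: hU|exists j].
have rho1 : rho <= 1.
  apply: ge_sup; first by case: hU.
  move=> _ [j _ <-]; apply: le_trans (hS2 _) _; apply: le_trans (ltW c0h) _; exact: chordal_le1.
have rho0 : 0 < rho by apply: lt_le_trans (sr 0%N); exact: lt_trans (eS _).
have Y0 : Y 0%N = y N by rewrite /Y mul0n addn0.
pose G := iter k g.
(* The largest ball of an initial piece of the chain contains both [y N] and [t]. Its image lies in
   the next ball, which a later member of the chain joins to [y N] again. *)
have trap t : dist t (y N) < rho -> dist (G t) (y N) < rho.
  move=> ht; have d_gt0 : 0 < rho - dist t (y N) by rewrite subr_gt0.
  have [_ [j _ <-]] := sup_adherent d_gt0 hU; rewrite -/rho subKr => tj.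
  have s0 : 0 < s 0%N := lt_trans e00 (eS _).
  have yy i : (forall t, dist t (Y 0%N) < s 0%N -> dist t (Y i) < s i) -> dist (y N) (Y i) < s i.
    by apply; rewrite Y0 chordalxx.
  have [i hi] := chain j; have [ji _] := hi j (leqnn j); have [_ /yy h0i] := hi 0%N (leq0n j).
  have ti : dist t (Y i) < s i by apply: (@chordal_lt _ _ (y N)) => //; exact: lt_le_trans tj ji.
  have Gt : dist (G t) (Y i.+1) < s i.+1 by rewrite /Y /s mulSn [(k + _)%N]addnC addnA; exact: step.
  have [i' hi'] := chain i.+1; have [_ h1] := hi' _ (leqnn _); have [_ /yy h2] := hi' 0%N (leq0n _).
  apply: lt_le_trans (sr i'); apply: (@chordal_lt _ _ (Y i')); first exact: h1.
  by rewrite chordalC.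
have [hrec|hcon] := trap_dichotomy (dg k) (hgi k) rho0 rho1 trap.
  exists N, rho => // z hz; apply: (recur_iter k0) => e N' e0'; exact: hrec.
(* A contraction would shrink the images of a small ball around [x] below every bound, against
   [hnc]. *)
exfalso; have hl : dist (G (y N)) (y N) < rho by apply: trap; rewrite chordalxx.
pose r' := Num.max (dist (G (y N)) (y N)) (rho / 2).
have r'r : r' < rho by rewrite gt_max hl ltr_pdivrMr // ltr_pMr // ltr1n.
have [l /andP[l0 l1] hlc] := hcon r' r'r.
have r'0 : 0 <= r' by rewrite le_max chordal_ge0.
have yN : dist (y N) (y N) <= r' by rewrite chordalxx.
have inv t : dist t (y N) <= r' -> dist (G t) (y N) <= r'.
  move=> ht; apply: (@chordal_le _ _ (G (y N))); last by rewrite le_max lexx.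
  by apply: le_trans (hlc _ _ ht yN) _; apply: le_trans ht; rewrite ler_piMl ?chordal_ge0 // ltW.
have rho2 : 0 < rho / 2 by rewrite divr_gt0.
have [del del0 hdel] := ratlmap_cont x (dg N) (hgi N) rho2.
have [e1 e10 he1] := hnc del del0.
have [j hj] := exprn_small (introT andP (conj l0 l1)) e10.
have [z hz] := he1 (j * k + N)%N.
rewrite !iterD !iterM -/G -/(y N) ltNge => /negP; apply; apply: le_trans (ltW hj).
have {}hz : dist (iter N g z) (y N) <= r' by rewrite le_max (ltW (hdel _ hz)) orbT.
have hin m t : dist t (y N) <= r' -> dist (iter m G t) (y N) <= r'.
  by move=> ht; elim: m => //= m; exact: inv.
elim: j {hj} => [|j IH]; first by rewrite expr0 chordal_le1.
rewrite !iterS exprS; apply: le_trans (hlc _ _ (hin j _ hz) (hin j _ yN)) _.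
exact: ler_wpM2l.
Qed.

End Backward.

(** * Iterates that collapse a disc *)

Section Collapse.
Variables (R : realType) (K : cpField R).
Local Notation v := (@uabs R K).
Local Notation dist := (@cdist R K).
Variables (d : nat) (g : option K -> option K).
Hypotheses (d1 : (1 < d)%N) (hg : ratlmap d g).
Implicit Types (x y z w : option K).

(** Uniformity in [x] comes from [ratlmap_lower]: a generic point at distance [v c] from [x] is at
    least that far from every point of the fibre of [h x]. *)
Lemma ball_nonconstant n (r : R) : 0 < r -> (0 < n)%N -> forall h : option K -> option K, ratlmap n h ->
  exists2 e : R, 0 < e & forall x, exists2 z, dist z x < r & e <= dist (h z) (h x).
Proof.
move=> r0 n0 h hh; have [C C0 hlow] := ratlmap_lower n0 hh.
have m0 : 0 < Num.min r 1 by rewrite lt_min r0 ltr01.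
have [||c c0 /andP[_ cr]] := @radius_exists R K (Num.min r 1 / 2) (Num.min r 1).
- by rewrite divr_gt0.
- by rewrite ltr_pdivrMr // ltr_pMr // ltr1n.
move: cr; rewrite lt_min => /andP[cr c1]; have vc0 : 0 < v c by rewrite uabs_gt0.
exists (C * v c ^+ n); first by rewrite mulr_gt0 // exprn_gt0.
move=> x; have [s ss [_ hs]] := hlow (h x); have [z zx hz] := chordal_generic x s c0 c1.
exists z; first by rewrite zx.
apply: le_trans (hs z); apply: ler_wpM2l; first exact: ltW.
rewrite -ss; apply: prod_ge_exp; first exact: ltW.
by move=> a /hz ->; rewrite le_max lexx.
Qed.

Variables (x : option K) (r : R) (k m : nat).
Hypotheses (r_gt0 : 0 < r) (k0 : (0 < k)%N).

Definition osc N (e : R) := forall z, dist z x < r -> dist (iter N g z) (iter N g x) < e.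

Lemma osc_le N e e' : e <= e' -> osc N e -> osc N e'.
Proof. by move=> ee h z /h hz; exact: lt_le_trans ee. Qed.

(** Used to make sure that a sufficiently small oscillation occurs only at late times. *)
Lemma osc_pos N0 : exists2 e : R, 0 < e & forall N, (N < N0)%N -> ~ osc N e.
Proof.
elim: N0 => [|N0 [e e0 IH]]; first by exists 1.
have [e' e'0 he'] := ball_nonconstant r_gt0 (expd_gt0 d1 N0) (ratlmap_iterd hg N0).
exists (Num.min e e'); first by rewrite lt_min e0.
move=> N; rewrite ltnS leq_eqVlt => /predU1P[->|/IH h] ho.
  have [z hz] := he' x; rewrite leNgt => /negP; apply.
  by apply: lt_le_trans (ho z hz) _; rewrite ge_min lexx orbT.
by apply: h; apply: osc_le ho; rewrite ge_min lexx.
Qed.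

(** If the oscillation at time N were at least [e], the image would contain a disc of fixed radius
    around [iter N g x], by [ball_image], and [iter k g] oscillates on it by a fixed amount. *)
Lemma osc_backward (w1 w2 : option K) (e : R) : w1 != w2 ->
  (forall n z, dist z x < r -> iter n g z != w1) ->
  (forall n z, dist z x < r -> iter n g z != w2) -> 0 < e ->
  exists2 e' : R, 0 < e' & forall N, osc (N + k) e' -> osc N e.
Proof.
move=> w12 hw1 hw2 e0; set c0 := dist w1 w2; have c00 : 0 < c0 by rewrite chordal_gt0.
have m0 : 0 < Num.min e c0 by rewrite lt_min e0.
have [e' e'0 he'] := ball_nonconstant m0 (expd_gt0 d1 k) (ratlmap_iterd hg k).
exists e' => // N ho z hz; rewrite ltNge; apply/negP => hez.
have [w wN hwN] : exists2 w, c0 <= dist (iter N g x) w & forall z, dist z x < r -> iter N g z != w.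
  have [h|h] := @chordal_ge _ _ (iter N g x) w1 w2.
    by exists w1; [rewrite chordalC|exact: hw1].
  by exists w2 => //; exact: hw2.
have [t ht] := he' (iter N g x); rewrite leNgt => /negP; apply.
move: ht; rewrite lt_min => /andP[t1 t2].
have [y yx <-] := ball_image (expd_gt0 d1 N) (ratlmap_iterd hg N) hwN hz
  (lt_le_trans t2 wN) (lt_le_trans t1 hez).
by rewrite -!iterD addnC; exact: ho.
Qed.

Variables (X Y : set (option K)) (a b : option K).
Hypotheses (hX : open_affinoid v X) (hY : open_affinoid v Y) (Xa : X a) (Yb : Y b).
Hypotheses (rX : forall z, dist z x < r -> X z) (rY : forall z, dist z x < r -> Y z).
Hypothesis oX : forall M, exists2 ws : seq (option K), uniq ws /\ size ws = M &
  forall n z w, X z -> w \in ws -> iter n g z != w.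
Hypothesis oY : forall M, exists2 ws : seq (option K), uniq ws /\ size ws = M &
  forall n z w, Y z -> w \in ws -> iter n g z != w.
Hypothesis hab : iter m g a = iter (m + k) g b.

(** The displacement of [iter N g x] under [iter k g] is small, and the lower bound by the product
    over the fixed points turns this into closeness to one of them. *)
Lemma osc_near_fixed (s : seq (option K)) (C1 e : R) : 0 < C1 -> 0 < e ->
  (forall z, C1 * \prod_(c <- s) dist z c <= dist (iter k g z) z) ->
  exists2 e1 : R, 0 < e1 & forall N, (m <= N)%N -> osc N e1 ->
    dist (iter (N + k) g x) (iter N g x) < e /\ exists2 c, c \in s & dist (iter N g x) c < e.
Proof.
move=> C10 e0 hs; pose eta := Num.min e (C1 * e ^+ size s).
have eta0 : 0 < eta by rewrite lt_min e0 mulr_gt0 // exprn_gt0.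
have [MX hMX] := vitali hX Xa r_gt0 rX eta0; have [ws [u sw] hw] := oX MX.
have [eX eX0 {}hMX] := hMX ws u sw.
have [MY hMY] := vitali hY Yb r_gt0 rY eta0; have [ws' [u' sw'] hw'] := oY MY.
have [eY eY0 {}hMY] := hMY ws' u' sw'.
have [L L0 hL] := ratlmap_lipschitz (expd_gt0 d1 k) (ratlmap_iterd hg k).
(* Dividing by the Lipschitz constant of [iter k g] carries a small oscillation at time N over to
   time N + k. *)
exists (Num.min eX (eY / L)); first by rewrite lt_min eX0 divr_gt0.
move=> N mN ho; have hx : dist (iter N g x) (iter N g a) < eta.
  apply: hMX (expd_gt0 d1 N) (ratlmap_iterd hg N) _ _; first by move=> z w; exact: hw.
  by move=> z /ho; rewrite lt_min => /andP[].
have hy : dist (iter (N + k) g x) (iter (N + k) g b) < eta.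
  apply: hMY (expd_gt0 d1 _) (ratlmap_iterd hg _) _ _; first by move=> z w; exact: hw'.
  move=> z /ho; rewrite lt_min => /andP[_ h]; rewrite addnC !iterD.
  by apply: le_lt_trans (hL _ _) _; rewrite mulrC -ltr_pdivlMr.
have eab : iter N g a = iter (N + k) g b.
  by rewrite -(subnK mN) iterD hab -iterD addnA.
have hG : dist (iter (N + k) g x) (iter N g x) < eta.
  by apply: (@chordal_lt _ _ (iter (N + k) g b)) => //; rewrite -eab chordalC.
split; first by apply: lt_le_trans hG _; rewrite ge_min lexx.
apply: contrapT => hno; have hge c : c \in s -> e <= dist (iter N g x) c.
  by move=> cs; rewrite leNgt; apply/negP => h; apply: hno; exists c.
have := hs (iter N g x); rewrite -iterD addnC leNgt => /negP; apply.
apply: lt_le_trans hG _; apply: le_trans (_ : C1 * e ^+ size s <= _).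
  by rewrite ge_min lexx orbT.
by apply: ler_wpM2l; [exact: ltW|apply: prod_ge_exp => //; exact: ltW].
Qed.

(** The repelling case is excluded by descent: an expanding map cannot have had a larger oscillation
    k steps earlier, and the earlier iterate is near the same fixed point. The time thus drops below
    m + k, where the oscillation is not that small. *)
Lemma collapse_fixed : (forall e : R, 0 < e -> exists N, osc N e) ->
  (exists N, exists2 rho : R, 0 < rho & forall z, dist z (iter N g x) < rho -> recur g z) \/
  exists N c (rho : R), [/\ 0 < rho, iter k g c = c, dist (iter N g x) c < rho &
    exists2 l : R, 0 <= l < 1 & forall z, dist z c <= rho -> dist (iter k g z) c <= l * dist z c].
Proof.
move=> hcol; have hG := ratlmap_iterd hg k; have dk := expd_gt0 d1 k.
have dk1 : (1 < d ^ k)%N by rewrite -(exp1n k) ltn_exp2r.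
have [s ss [C1 [C2 [C10 hfix hs]]]] := ratlmap_fix dk1 hG.
have {}hs z : C1 * \prod_(c <- s) dist z c <= dist (iter k g z) z by case/andP: (hs z).
have [sep sep0 hsep] : exists2 sep : R, 0 < sep &
    forall c c', c \in s -> c' \in s -> dist c c' < sep -> c = c'.
  pose F (p : option K * option K) := if p.1 == p.2 then 1 else dist p.1 p.2.
  have [|sep sep0 h] := @seq_pos_lb R _ [seq (c, c') | c <- s, c' <- s] F.
    by move=> p _; rewrite /F; case: eqP => [_|/eqP]; rewrite ?ltr01 ?chordal_gt0.
  exists sep => // c c' cs c's; have := h (c, c') (allpairs_f _ cs c's).
  by rewrite /F /=; case: eqP => // _ h1; rewrite ltNge h1.
have hdic c : exists rho : R, c \in s -> 0 < rho <= 1 /\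
    ((forall z, dist z c < rho -> dist (iter k g z) c <= dist z c) \/
     (forall y z, dist y c < rho -> dist z c < rho -> dist y z <= dist (iter k g y) (iter k g z))).
  have [cs|cs] := boolP (c \in s); last by exists 0.
  by have [rho h1 h2] := fixed_dichotomy dk hG (hfix c cs); exists rho.
have [rho hrho] := choice hdic.
have [|rs rs0 hrs] := @seq_pos_lb R _ s rho.
  by move=> c /hrho[/andP[]].
(* Closeness below [sep] identifies the fixed points met at times M and M - k; the bound [rs / 2]
   stays inside the discs where the local dichotomy holds. *)
pose e := Num.min (rs / 2) sep; have e0 : 0 < e by rewrite lt_min divr_gt0.
have rs2 : rs / 2 < rs by rewrite ltr_pdivrMr // ltr_pMr // ltr1n.
have ers : e < rs by rewrite gt_min rs2.
have [e1 e10 he1] := osc_near_fixed C10 e0 hs.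
have [ws [uw sw] hw] := oX 2.
have [e' e'0 he'] : exists2 e' : R, 0 < e' & forall N, osc (N + k) e' -> osc N (Num.min e1 rs).
  case: ws uw sw hw => [|w1 [|w2 [|]]] //= /andP[h _] _ hw.
  apply: (@osc_backward w1 w2); rewrite ?lt_min ?e10 //; first by rewrite inE in h.
  - by move=> n z /rX Xz; apply: hw => //; rewrite inE eqxx.
  - by move=> n z /rX Xz; apply: hw => //; rewrite !inE eqxx orbT.
(* An oscillation below [ep] forces the time to be at least m + k, so that k steps can be undone. *)
have [ep ep0 hep] := osc_pos (m + k).
pose eps := Num.min e1 (Num.min e' ep).
have eps0 : 0 < eps by rewrite !lt_min e10 e'0.
have [N oN] := hcol eps eps0.
have big M : osc M eps -> (m + k <= M)%N.
  move=> oM; rewrite leqNgt; apply/negP => /hep; apply; apply: osc_le oM.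
  by rewrite !ge_min lexx !orbT.
have [mN cl] : (m <= N)%N /\ exists2 c, c \in s & dist (iter N g x) c < e.
  have mN : (m <= N)%N by apply: leq_trans (big N oN); exact: leq_addr.
  split => //; case: (he1 N mN) => //; apply: osc_le oN; by rewrite ge_min lexx.
have [c cs Nc] := cl; have [/andP[rho0 rho1] hd] := hrho c cs.
have rsr := hrs c cs; have rs1 := le_trans rsr rho1.
case: hd => [hnon|hexp]; last first.
  exfalso; have : forall M, (m <= M)%N -> osc M eps -> dist (iter M g x) c < e -> False.
    elim/ltn_ind => M IH mM oM Mc; have kM := big M oM.
    have mMk : (m <= M - k)%N by rewrite leq_subRL ?(leq_trans _ kM) ?leq_addl // addnC.
    have ME : (M - k + k)%N = M by rewrite subnK // (leq_trans _ kM) ?leq_addl.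
    have o1 : osc (M - k) (Num.min e1 rs).
      by apply: he'; rewrite ME; apply: osc_le oM; rewrite !ge_min lexx orbT.
    have [hc [c' c's h']] : dist (iter M g x) (iter (M - k) g x) < e /\
        exists2 c, c \in s & dist (iter (M - k) g x) c < e.
      by rewrite -{1}ME; apply: he1 => //; apply: osc_le o1; rewrite ge_min lexx.
    have cc' : c = c'.
      apply: hsep => //; apply: lt_le_trans (_ : e <= _); last by rewrite ge_min lexx orbT.
      apply: (@chordal_lt _ _ (iter M g x)); first by rewrite chordalC.
      exact: (@chordal_lt _ _ (iter (M - k) g x)).
    rewrite -cc' in h'; apply: (IH (M - k)%N) => //.
      by rewrite -{2}ME -[X in (X < _)%N]addn0 ltn_add2l.
    have ME' t : iter M g t = iter k g (iter (M - k) g t) by rewrite -iterD addnC ME.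
    move=> z hz; apply: le_lt_trans (oM z hz); rewrite !ME'.
    have hxc : dist (iter (M - k) g x) c < rs by exact: lt_trans ers.
    apply: hexp; last exact: lt_le_trans rsr.
    apply: lt_le_trans rsr; apply: (@chordal_lt _ _ (iter (M - k) g x)) => //.
    by apply: lt_le_trans (o1 z hz) _; rewrite ge_min lexx orbT.
  by move=> /(_ N mN oN); apply.
have trap z : dist z c < rs -> dist (iter k g z) c < rs.
  by move=> hz; apply: le_lt_trans (hz); apply: hnon; exact: lt_le_trans rsr.
have [hrec|hcon] := trap_dichotomy dk hG rs0 rs1 trap; [left|right].
  exists N, rs => // z hz; apply: (recur_iter k0) => ep' N' ep'0; apply: hrec => //.
  by apply: (@chordal_lt _ _ (iter N g x)) => //; exact: lt_trans ers.
have [l l01 hl] := hcon _ rs2; exists N, c, (rs / 2); split; first by rewrite divr_gt0.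
- exact: hfix.
- by apply: lt_le_trans Nc _; rewrite ge_min lexx.
exists l => // z hz; rewrite -{1}(hfix c cs); apply: hl => //.
by rewrite chordalxx divr_ge0 // ltW.
Qed.

End Collapse.

(** * Fatou components *)

Section Dynamics.
Variables (R : realType) (K : cpField R).
Local Notation v := (@uabs R K).
Local Notation dist := (@cdist R K).
Variable f : {fraction {poly K}}.
Hypothesis hf : (2 <= rdeg f)%N.
Local Notation g := (@reval K f).
Local Notation d := (rdeg f).
Implicit Types (x y z w : option K) (X : set (option K)).

(** A common zero of the two forms is excluded at finite points by coprimality and at infinity
    because one of the two polynomials has degree [d]. *)
Lemma ratlmap_reval : ratlmap d g.
Proof.
have sn : (size (rnum f) <= d.+1)%N.
  by apply: leq_trans (leqSpred _) _; rewrite ltnS leq_maxl.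
have sd : (size (rden f) <= d.+1)%N.
  by apply: leq_trans (leqSpred _) _; rewrite ltnS leq_maxr.
have top : ((rnum f)`_d != 0) || ((rden f)`_d != 0).
  rewrite /d; case: leqP => h.
    by apply/orP; right; rewrite -lead_coefE lead_coef_eq0 rden_neq0.
  apply/orP; left; rewrite -lead_coefE lead_coef_eq0 -size_poly_eq0.
  by case: (size (rnum f)) h.
exists (bform d (rnum f)), (bform d (rden f)); split; [by exists (rnum f)|by exists (rden f)| |].
  case=> a b ab; apply/negP; rewrite xpair_eqE; have [b0|b0] := eqVneq b 0.
    rewrite b0 xpair_eqE eqxx andbT in ab; rewrite b0 !bform_inf !mulf_eq0 !expf_eq0 (negPf ab) !andbF !orbF.
    by case/andP => /eqP h1 /eqP h2; move: top; rewrite h1 h2 eqxx.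
  rewrite !bform_fin // !mulf_eq0 !expf_eq0 (negPf b0) !andbF /= => /andP[h1 h2].
  have := coprimep_rnum_rden f; rewrite /coprimep.
  case/(@Bezout_eq1_coprimepP K); move=> [u1 u2] /= /(congr1 (fun p => p.[a / b])).
  rewrite !hornerE (eqP h1) (eqP h2) !mulr0 addr0 => /esym/eqP; by rewrite oner_eq0.
case=> [z|]; rewrite /hproj /=.
  by rewrite !bform_fin ?oner_eq0 // expr1n !mul1r divr1.
by rewrite !bform_inf expr1n !mulr1.
Qed.

Let hg := ratlmap_reval.
Let d0 : (0 < d)%N := ltnW hf.
Let dg n := expd_gt0 hf n.
Let hgi n : ratlmap (d ^ n) (iter n g) := ratlmap_iterd hg n.

Lemma nbhsP x X : chordal_nbhs v x X <-> exists2 e : R, 0 < e & forall y, dist y x < e -> X y.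
Proof.
split=> -[e e0 h]; exists e => // y hy; apply: h; first by rewrite /= -cdistE chordalC.
by rewrite chordalC cdistE.
Qed.

Lemma cvg0P (u : nat -> R) : (forall n, 0 <= u n) ->
  (u @ \oo --> (0 : R)) <-> forall e : R, 0 < e -> exists N, forall n, (N <= n)%N -> u n < e.
Proof.
move=> u0; split=> [/cvgrPdist_lt h e e0|h].
  have [N _ hN] := h e e0; exists N => n Nn; have := hN n Nn.
  by rewrite /= sub0r normrN ger0_norm.
apply/cvgrPdist_lt => e e0; have [N hN] := h e e0; exists N => // n /= Nn.
by rewrite sub0r normrN ger0_norm ?hN.
Qed.

Lemma recurrentP x : recurrent v f x <-> recur g x.
Proof.
split=> [[s /cvgnyPge hs]|h].
  rewrite /chordal_cvg; under eq_fun do rewrite -cdistE.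
  move=> /cvg0P hc e N e0; have [j|N' hN'] := hc _ e e0; first exact: chordal_ge0.
  have [N'' _ hN''] := hs N; exists (s (maxn N' N'')).
    by apply: hN''; rewrite /= leq_maxr.
  by apply: hN'; rewrite leq_maxl.
have hch n : exists m, (n <= m)%N /\ dist (iter m g x) x < n.+1%:R^-1.
  by have [|m h1 h2] := h n.+1%:R^-1 n; [rewrite invr_gt0 ltr0Sn|exists m].
have [s hs] := choice hch; exists s.
  apply/cvgnyPge => A; exists A => // n /= An; apply: leq_trans An _; by case: (hs n).
rewrite /chordal_cvg; under eq_fun do rewrite -cdistE.
apply/cvg0P => [n|e e0]; first exact: chordal_ge0.
have [N hN] : exists N, N.+1%:R^-1 < e.
  have e1 : 0 <= e^-1 by rewrite invr_ge0 ltW.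
  exists (Num.bound e^-1); rewrite invf_plt ?posrE ?ltr0Sn //.
  by apply: lt_trans (archi_boundP e1) _; rewrite ltr_nat.
exists N => n Nn; have [_ h1] := hs n; apply: lt_trans h1 _; apply: le_lt_trans hN.
by rewrite lef_pV2 ?posrE ?ltr0Sn // ler_nat ltnS.
Qed.

Lemma orbitP X w : forward_orbit f X w <-> exists n y, X y /\ iter n g y = w.
Proof.
split=> [[n _ [y Xy <-]]|[n [y [Xy <-]]]]; first by exists n, y.
by exists n => //; exists y.
Qed.

(** Preimages under [iter N g] of three points omitted by [X] are distinct and omitted by [X']. *)
Lemma omits_pull N X X' : (forall y, X' y -> X (iter N g y)) ->
  omits_three (forward_orbit f X) -> omits_three (forward_orbit f X').
Proof.
move=> hX [a [b [c [[ab bc ac] [Xa Xb Xc]]]]].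
have surj u : exists u', iter N g u' = u by exact: ratlmap_surj (dg N) (hgi N).
have [a' ha] := surj a; have [b' hb] := surj b; have [c' hc] := surj c.
have pull u u' : iter N g u' = u -> ~ forward_orbit f X u -> ~ forward_orbit f X' u'.
  move=> uu' nu /orbitP[n [y [X'y yu]]]; apply: nu; apply/orbitP.
  exists n, (iter N g y); split; first exact: hX.
  by rewrite -iterD addnC iterD yu.
have ne (s t s' t' : option K) : iter N g s' = s -> iter N g t' = t -> s != t -> s' != t'.
  by move=> <- <-; apply: contraNneq => ->.
exists a', b', c'; split; split.
- exact: ne ha hb ab.
- exact: ne hb hc bc.
- exact: ne ha hc ac.
- exact: pull ha Xa.
- exact: pull hb Xb.
- exact: pull hc Xc.
Qed.

Lemma omits_sub X X' : X' `<=` X ->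
  omits_three (forward_orbit f X) -> omits_three (forward_orbit f X').
Proof. by move=> XX; apply: (@omits_pull 0). Qed.

Lemma FatouP x : Fatou v f x <-> exists2 e : R, 0 < e &
  omits_three (forward_orbit f [set y | dist y x < e]).
Proof.
split=> [[X /nbhsP[e e0 hX] oX]|[e e0 h]]; first by exists e => //; exact: omits_sub oX.
by exists [set y | dist y x < e] => //; apply/nbhsP; exists e.
Qed.

Lemma iter_cont N x (e : R) : 0 < e -> exists2 del : R, 0 < del &
  forall y, dist y x < del -> dist (iter N g y) (iter N g x) < e.
Proof. exact: ratlmap_cont (dg N) (hgi N). Qed.

Lemma Fatou_backward N x : Fatou v f (iter N g x) -> Fatou v f x.
Proof.
move=> /FatouP[e e0 h]; have [del del0 hdel] := iter_cont N x e0.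
by apply/FatouP; exists del => //; apply: (@omits_pull N) h => y; exact: hdel.
Qed.

Lemma Fatou_ball x (e : R) y : omits_three (forward_orbit f [set y | dist y x < e]) ->
  dist y x < e -> Fatou v f y.
Proof.
move=> h yx; apply/FatouP; exists e; first by apply: le_lt_trans yx; exact: chordal_ge0.
by apply: omits_sub h => z /= zy; exact: (@chordal_lt _ _ y).
Qed.

Lemma orbit_omits X M : omits_three (forward_orbit f X) ->
  exists2 ws : seq (option K), uniq ws /\ size ws = M &
    forall n z w, X z -> w \in ws -> iter n g z != w.
Proof.
move=> [a [b [c [h1 h2]]]].
have [|| ws hws hw] := @backward_infinite _ _ _ _ hf hg (~` forward_orbit f X) _ _ M.
- move=> y hy /orbitP[n [z [Xz zy]]]; apply: hy; apply/orbitP; exists n.+1, z.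
  by rewrite iterS zy.
- by exists a, b, c.
exists ws => // n z w Xz /hw nw; apply/eqP => zw; apply: nw; apply/orbitP.
by exists n, z.
Qed.

Lemma quasi_Fatou x : backward_orbit f (quasi_periodicity_domain v f) x -> Fatou v f x.
Proof.
move=> [N _ /= /nbhsP[e e0 he]]; apply: (@Fatou_backward N); apply/FatouP; exists e => //.
have [a [b [c [h1 [na nb nc]]]]] := three_nonrecur hf hg; exists a, b, c; split => //.
have rec w : forward_orbit f [set y | dist y (riter f N x) < e] w -> recur g w.
  move=> /orbitP[n [y [/he /recurrentP hy <-]]]; elim: n => // n IH.
  by apply: (recur_image hf hg).
by split=> /rec.
Qed.

Lemma iter_lip k : exists2 L : R, 0 < L & forall j, (j < k)%N -> forall y z,
  dist (iter j g y) (iter j g z) <= L * dist y z.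
Proof.
elim: k => [|k [L L0 IH]]; first by exists 1.
have [M M0 hM] := ratlmap_lipschitz (dg k) (hgi k); exists (Num.max L M); first by rewrite lt_max L0.
move=> j; rewrite ltnS leq_eqVlt => /predU1P[->|jk] y z.
  by apply: le_trans (hM y z) _; apply: ler_wpM2r; [exact: chordal_ge0|rewrite le_max lexx orbT].
by apply: le_trans (IH j jk y z) _; apply: ler_wpM2r; [exact: chordal_ge0|rewrite le_max lexx].
Qed.

(** An attracting periodic point described by the metric alone; [k] may be a proper multiple of its
    period. *)
Definition contracting k z (del l : R) :=
  [/\ (0 < k)%N, iter k g z = z, 0 < del, 0 <= l < 1 &
     forall y, dist y z < del -> dist (iter k g y) z <= l * dist y z].

Lemma contracting_basin k z del l y : contracting k z del l -> dist y z < del -> basin v f z y.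
Proof.
move=> [k0 kz del0 /andP[l0 l1] hc] yz.
have hq q : dist (iter (q * k) g y) z <= l ^+ q /\ dist (iter (q * k) g y) z < del.
  elim: q => [|q [IH1 IH2]]; first by rewrite mul0n expr0 chordal_le1.
  rewrite mulSn iterD; have h := hc _ IH2; split.
    by apply: le_trans h _; rewrite exprS; exact: ler_wpM2l.
  by apply: le_lt_trans h _; apply: le_lt_trans IH2; rewrite ler_piMl ?chordal_ge0 // ltW.
have zq q : iter (q * k) g z = z by elim: q => // q IH; rewrite mulSn iterD IH.
rewrite /basin /=; under eq_fun do rewrite -cdistE.
apply/cvg0P => [n|e e0]; first exact: chordal_ge0.
have [L L0 hL] := iter_lip k.
have [q hq'] : exists q, l ^+ q < e / L.
  by apply: exprn_small; rewrite ?l0 // divr_gt0.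
exists (q * k)%N => n hn; rewrite /riter {1 2}(divn_eq n k) addnC !iterD.
apply: le_lt_trans (hL _ (ltn_pmod _ k0) _ _) _; rewrite zq mulrC -ltr_pdivlMr //.
apply: le_lt_trans hq'; apply: le_trans (proj1 (hq _)) _.
by apply: ler_wiXn2l => //; [exact: ltW|rewrite leq_divRL].
Qed.

(** If the multiplier at the primitive period had norm at least 1, the iterate would not decrease
    distances to [z] nearby, and neither would its power [iter k g]. *)
Lemma contracting_attracting k z del l : contracting k z del l -> attracting v f z.
Proof.
move=> [k0 kz del0 /andP[l0 l1] hc].
have hex : exists n, (0 < n)%N && (iter n g z == z) by exists k; rewrite k0 kz eqxx.
case: (ex_minnP hex) => n /andP[n0 /eqP nz] hmin.
have zq q : iter (q * n) g z = z by elim: q => // q IH; rewrite mulSn iterD IH.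
have kn : k = (k %/ n * n)%N.
  rewrite {1}(divn_eq k n) -[RHS]addn0; congr (_ + _)%N; apply/eqP.
  rewrite eqn0Ngt; apply/negP => m0; have := hmin (k %% n)%N; rewrite m0 /=.
  have -> : iter (k %% n) g z = z by rewrite -{2}kz {2}(divn_eq k n) addnC iterD zq.
  by rewrite eqxx => /(_ isT); rewrite leqNgt ltn_pmod.
exists n; split; first split => //.
  by move=> m /andP[m0 mn] mz; have := hmin m; rewrite m0 /= leqNgt mn => /(_ _)/negP; apply; apply/eqP.
have [lam hlam] := multiplier_exists (dg n) (hgi n) nz; exists lam => //.
rewrite ltNge; apply/negP => lam1.
have [e e0 he] := multiplier_near nz hlam.
have {}he y : dist y z < e -> dist y z <= dist (iter n g y) z by move=> /he[_]; apply.
have [e' e'0 he'] : exists2 e' : R, 0 < e' & forall q, (q <= k %/ n)%N -> forall y,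
    dist y z < e' -> dist (iter (q * n) g y) z < e.
  elim: (k %/ n)%N => [|q [e' e'0 IH]].
    by exists e => // q; rewrite leqn0 => /eqP ->.
  have [e2 e20 h2] := iter_cont (q.+1 * n) z e0; rewrite zq in h2.
  exists (Num.min e' e2); first by rewrite lt_min e'0.
  move=> q'; rewrite leq_eqVlt ltnS => /predU1P[->|q'q] y; rewrite lt_min => /andP[y1 y2].
    exact: h2.
  exact: IH.
have m0 : 0 < Num.min e' del by rewrite lt_min e'0.
have [y yz] := near_dist z m0; rewrite lt_min => /andP[y1 y2].
have D0 : 0 < dist y z by rewrite chordal_gt0.
have := hc y y2; rewrite kn leNgt => /negP; apply.
apply: lt_le_trans (_ : dist y z <= _); first by rewrite gtr_pMl.
have : forall q, (q <= k %/ n)%N -> dist y z <= dist (iter (q * n) g y) z.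
  elim=> [|q IH] hq //; rewrite mulSn iterD; apply: le_trans (IH (ltnW hq)) _.
  by apply: he; apply: he' => //; exact: ltnW.
exact.
Qed.

Lemma attracting_contracting z : attracting v f z -> exists k del l, contracting k z del l.
Proof.
move=> [n [[n0 nz _] [lam hlam lam1]]].
have [e e0 he] := multiplier_near nz hlam.
exists n, e, (Num.max (v lam) (1 / 2)); split => //.
  rewrite le_max uabs_ge0 gt_max lam1 /=.
  by rewrite ltr_pdivrMr // mul1r ltr1n.
by move=> y /he[h _]; exact: h.
Qed.

Lemma attracting_domain_near k z del l : contracting k z del l ->
  exists2 e : R, 0 < e & forall y, dist y z < e -> attracting_domain v f y.
Proof.
move=> hc; have zat := contracting_attracting hc; have del0 : 0 < del by case: hc.
have [c c0 [ce [hA _]]] := small_affinoid z del0.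
exists (v c); first by rewrite uabs_gt0.
move=> y yz; exists z => //; exists [set y | dist y z < v c] => //; split => //.
  by move=> t /= tz; apply: (contracting_basin hc); exact: lt_trans ce.
by rewrite /= chordalxx uabs_gt0.
Qed.

Lemma attracted_domain k z del l N x : contracting k z del l -> dist (iter N g x) z < del ->
  backward_orbit f (attracting_domain v f) x.
Proof.
move=> hc hx; have [e e0 he] := attracting_domain_near hc.
have := contracting_basin hc hx; rewrite /basin /=; under eq_fun do rewrite -cdistE.
move=> /cvg0P h; have [n|M hM] := h _ e e0; first exact: chordal_ge0.
have [k0 kz _ _ _] := hc; have zq q : iter (q * k) g z = z by elim: q => // q IH; rewrite mulSn iterD IH.
exists (M * k + N)%N => //=; apply: he.
have := hM (M * k)%N; rewrite leq_pmulr // => /(_ isT).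
by rewrite /riter zq -iterD.
Qed.

Lemma domain_attracted x : backward_orbit f (attracting_domain v f) x ->
  exists2 z, attracting v f z & forall e : R, 0 < e -> exists N, dist (iter N g x) z < e.
Proof.
move=> [N _ [z zat [X [_ Xb _] Xx]]]; exists z => // e e0.
have [k [del [l [k0 kz _ _ _]]]] := attracting_contracting zat.
have zq q : iter (q * k) g z = z by elim: q => // q IH; rewrite mulSn iterD IH.
have := Xb _ Xx; rewrite /basin /=; under eq_fun do rewrite -cdistE.
move=> /cvg0P h; have [n|M hM] := h _ e e0; first exact: chordal_ge0.
exists (M * k + N)%N; have := hM (M * k)%N; rewrite leq_pmulr // => /(_ isT).
by rewrite /riter zq -iterD.
Qed.

(** The orbit of a small disc stays at distance less than 1 from the cycle, while there are three
    points at distance 1 from all of the cycle. *)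
Lemma contracting_omits k z del l : contracting k z del l ->
  exists2 e : R, 0 < e <= del & omits_three (forward_orbit f [set y | dist y z < e]).
Proof.
move=> hc; have [k0 kz del0 /andP[l0 l1] hcon] := hc.
have [L L0 hL] := iter_lip k.
have [a [b [c [h1 h2]]]] := generic_three (mkseq (fun j => iter j g z) k).
pose e := Num.min del L^-1; have e0 : 0 < e by rewrite lt_min del0 invr_gt0.
exists e; first by rewrite e0 ge_min lexx.
have hq q y : dist y z < e -> dist (iter (q * k) g y) z < e.
  move=> yz; elim: q => [|q IH] //; rewrite mulSn iterD; apply: le_lt_trans (IH).
  have hlt : dist (iter (q * k) g y) z < del by apply: lt_le_trans IH _; rewrite ge_min lexx.
  by apply: le_trans (hcon _ hlt) _; rewrite ler_piMl ?chordal_ge0 // ltW.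
have far w : forward_orbit f [set y | dist y z < e] w ->
    exists2 t, t \in mkseq (fun j => iter j g z) k & dist w t < 1.
  move=> /orbitP[n [y [/= yz <-]]]; exists (iter (n %% k) g z).
    by apply/mapP; exists (n %% k)%N; rewrite ?mem_iota ?ltn_pmod.
  rewrite {1}(divn_eq n k) addnC iterD; apply: le_lt_trans (hL _ (ltn_pmod _ k0) _ _) _.
  rewrite mulrC -ltr_pdivlMr // div1r; apply: lt_le_trans (hq _ _ yz) _.
  by rewrite ge_min lexx orbT.
have nf w : w \in [:: a; b; c] -> ~ forward_orbit f [set y | dist y z < e] w.
  by move=> wl /far[t tl]; rewrite h2 // ltxx.
by exists a, b, c; split => //; split; apply: nf; rewrite !inE eqxx ?orbT.
Qed.

Lemma attracted_Fatou x : backward_orbit f (attracting_domain v f) x -> Fatou v f x.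
Proof.
move=> /domain_attracted[z zat hz]; have [k [del [l hc]]] := attracting_contracting zat.
have [e /andP[e0 _] ho] := contracting_omits hc.
have [N hN] := hz e e0; apply: (@Fatou_backward N); exact: Fatou_ball ho hN.
Qed.

Lemma attracted_quasi_disjoint :
  backward_orbit f (attracting_domain v f) `&` backward_orbit f (quasi_periodicity_domain v f) = set0.
Proof.
rewrite -subset0 => x [/domain_attracted[z zat hz] [m _ /= /nbhsP[e e0 he]]].
have [k [del [l hc]]] := attracting_contracting zat.
have [k0 kz del0 /andP[l0 l1] hcon] := hc.
have del2 : 0 < del / 2 by rewrite divr_gt0.
have hhalf : del / 2 < del by rewrite ltr_pdivrMr // ltr_pMr // ltr1n.
have [N hN] := hz _ del2; set u := riter f m x in he.
have zq q : iter (q * k) g z = z by elim: q => // q IH; rewrite mulSn iterD IH.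
have [M hM] : exists M, dist (iter M g u) z < del.
  have := contracting_basin hc (lt_trans hN hhalf); rewrite /basin /=; under eq_fun do rewrite -cdistE.
  move=> /cvg0P h; have [n|Q hQ] := h _ del del0; first exact: chordal_ge0.
  have mk : (m <= (Q + m) * k + N)%N.
    by rewrite (leq_trans _ (leq_addr _ _)) // (leq_trans (leq_addl Q m)) // leq_pmulr.
  exists ((Q + m) * k + N - m)%N; rewrite /u /riter -iterD subnK // iterD.
  have := hQ ((Q + m) * k)%N; rewrite /riter zq; apply.
  by rewrite (leq_trans (leq_addr m Q)) // leq_pmulr.
have gap : 0 < del - dist (iter M g u) z by rewrite subr_gt0.
have [e' e'0 he'] := iter_cont M u del0.
have m0 : 0 < Num.min e e' by rewrite lt_min e0.
(* Points of the cycle are recurrent, so [y] is chosen off the cycle: its orbit approaches the cycle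
   and from some time on stays away from [y]. *)
have [y] := near_avoid u (mkseq (fun j => iter j g z) k) m0.
rewrite lt_min => /andP[y1 y2] /negP; apply.
have yrec : recur g y by apply/recurrentP; exact: he.
have yM : dist (iter M g y) z < del.
  by apply: (@chordal_lt _ _ (iter M g u)) => //; exact: he'.
have := contracting_basin hc yM; rewrite /basin /=; under eq_fun do rewrite -cdistE.
move=> /cvg0P h.
have zm n : iter n g z \in mkseq (fun j => iter j g z) k.
  rewrite (divn_eq n k) addnC iterD zq; apply/mapP; exists (n %% k)%N => //.
  by rewrite mem_iota ltn_pmod.
apply: contrapT => /negP ynot.
have [|ep ep0 hep] := @seq_pos_lb R _ (mkseq (fun j => iter j g z) k) (dist y).
  by move=> t tl; rewrite chordal_gt0; apply: contraNneq ynot => ->.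
have [n|Q hQ] := h _ ep ep0; first exact: chordal_ge0.
have [n Qn hn] := yrec ep (Q + M)%N ep0.
have := hQ (n - M)%N; rewrite leq_subRL ?(leq_trans (leq_addl _ _) Qn) // addnC Qn => /(_ isT).
rewrite /riter -iterD subnK ?(leq_trans (leq_addl _ _) Qn) // => hn'.
have := hep _ (zm (n - M)%N); rewrite leNgt => /negP; apply.
by apply: (@chordal_lt _ _ (iter n g y)) => //; rewrite chordalC.
Qed.

Lemma component_sub x X : open_affinoid v X -> X x -> (forall y, X y -> Fatou v f y) ->
  omits_three (forward_orbit f X) -> X `<=` Fatou_component_at v f x.
Proof. by move=> h1 h2 h3 h4 y Xy; exists X. Qed.

(** In the attracted case a pulled back affinoid connects [x] inside its component to a point [u]
    with [iter N g u = z]; as [z] is periodic, it lies in two images of the component. In the other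
    case a return of [iter m g x] near itself is, by openness, the image under [iter m g] of a point
    near [x]. *)
Lemma no_wandering : (forall x, Fatou v f x -> backward_orbit f (attracting_domain v f) x \/
    backward_orbit f (quasi_periodicity_domain v f) x) ->
  ~ (exists C, Fatou_component v f C /\ wandering f C).
Proof.
move=> hF [C [[x xF CE] hw]].
have meet i j (s t : option K) : C s -> C t -> iter i g s = iter j g t -> i = j.
  by move=> Cs Ct e; apply: hw => //; exists (iter i g s); split; [exists s|exists t].
have [/domain_attracted[z zat hz]|[m _ /= /nbhsP[e e0 he]]] := hF x xF.
  have [k [del [l hc]]] := attracting_contracting zat; have [k0 kz _ _ _] := hc.
  have [e /andP[e0 _] ho] := contracting_omits hc.
  have e1 : 0 < Num.min e 1 by rewrite lt_min e0 ltr01.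
  have [N hN] := hz _ e1.
  have [|V [hV Vx Ve [u Vu uz]]] := pullback_affinoid (dg N) (hgi N) hN.
    by rewrite ge_min lexx orbT.
  have {}Ve y : V y -> dist (iter N g y) z < e by move=> /Ve; rewrite lt_min => /andP[].
  have Cu : C u.
    rewrite CE; apply: (component_sub hV Vx) Vu.
      by move=> y /Ve h; apply: (@Fatou_backward N); exact: Fatou_ball ho h.
    exact: (@omits_pull N _ V _ ho).
  have := meet N (k + N)%N u u Cu Cu; rewrite iterD uz kz => /(_ erefl).
  by move=> /eqP; rewrite -{1}[N]add0n eqn_add2r => /eqP h; rewrite -h in k0.
have [e' e'0 ho] := (proj1 (FatouP x)) xF.
have [c c0 [ce [hA _]]] := small_affinoid x e'0.
have vc0 : 0 < v c by rewrite uabs_gt0.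
have sub y : dist y x < v c -> C y.
  move: y; rewrite CE; apply: (component_sub hA); first by rewrite /= chordalxx.
    by move=> t /= tx; apply: (Fatou_ball ho); exact: lt_trans ce.
  by apply: omits_sub ho => t /= tx; exact: lt_trans ce.
have [e2 e20 h2] := ratlmap_open x (dg m) (hgi m) vc0.
have /recurrentP xrec : recurrent v f (iter m g x) by apply: he; rewrite chordalxx.
have [n n1 hn] := xrec e2 1%N e20; have [y yx yE] := h2 _ hn.
have := meet m (n + m)%N y x; rewrite iterD => /(_ (sub _ yx)).
rewrite yE => /(_ _ erefl); rewrite -{1}[m]add0n => /(_ _)/eqP; rewrite eqn_add2r => h.
have {}h : 0%N == n by apply: h; apply: sub; rewrite chordalxx.
by move: n1; rewrite -(eqP h).
Qed.

(** With [x] sent to infinity the holes are bounded. *)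
Lemma affinoid_nbhs X x : open_affinoid v X -> X x ->
  exists2 e : R, 0 < e & forall y, dist y x < e -> X y.
Proof.
move=> hX Xx; have [M [N [hM Mx]]] := misom_to_inf x; have [[MN NM dM] _] := hM.
have [k [c [e [e0 hXE]]]] := affinoid_holes hX Xx hM Mx.
pose S := 1 + \sum_i (v (c i) + v (e i)).
have S1 : 1 <= S by rewrite lerDl sumr_ge0 // => i _; rewrite addr_ge0 ?uabs_ge0.
have S0 : 0 < S := lt_le_trans ltr01 S1.
exists S^-1; first by rewrite invr_gt0.
move=> y; have [->//|yx] := eqVneq y x; have [t yt] := misom_none hM Mx yx.
have -> : y = N (Some t) by rewrite -yt MN.
rewrite -dM NM Mx chordal_inf ltf_pV2 ?posrE ?lt_max ?ltr01 ?orbT // => h; apply/hXE => i.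
have hi : v (c i) + v (e i) <= S.
  rewrite /S (bigD1 i) //= addrCA lerDl addr_ge0 ?ler01 // sumr_ge0 // => j _.
  by rewrite addr_ge0 ?uabs_ge0.
have tS : S < v t by case/orP: h => //; rewrite ltNge S1.
have ct : v (c i) < v t by apply: le_lt_trans tS; apply: le_trans hi; rewrite lerDl uabs_ge0.
by rewrite uabsB_eql //; apply: le_lt_trans tS; apply: le_trans hi; rewrite lerDr uabs_ge0.
Qed.

(** The cases are separated by whether some disc around [x] has iterates of arbitrarily small
    oscillation. Only then do [a] and [b] enter; in the other case two omitted values suffice. *)
Lemma nonwandering_point x X Y (a b : option K) m k : (0 < k)%N ->
  open_affinoid v X -> open_affinoid v Y -> X x -> Y x -> X a -> Y b ->
  omits_three (forward_orbit f X) -> omits_three (forward_orbit f Y) ->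
  iter m g a = iter (m + k) g b ->
  backward_orbit f (attracting_domain v f) x \/ backward_orbit f (quasi_periodicity_domain v f) x.
Proof.
move=> k0 hX hY Xx Yx Xa Yb oX oY hab.
have quasi N (rho : R) : 0 < rho -> (forall z, dist z (iter N g x) < rho -> recur g z) ->
    backward_orbit f (quasi_periodicity_domain v f) x.
  move=> rho0 h; exists N => //=; apply/nbhsP; exists rho => // y hy.
  by apply/recurrentP; exact: h.
have [eX eX0 hXx] := affinoid_nbhs hX Xx; have [eY eY0 hYx] := affinoid_nbhs hY Yx.
pose r0 := Num.min eX eY; have r00 : 0 < r0 by rewrite lt_min eX0.
have rX z : dist z x < r0 -> X z by rewrite lt_min => /andP[/hXx].
have rY z : dist z x < r0 -> Y z by rewrite lt_min => /andP[_ /hYx].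
have oX' M := orbit_omits M oX; have oY' M := orbit_omits M oY.
have [[r /andP[r_gt0 rr] hcol]|hno] := pselect (exists2 r : R, 0 < r <= r0 &
    forall e : R, 0 < e -> exists N, osc g x r N e).
  have r0X z : dist z x < r -> X z by move=> h; apply: rX; exact: lt_le_trans rr.
  have r0Y z : dist z x < r -> Y z by move=> h; apply: rY; exact: lt_le_trans rr.
  have [[N [rho rho0 h]]|[N [c [rho [rho0 hc Nc [l l01 hl]]]]]] :=
    collapse_fixed hf hg r_gt0 k0 hX hY Xa Yb r0X r0Y oX' oY' hab hcol.
  - by right; exact: quasi h.
  left; apply: (@attracted_domain k c rho l N) Nc; split => // y yc.
  by apply: hl; exact: ltW.
right; have [ws [u sw] hw] := oX' 2.
case: ws u sw hw => [|w1 [|w2 [|]]] //= /andP[h _] _ hw.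
have [||||N [rho rho0 hr]] := @noncollapse_recur _ _ _ _ hf hg x r0 w1 w2 r00.
- by rewrite inE in h.
- by move=> n z /rX Xz; apply: hw => //; rewrite inE eqxx.
- by move=> n z /rX Xz; apply: hw => //; rewrite !inE eqxx orbT.
- move=> r r_gt0; apply: contrapT => hr; apply: hno; exists (Num.min r r0).
    by rewrite lt_min r_gt0 r00 ge_min lexx orbT.
  move=> e e0; apply: contrapT => he; apply: hr; exists (e / 2); first by rewrite divr_gt0.
  move=> N; apply: contrapT => hN; apply: he; exists N => z; rewrite lt_min => /andP[zr _].
  rewrite ltNge; apply/negP => ez; apply: hN; exists z => //; apply: lt_le_trans ez.
  by rewrite ltr_pdivrMr // ltr_pMr // ltr1n.
exact: quasi hr.
Qed.

Lemma nonwandering_Fatou x : ~ (exists C, Fatou_component v f C /\ wandering f C) ->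
  Fatou v f x ->
  backward_orbit f (attracting_domain v f) x \/ backward_orbit f (quasi_periodicity_domain v f) x.
Proof.
move=> hno xF; apply: contrapT => hx; apply: hno.
exists (Fatou_component_at v f x); split; first by exists x.
have key i j : (i < j)%N -> (riter f i @` Fatou_component_at v f x) `&`
    (riter f j @` Fatou_component_at v f x) !=set0 -> False.
  move=> ij [w [[a [X [hX _ Xx oX] Xa] aw] [b [Y [hY _ Yx oY] Yb] bw]]]; apply: hx.
  apply: (@nonwandering_point x X Y a b i (j - i)) => //; first by rewrite subn_gt0.
  by rewrite subnKC ?(ltnW ij) // -[LHS]/(riter f i a) aw -bw.
move=> i j _ _ hij; have [h|h|//] := ltngtP i j; first by case: (key i j h).
by rewrite setIC in hij; case: (key j i h).
Qed.

Lemma Fatou_decomposition :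
  (Fatou v f = backward_orbit f (attracting_domain v f) `|`
     backward_orbit f (quasi_periodicity_domain v f) /\
   backward_orbit f (attracting_domain v f) `&`
     backward_orbit f (quasi_periodicity_domain v f) = set0) <->
  ~ (exists C, Fatou_component v f C /\ wandering f C).
Proof.
split=> [[hF _]|hno].
  by apply: no_wandering => x; rewrite hF.
split; last exact: attracted_quasi_disjoint.
apply/seteqP; split=> [x|x [|]]; [exact: nonwandering_Fatou|exact: attracted_Fatou|exact: quasi_Fatou].
Qed.

End Dynamics.

(** * The arithmetic of C_p *)

(** The elements of [s] are adjoined one by one; reduction modulo a polynomial annihilating [a]
    bounds the powers of [a]. The family [b] spans and need not be free. *)
Lemma finite_extension (Q E : fieldType) (j : {rmorphism Q -> E}) (s : seq E) :
  (forall u : E, algebraicOver j u) ->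
  exists (F : fieldType) (rho : {rmorphism Q -> F}) (iota : {rmorphism F -> E})
    (I : finType) (b : I -> E),
    [/\ forall q, iota (rho q) = j q, forall c, c \in s -> exists y, iota y = c &
        forall y, exists u : I -> Q, iota y = \sum_i j (u i) * b i].
Proof.
move=> hj; elim: s => [|a s [F [rho [iota [I [b [hrho hs hb]]]]]]].
  exists Q, idfun, j, unit, (fun=> 1); split => // y; exists (fun=> y).
  by rewrite (big_pred1 tt) ?mulr1 //; case.
have [p p0 pa] := hj a; pose p' := map_poly rho p.
have p'0 : p' != 0 by rewrite map_poly_eq0.
have p'a : root (map_poly iota p') a by rewrite -map_poly_comp (eq_map_poly hrho).
have hev := subfx_inj_eval p'a p'0.
exists (subFExtend iota a p'), (inj_subfx iota a p' \o rho), (@subfx_inj F E iota a p').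
exists (I * 'I_(size p'))%type, (fun x : I * 'I_(size p') => b x.1 * a ^+ x.2); split.
- move=> q; transitivity (iota (rho q)); last exact: hrho.
  by rewrite /= /inj_subfx /= hev map_polyC hornerC.
- move=> c; rewrite inE => /predU1P[->|/hs[y <-]].
    by exists (subfx_root iota a p'); exact: subfx_inj_root.
  by exists (inj_subfx iota a p' y); rewrite /inj_subfx /= hev map_polyC hornerC.
move=> y; have [q ->] := subfxE y.
have [u hu] := choice hb; exists (fun x : I * 'I_(size p') => u (q %% p')`_x.2 x.1).
transitivity ((map_poly iota q).[a]); first exact: hev.
rewrite {1}(divp_eq q p') rmorphD rmorphM /= hornerD hornerM (rootP p'a) mulr0 add0r.
have sq : (size (map_poly iota (q %% p')) <= size p')%N.
  by rewrite size_map_poly ltnW // ltn_modp.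
rewrite (horner_coef_wide _ sq) -(pair_bigA _ (fun i (l : 'I_(size p')) =>
  j (u (q %% p')`_l i) * (b i * a ^+ l))) /= exchange_big /=.
have hc l : (map_poly iota (q %% p'))`_l = iota (q %% p')`_l := coef_map iota _ l.
by apply: eq_bigr => l _; rewrite hc hu mulr_suml; apply: eq_bigr => i _; rewrite mulrA.
Qed.

(** * Algebraic closedness passes to the completion *)

Section Completion.
Variables (R : realType) (K : ultraField R).
Local Notation v := (@uabs R K).

Lemma poly_lipschitz (P : {poly K}) (C : R) : 0 <= C -> exists2 A : R, 0 <= A &
  forall x y, v x <= C -> v y <= C -> v P.[x] <= A /\ v (P.[x] - P.[y]) <= A * v (x - y).
Proof.
move=> C0; elim/poly_ind: P => [|P c [A A0 IH]].
  by exists 0 => // x y _ _; rewrite !horner0 subrr uabs0 mul0r.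
exists (A * C + A + v c); first by rewrite !addr_ge0 ?mulr_ge0 ?uabs_ge0.
move=> x y hx hy; rewrite !hornerMXaddC; have [h1 h2] := IH x y hx hy.
have [h3 _] := IH y x hy hx; have AC : 0 <= A * C by rewrite mulr_ge0.
have c0 := uabs_ge0 c; split.
  apply: uabsD_le; last by rewrite lerDr addr_ge0.
  rewrite uabsM; apply: le_trans (ler_pM (uabs_ge0 _) (uabs_ge0 _) h1 hx) _.
  by rewrite -addrA lerDl addr_ge0.
have -> : P.[x] * x + c - (P.[y] * y + c) = (P.[x] - P.[y]) * x + P.[y] * (x - y) by ring.
have D0 := uabs_ge0 (x - y); apply: uabsD_le; rewrite uabsM.
  apply: le_trans (ler_pM (uabs_ge0 _) (uabs_ge0 _) h2 hx) _.
  by rewrite mulrAC; apply: ler_wpM2r => //; rewrite -addrA lerDl addr_ge0.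
apply: ler_wpM2r => //; apply: le_trans h3 _.
by rewrite -addrA addrCA lerDl addr_ge0.
Qed.

Variables (E : closedFieldType) (k : {rmorphism E -> K}).
Hypothesis dense : forall (y : K) (e : R), 0 < e -> exists x : E, v (y - k x) < e.
Hypothesis complete : complete_abs v.

(* z' is a root of an approximation of P over E: the product of the distances of
   z to these roots is small, hence so is one of them. *)
Lemma near_root (P : {poly K}) n (C : R) : P \is monic -> size P = n.+2 -> 1 <= C ->
  (forall i, v P`_i <= C) -> forall z (e d : R), 0 < e -> v z <= C -> v P.[z] < d ->
  exists z', [/\ v z' <= C, v P.[z'] < e & v (z - z') ^+ n.+1 < d].
Proof.
move=> Pm sP C1 hC z e d e0 hz hd; have C0 := lt_le_trans ltr01 C1.
have d0 : 0 < d := le_lt_trans (uabs_ge0 _) hd.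
have Cn : 0 < C ^+ n.+1 by apply: exprn_gt0.
(* Changing the coefficients by at most [m] changes the values on the disc of radius [C] by less
   than [e] and [d]. *)
pose m := Num.min 1 (Num.min e d / C ^+ n.+1 / 2).
have m0 : 0 < m by rewrite lt_min ltr01 !divr_gt0 // lt_min e0.
have mC : m * C ^+ n.+1 < Num.min e d.
  apply: le_lt_trans (_ : Num.min e d / 2 < _); last first.
    by rewrite ltr_pdivrMr // ltr_pMr ?lt_min ?e0 // ltr1n.
  by rewrite -ler_pdivlMr // mulrAC ge_min lexx orbT.
have [a ha] := choice (fun y => dense y m0).
pose Q : {poly E} := \poly_(i < n.+2) (if i == n.+1 then 1 else a P`_i).
have Qm : Q`_n.+1 = 1 by rewrite coef_poly ltnSn eqxx.
have sQ : size Q = n.+2 by rewrite size_poly_eq //= eqxx oner_eq0.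
have lQ : lead_coef Q = 1 by rewrite lead_coefE sQ.
have hk i : (map_poly k Q)`_i = k Q`_i := coef_map k Q i.
have hPQ i : v (P`_i - (map_poly k Q)`_i) <= m.
  rewrite hk coef_poly; case: ltnP => h; last first.
    by rewrite (rmorph0 k) nth_default ?sP // subrr uabs0 ltW.
  case: eqP => [->|_]; last by rewrite ltW.
  have /monicP := Pm; rewrite lead_coefE sP /= => ->.
  by rewrite rmorph1 subrr uabs0 ltW.
have hdiff y : v y <= C -> v (P.[y] - (map_poly k Q).[y]) < Num.min e d.
  move=> hy; apply: le_lt_trans mC; have sP' : (size P <= n.+2)%N by rewrite sP.
  have sQ' : (size (map_poly k Q) <= n.+2)%N by rewrite size_map_poly sQ.
  rewrite (horner_coef_wide _ sP') (horner_coef_wide _ sQ') -sumrB.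
  apply: uabs_sum_le; first by rewrite mulr_ge0 // ltW.
  move=> i; rewrite -mulrBl uabsM uabsX; apply: ler_pM; rewrite ?exprn_ge0 ?uabs_ge0 //.
  apply: le_trans (_ : C ^+ i <= _); first by apply: lerXn2r; rewrite ?nnegrE ?uabs_ge0 // ltW.
  by apply: ler_weXn2l => //; rewrite -ltnS ltn_ord.
have [r hr] := closed_field_poly_normal Q; rewrite lQ scale1r in hr.
have Qz y : (map_poly k Q).[y] = \prod_(b <- r) (y - k b).
  rewrite hr rmorph_prod /= horner_prod; apply: eq_bigr => b _.
  by rewrite rmorphB /= map_polyX map_polyC !hornerE.
have sr : size r = n.+1 by apply: succn_inj; rewrite -sQ hr size_prod_XsubC.
(* For a monic polynomial with coefficients bounded by [C >= 1], the leading term dominates beyond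
   [C]. *)
have hroot b : b \in r -> v (k b) <= C.
  move=> br; rewrite leNgt; apply/negP => Cb.
  have := Qz (k b); rewrite (big_rem b br) /= subrr mul0r => /eqP.
  have sQ' : (size (map_poly k Q) <= n.+2)%N by rewrite size_map_poly sQ.
  rewrite (horner_coef_wide _ sQ') big_ord_recr /= hk Qm (rmorph1 k) mul1r addrC addr_eq0 => /eqP eb.
  have vb : 0 < v (k b) := lt_trans C0 Cb.
  have : v (k b ^+ n.+1) <= C * v (k b) ^+ n.
    rewrite eb uabsN; apply: uabs_sum_le; first by rewrite mulr_ge0 ?exprn_ge0 ?uabs_ge0 // ltW.
    move=> i; rewrite uabsM uabsX; apply: ler_pM; rewrite ?exprn_ge0 ?uabs_ge0 //.
      rewrite -[X in v X](subKr P`_i); apply: uabsB_le => //.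
      by apply: le_trans (hPQ i) _; rewrite ge_min C1.
    apply: ler_weXn2l; first exact: ltW (le_lt_trans C1 Cb).
    by rewrite -ltnS.
  by rewrite uabsX exprS leNgt ltr_pM2r ?Cb // exprn_gt0.
have hQz : v (map_poly k Q).[z] < d.
  rewrite -[X in v X](subKr P.[z]); apply: uabsB_lt => //.
  by apply: lt_le_trans (hdiff z hz) _; rewrite ge_min lexx orbT.
have [b br hb] : exists2 b, b \in r & v (z - k b) ^+ n.+1 < d.
  apply: contrapT => hno; have hge b : b \in r -> d <= v (z - k b) ^+ n.+1.
    by move=> br; rewrite leNgt; apply/negP => h; apply: hno; exists b.
  have := prod_ge_exp (ltW d0) hge; rewrite sr prodrXl -uabs_prod -Qz.
  by rewrite ler_pXn2r ?nnegrE ?uabs_ge0 ?(ltW d0) // leNgt hQz.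
exists (k b); split => //; first exact: hroot.
have Qb : (map_poly k Q).[k b] = 0 by rewrite Qz (big_rem b br) /= subrr mul0r.
have := hdiff (k b) (hroot b br); rewrite Qb subr0 => h; apply: lt_le_trans h _.
by rewrite ge_min lexx.
Qed.

(** Approximate roots are refined by [near_root]. A value below [h ^+ (n.+1 * i)] moves the point by
    at most [h ^+ i], as one root out of n + 1 absorbs the smallness; with [h = 1 / 2] the sequence
    is Cauchy. *)
Lemma complete_root (P : {poly K}) : (1 < size P)%N -> exists x, root P x.
Proof.
move=> sP; wlog Pm : P sP / P \is monic => [hw|].
  have P0 : P != 0 by rewrite -size_poly_gt0 ltnW.
  have l0 : lead_coef P != 0 by rewrite lead_coef_eq0.
  have [||x] := hw ((lead_coef P)^-1 *: P).
  - by rewrite size_scale // invr_eq0.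
  - by rewrite monicE lead_coefZ mulVf.
  by rewrite rootZ ?invr_eq0 // => ?; exists x.
have [n sn] : exists n, size P = n.+2 by case: (size P) sP => [|[|n]] // _; exists n.
pose C := 1 + \sum_(c <- P) v c.
have C1 : 1 <= C by rewrite lerDl sumr_ge0 // => *; exact: uabs_ge0.
have C0 := lt_le_trans ltr01 C1.
have hC i : v P`_i <= C.
  have [h|h] := ltnP i (size P); last by rewrite nth_default // uabs0 ltW.
  rewrite /C (big_rem P`_i) ?mem_nth //= addrCA lerDl addr_ge0 // sumr_ge0 // => *.
  exact: uabs_ge0.
have hnear := near_root Pm sn C1 hC.
pose h : R := 1 / 2; have h0 : 0 < h by rewrite divr_gt0.
have h1 : h < 1 by rewrite ltr_pdivrMr // mul1r ltr1n.
have hp i : 0 < (h ^+ n.+1) ^+ i by rewrite !exprn_gt0.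
have stepP (q : nat * K) : exists z', v q.2 <= C -> v P.[q.2] < (h ^+ n.+1) ^+ q.1 ->
    [/\ v z' <= C, v P.[z'] < (h ^+ n.+1) ^+ q.1.+1 & v (q.2 - z') ^+ n.+1 < (h ^+ n.+1) ^+ q.1].
  have [[a b]|] := pselect (v q.2 <= C /\ v P.[q.2] < (h ^+ n.+1) ^+ q.1).
    by have [z' hz'] := hnear _ _ _ (hp q.1.+1) a b; exists z'.
  by move=> hn; exists 0 => a b; case: hn.
have [nx hnx] := choice stepP.
have [z0 [z01 z02 _]] : exists z', [/\ v z' <= C, v P.[z'] < 1 & v (0 - z') ^+ n.+1 < v P.[0] + 1].
  by apply: hnear => //; rewrite ?uabs0 ?ltW // ltrDl.
pose u := fix u i := if i is i'.+1 then nx (i', u i') else z0.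
have hu i : v (u i) <= C /\ v P.[u i] < (h ^+ n.+1) ^+ i.
  elim: i => [|i [IH1 IH2]]; first by rewrite expr0.
  by have [] := hnx (i, u i) IH1 IH2.
have ustep i : v (u i.+1 - u i) <= h ^+ i.
  have [hi1 hi2] := hu i; have [_ _] := hnx (i, u i) hi1 hi2 => /ltW.
  rewrite exprAC ler_pXn2r ?nnegrE ?uabs_ge0 ?exprn_ge0 ?(ltW h0) //.
  by rewrite uabs_distC.
have ucau N m : (N <= m)%N -> v (u m - u N) <= h ^+ N.
  move=> Nm; rewrite -(subnK Nm); elim: (m - N)%N => [|i IH].
    by rewrite add0n subrr uabs0 exprn_ge0 // ltW.
  rewrite addSn; apply: (@uabs_dist_le _ _ (u (i + N)%N)) => //.
  apply: le_trans (ustep _) _; apply: ler_wiXn2l; rewrite ?leq_addl //; exact: ltW.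
have hsm (e : R) : 0 < e -> exists N, h ^+ N < e.
  by apply: exprn_small; rewrite (ltW h0).
have [l hl] : exists l, (fun i => v (u i - l)) @ \oo --> (0 : R).
  apply: complete => e e0; have [N hN] := hsm e e0; exists N => i i' Ni Ni'.
  apply: le_lt_trans hN; apply: (@uabs_dist_le _ _ (u N)); first exact: ucau.
  by rewrite uabs_distC; exact: ucau.
have ul e : 0 < e -> exists N, forall i, (N <= i)%N -> v (u i - l) < e.
  move=> e0; move/cvgrPdist_lt: hl => /(_ e e0)[N _ hN]; exists N => i /hN.
  by rewrite sub0r normrN ger0_norm ?uabs_ge0.
have lC : v l <= C.
  have [N /(_ N (leqnn _)) hN] := ul C C0; rewrite -[l](subKr (u N)).
  by apply: uabsB_le; [case: (hu N)|exact: ltW].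
have [A A0 hA] := poly_lipschitz P (ltW C0).
exists l; rewrite rootE -uabs_eq0 eq_le uabs_ge0 andbT leNgt; apply/negP => Pl.
have A1 : 0 < A + 1 by rewrite ltr_wpDl.
have e0 : 0 < v P.[l] / (A + 1) by rewrite divr_gt0.
have [N hN] := ul _ e0; have hn1 : h ^+ n.+1 < 1 by rewrite exprn_ilt1 // ltW.
have [N' hN'] : exists N', (h ^+ n.+1) ^+ N' < v P.[l].
  by apply: exprn_small; rewrite // hn1 exprn_ge0 // ltW.
pose M := maxn N N'; have [uM1 uM2] := hu M.
have [_ h2] := hA _ _ lC uM1.
have : v P.[l] < v P.[l].
  rewrite -{1}[P.[l]](subrK P.[u M]); apply: uabsD_lt.
    apply: le_lt_trans h2 _; apply: le_lt_trans (_ : A * (v P.[l] / (A + 1)) < _).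
      by apply: ler_wpM2l => //; rewrite uabs_distC ltW // hN // leq_maxl.
    by rewrite mulrCA gtr_pMr // ltr_pdivrMr // mul1r ltrDl.
  apply: lt_trans uM2 _; apply: le_lt_trans hN'.
  apply: ler_wiXn2l; rewrite ?leq_maxr //; last exact: ltW.
  by rewrite exprn_ge0 // ltW.
by rewrite ltxx.
Qed.

End Completion.

(** * Total boundedness of the integers of a finite extension *)

Section Residue.
Variables (R : realType) (K : ultraField R) (p : nat).
Local Notation v := (@uabs R K).
Hypotheses (pp : prime p) (vp : v p%:R < 1) (char0 : forall n, n.+1%:R != 0 :> K).

Let p_gt0 : (0 < p)%N := prime_gt0 pp.

Lemma uabs_dvd n : (p %| n)%N -> v n%:R <= v p%:R.
Proof.
by move=> /dvdnP[m ->]; rewrite natrM uabsM ler_piMl ?uabs_ge0 ?uabs_nat.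
Qed.

Lemma minus_inverse n : ~~ (p %| n)%N -> exists a, (p %| 1 + a * n)%N.
Proof.
move=> pn; have [a _] := Bezoutl n p_gt0.
have /eqP -> : coprime p n by rewrite prime_coprime.
by exists a.
Qed.

Lemma uabs_coprime n : ~~ (p %| n)%N -> v n%:R = 1.
Proof.
move=> /minus_inverse[a /uabs_dvd h]; apply/eqP; rewrite eq_le uabs_nat /= leNgt; apply/negP => n1.
have : v (1 : K) < 1.
  rewrite -[X in v X](addrK ((a * n)%:R : K)); apply: uabsB_lt; first by rewrite -(natrD _ 1) (le_lt_trans h).
  rewrite natrM uabsM; apply: le_lt_trans n1.
  by rewrite ler_piMl ?uabs_ge0 ?uabs_nat.
by rewrite uabs1 ltxx.
Qed.

Lemma rat_nat_approx (i : {rmorphism rat -> K}) (r : rat) : v (i r) <= 1 ->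
  exists n : nat, v (i r - n%:R) <= v p%:R.
Proof.
have vint (z : int) : v z%:~R = v (`|z|%N)%:R.
  by case: (intP z) => [|n|n]; rewrite ?absz0 ?abszN //= rmorphN /= uabsN.
pose a := numq r; pose D := `|denq r|%N.
have D0 : (0 < D)%N by rewrite absz_gt0 denq_neq0.
have iD : (D%:R : K) != 0 by case: (D) D0.
have ir : i r = a%:~R / D%:R.
  rewrite -{1}(divq_num_den r) fmorph_div !rmorph_int; congr (_ / _).
  by rewrite -{1}[denq r](gez0_abs (denq_ge0 r)) -pmulrn.
have vD0 : 0 < v D%:R by rewrite uabs_gt0.
rewrite ir uabs_div ler_pdivrMr // mul1r vint => hle.
have pD : ~~ (p %| D)%N.
  apply/negP => pD; have pa : ~~ (p %| `|a|)%N.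
    apply/negP => pa; have := coprime_num_den r; rewrite -/a -/D => /eqP h.
    have : (p %| gcdn `|a| D)%N by rewrite dvdn_gcd pa.
    by rewrite h dvdn1 => /eqP p1; move: pp; rewrite p1.
  move: hle; rewrite (uabs_coprime pa) leNgt; apply/negP/negPn.
  by apply: le_lt_trans vp; exact: uabs_dvd.
have [c hc] := minus_inverse pD; have vD := uabs_coprime pD.
have hn (n : nat) : v (a%:~R - n%:R * D%:R) <= v p%:R -> v (a%:~R / D%:R - n%:R) <= v p%:R.
  move=> h; have -> : a%:~R / D%:R - n%:R = (a%:~R - n%:R * D%:R) / D%:R :> K by field.
  by rewrite uabs_div vD divr1.
have hc' : v (1 + c%:R * D%:R) <= v p%:R by have := uabs_dvd hc; rewrite natrD natrM.
case: (intP a) hn => [|m|m] hn.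
- by exists 0%N; apply: hn; rewrite mul0r subrr uabs0 uabs_ge0.
(* Modulo p the inverse of [D] is [- c]; the factor [p.-1] replaces the sign, so that the
   representative is a natural number. *)
- exists (p.-1 * m.+1 * c)%N; apply: hn.
  have -> : (m.+1)%:Z%:~R - (p.-1 * m.+1 * c)%:R * D%:R =
      m.+1%:R * (1 + c%:R * D%:R) - p%:R * (m.+1%:R * c%:R * D%:R) :> K.
    by rewrite -{2}(prednK p_gt0) -[in p.-1.+1%:R]addn1 !natrM natrD -pmulrn; ring.
  apply: uabsB_le; rewrite uabsM.
    by apply: le_trans hc'; rewrite ler_piMl ?uabs_ge0 ?uabs_nat.
  by rewrite -!natrM ler_piMr ?uabs_ge0 ?uabs_nat.
exists (m.+1 * c)%N; apply: hn.
have -> : (- m.+1%:Z)%:~R - (m.+1 * c)%:R * D%:R = - (m.+1%:R * (1 + c%:R * D%:R)) :> K.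
  by rewrite rmorphN /= natrM -pmulrn; ring.
by rewrite uabsN uabsM; apply: le_trans hc'; rewrite ler_piMl ?uabs_ge0 ?uabs_nat.
Qed.

Variables (Q : fieldType) (j : {rmorphism Q -> K}) (I : finType) (b : I -> K) (L : set K).
Hypothesis nat_dense : forall c : Q, v (j c) <= 1 -> exists n : nat, v (j c - n%:R) <= v p%:R.
Hypothesis span : forall x, L x -> exists u : I -> Q, x = \sum_i j (u i) * b i.
Hypotheses (L1 : L 1) (LB : forall x y, L x -> L y -> L (x - y))
  (LM : forall x y, L x -> L y -> L (x * y)) (LV : forall x, L x -> L x^-1).

(** Linear independence over the field with p elements of the classes of the [e i] modulo elements
    of norm at most [v p%:R], with coefficients represented by natural numbers. *)
Definition mod_free t (e : nat -> K) := forall n : nat -> nat,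
  (exists2 i, (i < t)%N & ~~ (p %| n i)%N) -> v p%:R < v (\sum_(i < t) (n i)%:R * e i).

(** More than [#|I|] elements are linearly dependent over [Q]. Dividing the relation by its largest
    coefficient makes it integral with one coefficient 1, and it reduces to a nontrivial relation
    modulo p. *)
Lemma mod_free_size t (e : nat -> K) : (forall i, (i < t)%N -> L (e i) /\ v (e i) <= 1) ->
  mod_free t e -> (t <= #|I|)%N.
Proof.
move=> he hfree; rewrite leqNgt; apply/negP => hI; case: t he hfree hI => // t he hfree hI.
have hu (i : 'I_t.+1) : exists u : I -> Q, e i = \sum_l j (u l) * b l.
  by apply: span; case: (he i (ltn_ord i)).
have [u {}hu] := choice hu; pose C : 'M[Q]_(t.+1, #|I|) := \matrix_(i, l) u i (enum_val l).
have : kermx C != 0.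
  by rewrite -mxrank_eq0 mxrank_ker subn_eq0 -ltnNge (leq_ltn_trans (rank_leq_col _)).
case/rowV0Pn => w /sub_kermxP wC w0.
have rel : \sum_i j (w 0 i) * e i = 0.
  transitivity (\sum_i \sum_l j (w 0 i * u i l) * b l).
    by apply: eq_bigr => i _; rewrite hu mulr_sumr; apply: eq_bigr => l _; rewrite rmorphM mulrA.
  rewrite exchange_big big1 // => l _; rewrite -mulr_suml -rmorph_sum /=.
  have := congr1 (fun M : 'rV_#|I| => M 0 (enum_rank l)) wC; rewrite !mxE => wl.
  rewrite (_ : \sum_i _ = 0) ?rmorph0 ?mul0r // -[RHS]wl; apply: eq_bigr => i _.
  by rewrite mxE enum_rankK.
have [i1 wi1] : exists i1, w 0 i1 != 0.
  apply: contrapT => h; case/negP: w0; apply/eqP/rowP => i; rewrite mxE.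
  by apply: contrapT => /eqP hi; apply: h; exists i.
pose i0 := [arg max_(i > i1) v (j (w 0 i))]%O.
have hmax i : v (j (w 0 i)) <= v (j (w 0 i0)).
  by rewrite /i0; case: arg_maxP => // k _; apply.
have w00 : 0 < v (j (w 0 i0)).
  by apply: lt_le_trans (hmax i1); rewrite uabs_gt0 fmorph_eq0.
have jw0 : j (w 0 i0) != 0 by rewrite -uabs_gt0.
have hn (i : 'I_t.+1) : exists n : nat, v (j (w 0 i / w 0 i0) - n%:R) <= v p%:R.
  by apply: nat_dense; rewrite fmorph_div uabs_div ler_pdivrMr // mul1r.
have [n {}hn] := choice hn.
have pn0 : ~~ (p %| n i0)%N.
  apply/negP => /uabs_dvd h; have := hn i0; rewrite divff -?(fmorph_eq0 j) // rmorph1 => h1.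
  have : v (1 : K) < 1.
    by rewrite -[X in v X](subrK ((n i0)%:R : K)); apply: uabsD_lt; exact: le_lt_trans vp.
  by rewrite uabs1 ltxx.
have := hfree (fun k => n (inord k)); rewrite ltNge => /(_ _)/negP; apply.
  by exists i0; rewrite ?inord_val.
have rel' : \sum_i j (w 0 i / w 0 i0) * e i = 0.
  transitivity ((j (w 0 i0))^-1 * \sum_i j (w 0 i) * e i); last by rewrite rel mulr0.
  rewrite mulr_sumr; apply: eq_bigr => i _.
  by rewrite fmorph_div mulrA [_^-1 * _]mulrC.
have -> : \sum_(i < t.+1) (n (inord i))%:R * e i =
    \sum_(i < t.+1) ((n i)%:R - j (w 0 i / w 0 i0)) * e i.
  transitivity (\sum_(i < t.+1) (n i)%:R * e i - \sum_i j (w 0 i / w 0 i0) * e i).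
    by rewrite rel' subr0; apply: eq_bigr => i _; rewrite inord_val.
  by rewrite -sumrB; apply: eq_bigr => i _; rewrite mulrBl.
apply: uabs_sum_le; first exact: uabs_ge0.
move=> i; rewrite uabsM uabs_distC; apply: le_trans (hn i).
by rewrite ler_piMr ?uabs_ge0 //; case: (he i (ltn_ord i)).
Qed.

Lemma subfield_nat n x : L x -> L (n%:R * x).
Proof.
move=> Lx; have L0 : L 0 by rewrite -(subrr 1); exact: LB.
have LN y : L y -> L (- y) by move=> Ly; rewrite -sub0r; exact: LB.
elim: n => [|n IH]; first by rewrite mul0r.
by rewrite -[n.+1]addn1 natrD mulrDl mul1r -[x in _ + x]opprK; apply: LB => //; exact: LN.
Qed.

(** A free family of maximal length generates modulo p: adding [x] produces a relation in which the
    coefficient of [x] is prime to p, since otherwise the family itself would be dependent. That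
    coefficient is then inverted modulo p. *)
Lemma residue_finite : exists t (e : nat -> K), (forall i, (i < t)%N -> L (e i) /\ v (e i) <= 1) /\
  forall x, L x -> v x <= 1 -> exists c : {ffun 'I_t -> 'I_p},
    v (x - \sum_(i < t) (c i)%:R * e i) <= v p%:R.
Proof.
pose P t := `[< exists2 e : nat -> K, forall i, (i < t)%N -> L (e i) /\ v (e i) <= 1 & mod_free t e >].
have P0 : exists t, P t.
  by exists 0%N; apply/asboolP; exists (fun=> 0) => // n [].
have PI t : P t -> (t <= #|I|)%N by move=> /asboolP[e]; exact: mod_free_size.
case: (ex_maxnP P0 PI) => t /asboolP[e he hfree] hmax.
exists t, e; split => // x Lx x1.
pose e' i := if (i < t)%N then e i else x.
have he' i : (i < t.+1)%N -> L (e' i) /\ v (e' i) <= 1.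
  by rewrite /e'; case: (ltnP i t) => // h _; exact: he.
have [n [i0 [it pn]] hle] : exists2 n : nat -> nat, exists i, (i < t.+1)%N /\ ~~ (p %| n i)%N &
    v (\sum_(i < t.+1) (n i)%:R * e' i) <= v p%:R.
  apply: contrapT => hno; have : (t.+1 <= t)%N.
    apply: hmax; apply/asboolP; exists e' => // n [i it pn]; rewrite ltNge; apply/negP => h.
    by apply: hno; exists n => //; exists i.
  by rewrite ltnn.
set S := \sum_(i < t) (n i)%:R * e i.
have {}hle : v (S + (n t)%:R * x) <= v p%:R.
  move: hle; rewrite big_ord_recr /= {2}/e' ltnn; congr (v (_ + _) <= _).
  by apply: eq_bigr => i _; rewrite /e' ltn_ord.
have pnt : ~~ (p %| n t)%N.
  apply/negP => pnt; have {}it : (i0 < t)%N.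
    by rewrite ltn_neqAle -ltnS it andbT; apply: contraNneq pn => ->.
  have := hfree n; rewrite -/S => /(_ (ex_intro2 _ _ i0 it pn)).
  rewrite ltNge => /negP; apply; rewrite -[S](addrK ((n t)%:R * x)); apply: uabsB_le => //.
  by rewrite uabsM; apply: le_trans (uabs_dvd pnt); rewrite ler_piMr ?uabs_ge0.
have [a ha] := minus_inverse pnt.
exists [ffun i : 'I_t => Ordinal (ltn_pmod (a * n i) p_gt0)].
have -> : x - \sum_(i < t) ([ffun i : 'I_t => Ordinal (ltn_pmod (a * n i) p_gt0)] i)%:R * e i =
   (1 + a * n t)%:R * x - a%:R * (S + (n t)%:R * x) +
   \sum_(i < t) (a * n i - (a * n i) %% p)%:R * e i.
  have -> : \sum_(i < t) (a * n i - (a * n i) %% p)%:R * e i =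
      a%:R * S - \sum_(i < t) ([ffun i : 'I_t => Ordinal (ltn_pmod (a * n i) p_gt0)] i)%:R * e i.
    rewrite mulr_sumr -sumrB; apply: eq_bigr => i _.
    by rewrite ffunE /= natrB ?leq_mod // natrM mulrBl mulrA.
  by rewrite natrD natrM; ring.
apply: uabsD_le; first apply: uabsB_le.
- by rewrite uabsM; apply: le_trans (uabs_dvd ha); rewrite ler_piMr ?uabs_ge0.
- by rewrite uabsM; apply: le_trans hle; rewrite ler_piMl ?uabs_ge0 ?uabs_nat.
apply: uabs_sum_le; first exact: uabs_ge0.
move=> i; rewrite uabsM; have [_ e1] := he i (ltn_ord i).
apply: le_trans (ler_pM (uabs_ge0 _) (uabs_ge0 _) (lexx _) e1) _; rewrite mulr1.
by apply: uabs_dvd; rewrite -eqn_mod_dvd ?leq_mod // modn_mod.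
Qed.

(** The code lists the first [s] digits of an expansion in powers of p; [T (c x)] is the leading
    digit of [x] and [rm x] what remains after division by p. *)
Lemma integers_totally_bounded (s : nat) : exists N (code : K -> 'I_N), forall x y,
  L x -> L y -> v x <= 1 -> v y <= 1 -> code x = code y -> v (x - y) <= v p%:R ^+ s.
Proof.
have [t [e [he hres]]] := residue_finite.
pose T (c : {ffun 'I_t -> 'I_p}) := \sum_(i < t) (c i)%:R * e i.
have hres' x : exists c : {ffun 'I_t -> 'I_p}, L x -> v x <= 1 -> v (x - T c) <= v p%:R.
  have [[Lx x1]|h] := pselect (L x /\ v x <= 1).
    by have [c hc] := hres x Lx x1; exists c.
  by exists [ffun=> Ordinal p_gt0] => Lx x1; case: h.
have [c hc] := choice hres'.
have p0 : (p%:R : K) != 0 by rewrite -(prednK p_gt0).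
have vp0 : 0 < v p%:R by rewrite uabs_gt0.
have L0 : L 0 by rewrite -(subrr 1); exact: LB.
have LT d : L (T d).
  rewrite /T; elim/big_ind: _ => // [x y Lx Ly|i _].
    by rewrite -[y]opprK; apply: LB => //; rewrite -sub0r; exact: LB.
  by apply: subfield_nat; case: (he i (ltn_ord i)).
have Lp : L p%:R by rewrite -[p%:R]mulr1; exact: subfield_nat.
pose rm x := (x - T (c x)) / p%:R.
have Lrm x : L x -> L (rm x) by move=> Lx; apply: LM; [exact: LB|exact: LV].
have rm1 x : L x -> v x <= 1 -> v (rm x) <= 1.
  by move=> Lx x1; rewrite uabs_div ler_pdivrMr // mul1r; exact: hc.
elim: s => [|s [N [code hcode]]].
  by exists 1%N, (fun=> ord0) => x y _ _ x1 y1 _; rewrite expr0; exact: uabsB_le.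
exists #|{: {ffun 'I_t -> 'I_p} * 'I_N}|, (fun x => enum_rank (c x, code (rm x))).
move=> x y Lx Ly x1 y1 /enum_rank_inj[cxy rxy].
have -> : x - y = p%:R * (rm x - rm y) by rewrite /rm cxy; field.
rewrite uabsM exprS; apply: ler_wpM2l; first exact: ltW.
by apply: hcode; rewrite ?rm1 //; exact: Lrm.
Qed.

End Residue.

Lemma padic_abs_prime (R : realType) p : prime p -> padic_abs R p p%:R = p%:R^-1.
Proof.
move=> pp; have p0 := prime_gt0 pp; rewrite /padic_abs pnatr_eq0 eqn0Ngt p0 /=.
have -> : (p%:R : rat) = (p%:Z)%:Q by rewrite -pmulrn.
by rewrite denq_int numq_int /= logn1 logn_prime // eqxx.
Qed.

Theorem mainTheorem5 (p : nat) (hp : prime p) (R : realType)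
    (K : fieldType) (v : K -> R) (hK : is_Cp p v)
    (f : {fraction {poly K}}) (hf : (2 <= rdeg f)%N) :
  (Fatou v f =
     backward_orbit f (attracting_domain v f) `|`
     backward_orbit f (quasi_periodicity_domain v f) /\
   backward_orbit f (attracting_domain v f) `&`
     backward_orbit f (quasi_periodicity_domain v f) = set0)
  <->
  ~ (exists C, Fatou_component v f C /\ wandering f C).
Proof.
case: hK => [Qp [vQp [i [E [vE [j [k [[_ _ hi di] halg _ hj [hv cv hk dk]]]]]]]]].
pose U : ultraField R := @UltraField R K v hv.
have hki (x : rat) : v (k (j (i x))) = padic_abs R p x by rewrite hk hj hi.
have vp : @uabs R U p%:R < 1.
  have -> : (p%:R : U) = k (j (i p%:R)) by rewrite !rmorph_nat.
  rewrite /= hki padic_abs_prime // invf_lt1 ?ltr0n ?prime_gt0 //.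
  by rewrite ltr1n prime_gt1.
have char0 n : (n.+1%:R : U) != 0.
  have -> : (n.+1%:R : U) = k (j (i n.+1%:R)) by rewrite !rmorph_nat.
  by rewrite !fmorph_eq0 pnatr_eq0.
have pE : p.-1.+1 = p by rewrite prednK // prime_gt0.
have vp0 : 0 < @uabs R U p%:R by rewrite uabs_gt0 -pE.
have hroot := @complete_root R U E k dk cv.
(* The closest rational number to within [v p%:R] is again integral, and integral rationals are
   congruent to natural numbers modulo p. *)
have dense (c : Qp) : @uabs R U (k (j c)) <= 1 ->
    exists n : nat, @uabs R U (k (j c) - n%:R) <= @uabs R U p%:R.
  move=> c1; have [r hr] := di c _ vp0.
  have cr : @uabs R U (k (j c) - k (j (i r))) < @uabs R U p%:R.
    by rewrite -!rmorphB /= hk hj.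
  have r1 : @uabs R U (k (j (i r))) <= 1.
    rewrite -[k (j (i r))](subKr (k (j c))); apply: uabsB_le => //.
    by apply: ltW; exact: lt_trans vp.
  have [n hn] := @rat_nat_approx R U p hp vp char0 (k \o j \o i) r r1.
  by exists n; apply: (@uabs_dist_le R U (k (j (i r)))) => //; exact: ltW.
have approx (s : seq U) (e : R) : 0 < e -> exists L : set U,
   [/\ L 1, forall x y, L x -> L y -> L (x - y),
       forall x y, L x -> L y -> L (x * y) & forall x, L x -> L x^-1] /\
   (forall c, c \in s -> exists2 c', L c' & uabs (c - c') < e) /\
   (forall d, 0 < d -> exists N (code : U -> 'I_N), forall x y,
      L x -> L y -> uabs x <= 1 -> uabs y <= 1 -> code x = code y -> uabs (x - y) < d).
  move=> e0; have [a ha] := choice (fun c => dk c e e0).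
  have [F [rho [iota [I [b [hrho hs hb]]]]]] := finite_extension (map a s) halg.
  (* The field generated over [Qp] by elements of the algebraic closure that approximate the members
     of [s]. *)
  pose L : set U := range (k \o iota).
  have L1 : L 1 by exists 1 => //; rewrite /= !rmorph1.
  have LB x y : L x -> L y -> L (x - y).
    by move=> [x' _ <-] [y' _ <-]; exists (x' - y') => //; rewrite /= !rmorphB.
  have LM x y : L x -> L y -> L (x * y).
    by move=> [x' _ <-] [y' _ <-]; exists (x' * y') => //; rewrite /= !rmorphM.
  have LV x : L x -> L x^-1 by move=> [x' _ <-]; exists x'^-1 => //; rewrite /= !fmorphV.
  exists L; split => //; split.
    move=> c cs; have [|y hy] := hs (a c); first exact: map_f.
    by exists (k (a c)); [exists y => //=; rewrite hy|exact: ha].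
  move=> d d0; have span x : L x -> exists u : I -> Qp, x = \sum_l (k \o j) (u l) * k (b l).
    move=> [y _ <-]; have [u hu] := hb y; exists u; rewrite /= hu rmorph_sum /=.
    by apply: eq_bigr => l _; rewrite rmorphM.
  have [n hn] : exists n, @uabs R U p%:R ^+ n < d.
    by apply: exprn_small; rewrite // vp uabs_ge0.
  have [N [code hcode]] := @integers_totally_bounded R U p hp vp char0 Qp (k \o j) I
    (fun l => k (b l)) L dense span L1 LB LM LV n.
  by exists N, code => x y Lx Ly x1 y1 e1; apply: le_lt_trans hn; exact: hcode.
have vp' : @uabs R U p.-1.+1%:R < 1 by rewrite pE.
exact: (@Fatou_decomposition R (@CpField R U hroot p.-1 vp' char0 approx) f hf).
Qed.
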